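(* Let $n\ge 1$ and let $\lambda=(\lambda_0,\dots,\lambda_n)$ be a weight for the quiver of extended Dynkin type $\widetilde{A}_n$ with $\sum_{i=0}^n\lambda_i=0$ and with $\lambda_i\geq 0$ for all $i=1,\dots,n$. Let $\mathcal{O}^\lambda=e_0\Pi^\lambda e_0$. Then $$\mathrm{G}_0(\mathcal{O}^\lambda)\cong\mathbb{Z}\oplus\mathrm{Cl}(\mathcal{O}^\lambda),$$ and $$\mathrm{Cl}(\mathcal{O}^\lambda)\cong L/Q_\lambda\cong P/\langle 2t_i-t_{i-1}-t_{i+1}\mid \lambda_i=0\rangle .$$
   Context: The double quiver $\overline{Q}$ of type $\widetilde{A}_n$ has vertices $0,1,\dots,n$ (indices read modulo $n+1$) and arrows $c_i\colon i\to i+1$ and $d_i\colon i+1\to i$; paths are composed left to right ($pq$ means $p$ then $q$), and $e_i$ is the trivial path at $i$. The deformed preprojective algebra $\Pi^\lambda$ is $\mathbb{C}\overline{Q}$ modulo the relations $d_{i-1}c_{i-1}-c_id_i=\lambda_ie_i$ for all vertices $i$. When $\sum_i\lambda_i=0$, $\mathcal{O}^\lambda=e_0\Pi^\lambda e_0$ is a commutative normal noetherian domain of Krull dimension $2$. $\mathrm{G}_0$ denotes the Grothendieck group of the category of finitely generated modules, and $\mathrm{Cl}$ the divisor class group. $L$ is the weight lattice $L=\mathrm{Span}_{\mathbb{Z}}\{r_0,\dots,r_n\}/(r_0+\cdots+r_n)$ ($r_0,\dots,r_n$ being formal basis elements). With $\nu_i=\lambda_0+\cdots+\lambda_i$, $Q_\lambda\subseteq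 L$ is the subgroup spanned by those roots $r_i-r_j$ ($i\neq j$) that pair to zero with $\lambda$, i.e. those with $\nu_i=\nu_j$. $P\subseteq\bigoplus_{i=0}^n\mathbb{Z}t_i$ is the sublattice spanned by all $t_i-t_j$; in the relations $2t_i-t_{i-1}-t_{i+1}$, the vertex $i$ ranges over $0,\dots,n$ with $\lambda_i=0$ and indices are modulo $n+1$. *)

(* Defs.v *)
From HB Require Import structures.
From mathcomp Require Import all_boot all_order all_algebra.
From mathcomp Require Import finmap monalg.
From mathcomp Require Import boolp classical_sets reals complex.

Set Implicit Arguments.
Unset Strict Implicit.
Unset Printing Implicit Defensive.

Import Order.TTheory GRing.Theory Num.Theory.
Local Open Scope ring_scope.
Local Open Scope classical_set_scope.
Local Open Scope quotient_scope.

Definition zmod_iso (G H : zmodType) : Prop :=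
  exists f : {additive G -> H}, bijective f.

Section SubgroupGeneratedBy.
Variables (V : zmodType) (S : set V).

Definition subgroup (H : set V) : Prop :=
  H 0 /\ forall x y, H x -> H y -> H (x - y).

Definition span : {pred V} := fun x => `[< smallest subgroup S x >].

Lemma span_zmod_closed : zmod_closed span.
Proof.
split=> [|x y /asboolP hx /asboolP hy].
  by apply/asboolP => H [[H0 _] _].
apply/asboolP => H hH; case: (hH) => -[_ HB] _.
by apply: HB; [apply: hx | apply: hy].
Qed.

HB.instance Definition _ := GRing.isZmodClosed.Build V span span_zmod_closed.

Definition spanned := {x : V | span x}.
HB.instance Definition _ := SubChoice.on spanned.
HB.instance Definition _ := [SubChoice_isSubZmodule of spanned by <:].

Definition quotg := {ideal_quot span}.
HB.instance Definition _ := GRing.Zmodule.on quotg.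

Definition quotg_pi (x : V) : quotg := \pi_({ideal_quot span}) x.

Lemma quotg_pi_zmod_morphism : zmod_morphism quotg_pi.
Proof. by move=> x y; rewrite /quotg_pi (raddfB \pi_({ideal_quot span})). Qed.

HB.instance Definition _ :=
  GRing.isZmodMorphism.Build V quotg quotg_pi quotg_pi_zmod_morphism.

Lemma quotg_piP (x y : V) : quotg_pi x = quotg_pi y <-> x - y \in span.
Proof.
rewrite /quotg_pi; split.
  by move/eqP; rewrite -Quotient.idealrBE.
by move=> h; apply/eqP; rewrite -Quotient.idealrBE.
Qed.

End SubgroupGeneratedBy.

Section QuotientRing.
Variables (A : pzRingType) (S : set A).

Definition two_sided_ideal (I : set A) : Prop :=
  subgroup I /\ forall a x, I x -> I (a * x) /\ I (x * a).

Definition ideal_span : {pred A} := fun x => `[< smallest two_sided_ideal S x >].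

Lemma ideal_span_zmod_closed : zmod_closed ideal_span.
Proof.
split=> [|x y /asboolP hx /asboolP hy].
  by apply/asboolP => I [[[I0 _] _] _].
apply/asboolP => I hI; case: (hI) => -[[_ IB] _] _.
by apply: IB; [apply: hx | apply: hy].
Qed.

HB.instance Definition _ :=
  GRing.isZmodClosed.Build A ideal_span ideal_span_zmod_closed.

Lemma ideal_spanMl a x : x \in ideal_span -> a * x \in ideal_span.
Proof.
move=> /asboolP hx; apply/asboolP => I hI; case: (hI) => -[_ IM] _.
by case: (IM a x (hx I hI)).
Qed.

Lemma ideal_spanMr a x : x \in ideal_span -> x * a \in ideal_span.
Proof.
move=> /asboolP hx; apply/asboolP => I hI; case: (hI) => -[_ IM] _.
by case: (IM a x (hx I hI)).
Qed.

Definition quotr := {ideal_quot ideal_span}.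
HB.instance Definition _ := GRing.Zmodule.on quotr.

Definition quotr_pi (x : A) : quotr := \pi_({ideal_quot ideal_span}) x.
Definition quotr_mul (x y : quotr) : quotr := quotr_pi (repr x * repr y).

Lemma quotr_piP (x y : A) :
  quotr_pi x = quotr_pi y <-> x - y \in ideal_span.
Proof.
rewrite /quotr_pi; split.
  by move/eqP; rewrite -Quotient.idealrBE.
by move=> h; apply/eqP; rewrite -Quotient.idealrBE.
Qed.

Lemma quotr_piK (x : quotr) : quotr_pi (repr x) = x.
Proof. exact: reprK. Qed.

Lemma quotr_piD : {morph quotr_pi : x y / x + y}.
Proof. by move=> x y; rewrite /quotr_pi (raddfD \pi_({ideal_quot ideal_span})). Qed.

Lemma quotr_piM x y : quotr_pi (x * y) = quotr_mul (quotr_pi x) (quotr_pi y).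
Proof.
apply/quotr_piP.
set x' := repr _; set y' := repr (quotr_pi y).
have hx : x - x' \in ideal_span by apply/quotr_piP; rewrite quotr_piK.
have hy : y - y' \in ideal_span by apply/quotr_piP; rewrite quotr_piK.
have -> : x * y - x' * y' = (x - x') * y + x' * (y - y').
  by rewrite mulrBl mulrBr addrA subrK.
by apply: rpredD; [apply: ideal_spanMr | apply: ideal_spanMl].
Qed.

Lemma quotr_mulA : associative quotr_mul.
Proof.
move=> x y z; rewrite -(quotr_piK x) -(quotr_piK y) -(quotr_piK z).
by rewrite -!quotr_piM mulrA.
Qed.

Lemma quotr_mul1r : left_id (quotr_pi 1) quotr_mul.
Proof. by move=> x; rewrite -(quotr_piK x) -quotr_piM mul1r. Qed.

Lemma quotr_mulr1 : right_id (quotr_pi 1) quotr_mul.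
Proof. by move=> x; rewrite -(quotr_piK x) -quotr_piM mulr1. Qed.

Lemma quotr_mulDl : left_distributive quotr_mul +%R.
Proof.
move=> x y z; rewrite -(quotr_piK x) -(quotr_piK y) -(quotr_piK z).
by rewrite -quotr_piD -!quotr_piM mulrDl quotr_piD.
Qed.

Lemma quotr_mulDr : right_distributive quotr_mul +%R.
Proof.
move=> x y z; rewrite -(quotr_piK x) -(quotr_piK y) -(quotr_piK z).
by rewrite -quotr_piD -!quotr_piM mulrDr quotr_piD.
Qed.

HB.instance Definition _ := GRing.Zmodule_isPzRing.Build quotr
  quotr_mulA quotr_mul1r quotr_mulr1 quotr_mulDl quotr_mulDr.

Lemma quotr_pi_zmod_morphism : zmod_morphism quotr_pi.
Proof. by move=> x y; rewrite /quotr_pi (raddfB \pi_({ideal_quot ideal_span})). Qed.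

Lemma quotr_pi_monoid_morphism : monoid_morphism quotr_pi.
Proof. by split=> // x y; rewrite quotr_piM. Qed.

HB.instance Definition _ :=
  GRing.isZmodMorphism.Build A quotr quotr_pi quotr_pi_zmod_morphism.
HB.instance Definition _ :=
  GRing.isMonoidMorphism.Build A quotr quotr_pi quotr_pi_monoid_morphism.

End QuotientRing.

Section CornerRing.
Variables (A : pzRingType) (e : A) (ee : e * e = e).

Definition in_corner : {pred A} := fun x => `[< exists a, x = e * a * e >].

Lemma in_cornerP x : reflect (e * x = x /\ x * e = x) (x \in in_corner).
Proof.
apply: (iffP (asboolP _)) => [[a ->]|[h1 h2]].
  by rewrite !mulrA ee -!mulrA ee.
by exists x; rewrite h1 h2.
Qed.

Lemma in_corner_zmod_closed : zmod_closed in_corner.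
Proof.
split=> [|x y /in_cornerP[x1 x2] /in_cornerP[y1 y2]]; apply/in_cornerP.
  by rewrite mulr0 mul0r.
by rewrite mulrBr mulrBl x1 x2 y1 y2.
Qed.

HB.instance Definition _ :=
  GRing.isZmodClosed.Build A in_corner in_corner_zmod_closed.

(* the ring e A e, with unit e; it depends on the proof that e is idempotent *)
Definition corner of e * e = e := {x : A | x \in in_corner}.

Local Notation eAe := (corner ee).
HB.instance Definition _ := SubChoice.on eAe.
HB.instance Definition _ := [SubChoice_isSubZmodule of eAe by <:].

Lemma corner1_subproof : e \in in_corner.
Proof. by apply/in_cornerP; rewrite ee. Qed.

Lemma cornerM_subproof (x y : eAe) : val x * val y \in in_corner.
Proof.
case: x y => [x /= /in_cornerP[x1 x2]] [y /= /in_cornerP[y1 y2]].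
by apply/in_cornerP; rewrite mulrA x1 -mulrA y2.
Qed.

Definition corner_one : eAe := exist (fun x => x \in in_corner) e corner1_subproof.
Definition corner_mul (x y : eAe) : eAe := exist (fun x => x \in in_corner) _ (cornerM_subproof x y).

Lemma corner_mulA : associative corner_mul.
Proof. by move=> x y z; apply/val_inj; rewrite /= mulrA. Qed.

Lemma corner_mul1r : left_id corner_one corner_mul.
Proof. by move=> [x hx]; apply/val_inj; case/in_cornerP: (hx). Qed.

Lemma corner_mulr1 : right_id corner_one corner_mul.
Proof. by move=> [x hx]; apply/val_inj; case/in_cornerP: (hx). Qed.

Lemma corner_mulDl : left_distributive corner_mul +%R.
Proof. by move=> x y z; apply/val_inj; exact: mulrDl. Qed.

Lemma corner_mulDr : right_distributive corner_mul +%R.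
Proof. by move=> x y z; apply/val_inj; exact: mulrDr. Qed.

HB.instance Definition _ := GRing.Zmodule_isPzRing.Build eAe
  corner_mulA corner_mul1r corner_mulr1 corner_mulDl corner_mulDr.

End CornerRing.

Record quiver := Quiver {
  vertex : finType;
  arrow : finType;
  src : arrow -> vertex;
  tgt : arrow -> vertex }.

Section PathAlgebra.
Variables (F : comNzRingType) (Q : quiver).

(* [:: a1; ...; am] starting at i is a path when src a1 = i and
   src a_{k+1} = tgt a_k; the pair (i, [::]) is the trivial path at i *)
Fixpoint is_path (i : vertex Q) (s : seq (arrow Q)) : bool :=
  if s is a :: s' then (src a == i) && is_path (tgt a) s' else true.

Definition qpath := {p : vertex Q * seq (arrow Q) | is_path p.1 p.2}.
HB.instance Definition _ := SubChoice.on qpath.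

Definition pstart (p : qpath) : vertex Q := (val p).1.
Definition parrows (p : qpath) : seq (arrow Q) := (val p).2.
Definition pend (p : qpath) : vertex Q :=
  last (pstart p) (map (@tgt Q) (parrows p)).

Definition trivial_path (i : vertex Q) : qpath :=
  @exist (vertex Q * seq (arrow Q)) (fun p => is_path p.1 p.2) (i, [::]) isT.

Lemma arrow_path_subproof (a : arrow Q) : is_path (src a) [:: a].
Proof. by rewrite /= eqxx. Qed.

Definition arrow_path (a : arrow Q) : qpath :=
  @exist (vertex Q * seq (arrow Q)) (fun p => is_path p.1 p.2)
    (src a, [:: a]) (arrow_path_subproof a).

(* "p then q", defined when p ends where q starts *)
Definition pcat (p q : qpath) : option qpath :=
  if pend p == pstart q then insub (pstart p, parrows p ++ parrows q) else None.

Definition pathalg := {malg F[qpath]}.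
HB.instance Definition _ := GRing.Lmodule.on pathalg.

Definition path_elt (p : qpath) : pathalg := mkmalgU p 1.

Definition path_mul (p q : qpath) : pathalg := oapp path_elt 0 (pcat p q).

Definition lin_ext (h : qpath -> pathalg) (f : pathalg) : pathalg :=
  \sum_(p <- msupp f) mcoeff p f *: h p.

Definition pathalg_one : pathalg := \sum_(i : vertex Q) path_elt (trivial_path i).

Definition pathalg_mul (f g : pathalg) : pathalg :=
  lin_ext (fun p => lin_ext (fun q => path_mul p q) g) f.

Lemma lin_ext_w h (f : pathalg) (d : {fset qpath}) : (msupp f `<=` d)%fset ->
  lin_ext h f = \sum_(p <- d) mcoeff p f *: h p.
Proof.
move=> le; rewrite /lin_ext (big_fset_incl _ le) // => p _ hp.
by rewrite mcoeff_outdom // scale0r.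
Qed.

Lemma lin_extD h : {morph lin_ext h : f g / f + g}.
Proof.
move=> f g; pose d := (msupp f `|` msupp g)%fset.
rewrite (@lin_ext_w _ _ d) ?msuppD_le // (@lin_ext_w _ f d) ?fsubsetUl //.
rewrite (@lin_ext_w _ g d) ?fsubsetUr // -big_split /=.
by apply: eq_bigr => p _; rewrite mcoeffD scalerDl.
Qed.

Lemma lin_extZ h c f : lin_ext h (c *: f) = c *: lin_ext h f.
Proof.
rewrite (@lin_ext_w _ _ (msupp f)) ?msuppZ_le // scaler_sumr.
by apply: eq_bigr => p _; rewrite mcoeffZ scalerA.
Qed.

Lemma lin_ext0 h : lin_ext h 0 = 0.
Proof. by rewrite /lin_ext msupp0 big_seq_fset0. Qed.

Lemma lin_ext_sum h (I : Type) (r : seq I) (E : I -> pathalg) :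
  lin_ext h (\sum_(i <- r) E i) = \sum_(i <- r) lin_ext h (E i).
Proof. exact: (big_morph _ (lin_extD h) (lin_ext0 h)). Qed.

Lemma lin_extU h p : lin_ext h (path_elt p) = h p.
Proof.
by rewrite (@lin_ext_w _ _ [fset p]%fset) ?msuppU_le // big_seq_fset1 mcoeffUU scale1r.
Qed.

Lemma eq_lin_ext h1 h2 : h1 =1 h2 -> lin_ext h1 =1 lin_ext h2.
Proof. by move=> e f; apply: eq_bigr => p _; rewrite e. Qed.

Lemma lin_ext_comp H h f : lin_ext H (lin_ext h f) = lin_ext (lin_ext H \o h) f.
Proof. by rewrite /(lin_ext h) lin_ext_sum; apply: eq_bigr => p _; rewrite lin_extZ. Qed.

Lemma lin_ext_id f : lin_ext path_elt f = f.
Proof.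
rewrite {2}[f]monalgE; apply: eq_bigr => p _; apply/malgP => q.
by rewrite mcoeffZ !mcoeffU mulr_natr.
Qed.

Lemma lin_ext_const0 f : lin_ext (fun=> 0) f = 0.
Proof. by apply: big1 => p _; rewrite scaler0. Qed.

Lemma pend_cat p q r : pcat p q = Some r ->
  [/\ pend p = pstart q, pstart r = pstart p, pend r = pend q
    & parrows r = parrows p ++ parrows q].
Proof.
rewrite /pcat; case: eqP => // epq; case: insubP => // u _ hu [<-].
rewrite /pend /pstart /parrows hu /= map_cat last_cat; split=> //.
by move: epq; rewrite /pend => ->.
Qed.

Lemma is_path_cat i s t :
  is_path i (s ++ t) = is_path i s && is_path (last i (map (@tgt Q) s)) t.
Proof. by elim: s i => //= a s IH i; rewrite IH andbA. Qed.

Lemma pcat_some p q : pend p = pstart q -> exists r, pcat p q = Some r.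
Proof.
move=> e; rewrite /pcat e eqxx; case: insubP => [u _ _|]; first by exists u.
rewrite /= is_path_cat -[is_path _ (parrows p)]/(is_path (val p).1 (val p).2).
by rewrite (valP p) -/(pend p) e /= /pstart /parrows (valP q).
Qed.

Lemma pcat_none p q : pend p <> pstart q -> pcat p q = None.
Proof. by rewrite /pcat; case: eqP. Qed.

Lemma qpath_inj p q : pstart p = pstart q -> parrows p = parrows q -> p = q.
Proof.
move=> h1 h2; apply/val_inj.
by rewrite [val p]surjective_pairing [val q]surjective_pairing; congr pair.
Qed.

Lemma path_mulA p q r :
  lin_ext (fun s => path_mul s r) (path_mul p q) =
  lin_ext (fun s => path_mul p s) (path_mul q r).
Proof.
rewrite /path_mul.
case: (pselect (pend p = pstart q)) => [epq|npq]; last first.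
  rewrite (pcat_none npq) /= lin_ext0.
  case: (pselect (pend q = pstart r)) => [eqr|nqr]; last first.
    by rewrite (pcat_none nqr) /= lin_ext0.
  have [v hv] := pcat_some eqr; rewrite hv /= lin_extU.
  by have [_ e1 _ _] := pend_cat hv; rewrite pcat_none // e1.
have [u hu] := pcat_some epq; have [_ u1 u2 u3] := pend_cat hu.
rewrite hu /= lin_extU.
case: (pselect (pend q = pstart r)) => [eqr|nqr]; last first.
  by rewrite (pcat_none nqr) /= lin_ext0 pcat_none // u2.
have [v hv] := pcat_some eqr; have [_ v1 v2 v3] := pend_cat hv.
rewrite hv /= lin_extU.
have [w hw] : exists w, pcat u r = Some w by apply: pcat_some; rewrite u2.
have [x hx] : exists x, pcat p v = Some x by apply: pcat_some; rewrite v1.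
have [_ w1 _ w3] := pend_cat hw; have [_ x1 _ x3] := pend_cat hx.
rewrite hw hx /=; congr path_elt; apply: qpath_inj.
  by rewrite w1 x1 u1.
by rewrite w3 x3 u3 v3 catA.
Qed.

Lemma pathalg_mulA : associative pathalg_mul.
Proof.
move=> f g k; rewrite /pathalg_mul lin_ext_comp; apply: eq_lin_ext => p /=.
rewrite !lin_ext_comp; apply: eq_lin_ext => q /=.
rewrite lin_ext_comp.
rewrite -(eq_lin_ext (fun r => path_mulA p q r)) /path_mul.
case: (pcat p q) => [s|] /=.
  by rewrite lin_extU; apply: eq_lin_ext => r; rewrite /= lin_extU.
rewrite lin_ext0 -[RHS](lin_ext_const0 k).
by apply: eq_lin_ext => r; rewrite /= lin_ext0.
Qed.

Lemma path_mul_trivl i p :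
  path_mul (trivial_path i) p = if i == pstart p then path_elt p else 0.
Proof.
rewrite /path_mul; case: eqP => [e|n]; last by rewrite pcat_none.
have [r hr] : exists r, pcat (trivial_path i) p = Some r by apply: pcat_some.
rewrite hr /=; have [_ h1 _ h2] := pend_cat hr.
by congr path_elt; apply: qpath_inj; rewrite // h1 -e.
Qed.

Lemma path_mul_trivr i p :
  path_mul p (trivial_path i) = if i == pend p then path_elt p else 0.
Proof.
rewrite /path_mul; case: eqP => [e|n]; last first.
  by rewrite pcat_none // => h; apply: n; rewrite h.
have [r hr] : exists r, pcat p (trivial_path i) = Some r by apply: pcat_some.
rewrite hr /=; have [_ h1 _ h2] := pend_cat hr.
by congr path_elt; apply: qpath_inj; rewrite // h2 cats0.
Qed.

Lemma pathalg_mul1r : left_id pathalg_one pathalg_mul.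
Proof.
move=> f; rewrite /pathalg_mul /pathalg_one lin_ext_sum.
under eq_bigr do rewrite lin_extU.
rewrite /lin_ext exchange_big /= -[RHS]lin_ext_id; apply: eq_bigr => p _.
rewrite -scaler_sumr; congr (_ *: _).
under eq_bigr do rewrite path_mul_trivl.
by rewrite -big_mkcond big_pred1_eq.
Qed.

Lemma pathalg_mulr1 : right_id pathalg_one pathalg_mul.
Proof.
move=> f; rewrite /pathalg_mul -[RHS]lin_ext_id; apply: eq_lin_ext => p.
rewrite /pathalg_one lin_ext_sum.
under eq_bigr do rewrite lin_extU path_mul_trivr.
by rewrite -big_mkcond big_pred1_eq.
Qed.

Lemma pathalg_mulDl : left_distributive pathalg_mul +%R.
Proof. by move=> f g k; rewrite /pathalg_mul lin_extD. Qed.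

Lemma pathalg_mulDr : right_distributive pathalg_mul +%R.
Proof.
move=> f g k; rewrite /pathalg_mul /(lin_ext _ f) -big_split /=.
by apply: eq_bigr => p _; rewrite -/(lin_ext _ (g + k)) lin_extD scalerDr.
Qed.

HB.instance Definition _ := GRing.Zmodule_isPzRing.Build pathalg
  pathalg_mulA pathalg_mul1r pathalg_mulr1 pathalg_mulDl pathalg_mulDr.

Definition trivial_elt (i : vertex Q) : pathalg := path_elt (trivial_path i).
Definition arrow_elt (a : arrow Q) : pathalg := path_elt (arrow_path a).

Lemma trivial_elt_idem i : trivial_elt i * trivial_elt i = trivial_elt i.
Proof.
rewrite -[LHS]/(pathalg_mul _ _) /pathalg_mul !lin_extU path_mul_trivl.
by rewrite eqxx.
Qed.

End PathAlgebra.

(* inl i is the arrow c_i : i -> i+1 and inr i is d_i : i+1 -> i,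
   with i+1 = ordS i read modulo n+1 *)
Definition double_cyclic_quiver (n : nat) : quiver :=
  @Quiver 'I_n.+1 ('I_n.+1 + 'I_n.+1)%type
    (fun a => match a with inl i => i | inr i => ordS i end)
    (fun a => match a with inl i => ordS i | inr i => i end).

Section DeformedPreprojective.
Variables (F : comNzRingType) (n : nat) (lam : 'I_n.+1 -> F).
Local Notation Qbar := (double_cyclic_quiver n).
Local Notation FQ := (pathalg F Qbar).

Definition e_ (i : 'I_n.+1) : FQ := @trivial_elt F Qbar i.
Definition c_ (i : 'I_n.+1) : FQ := @arrow_elt F Qbar (inl i).
Definition d_ (i : 'I_n.+1) : FQ := @arrow_elt F Qbar (inr i).

Definition preproj_relations : set FQ :=
  [set x | exists i : 'I_n.+1,
    x = d_ (ord_pred i) * c_ (ord_pred i) - c_ i * d_ i - lam i *: e_ i].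

Definition preproj := quotr preproj_relations.
HB.instance Definition _ := GRing.PzRing.on preproj.

Definition preproj_e0 : preproj := quotr_pi preproj_relations (e_ ord0).

Lemma preproj_e0_idem : preproj_e0 * preproj_e0 = preproj_e0.
Proof. by rewrite /preproj_e0 -(rmorphM (quotr_pi _)) trivial_elt_idem. Qed.

Definition Olambda := corner preproj_e0_idem.
HB.instance Definition _ := GRing.PzRing.on Olambda.

End DeformedPreprojective.

Record submodule (A : pzRingType) (V : lmodType A) := Submodule {
  submod_pred :> V -> bool;
  submodP : GRing.submod_closed submod_pred }.

Section QuotientModule.
Variables (A : pzRingType) (V : lmodType A) (K : submodule V).

Definition in_submod : {pred V} := fun x => submod_pred K x.

Lemma in_submod_zmod_closed : zmod_closed in_submod.
Proof. exact: GRing.submod_closedB (submodP K). Qed.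

HB.instance Definition _ :=
  GRing.isZmodClosed.Build V in_submod in_submod_zmod_closed.

Lemma in_submodZ a x : x \in in_submod -> a *: x \in in_submod.
Proof.
case: (submodP K) => h0 hl hx.
by have := hl a x 0 hx h0; rewrite addr0.
Qed.

Definition quotm := {ideal_quot in_submod}.
HB.instance Definition _ := GRing.Zmodule.on quotm.

Definition quotm_pi (x : V) : quotm := \pi_({ideal_quot in_submod}) x.
Definition quotm_scale (a : A) (x : quotm) : quotm := quotm_pi (a *: repr x).

Lemma quotm_piP (x y : V) : quotm_pi x = quotm_pi y <-> x - y \in in_submod.
Proof.
rewrite /quotm_pi; split.
  by move/eqP; rewrite -Quotient.idealrBE.
by move=> h; apply/eqP; rewrite -Quotient.idealrBE.
Qed.

Lemma quotm_piK (x : quotm) : quotm_pi (repr x) = x.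
Proof. exact: reprK. Qed.

Lemma quotm_piD : {morph quotm_pi : x y / x + y}.
Proof. by move=> x y; rewrite /quotm_pi (raddfD \pi_({ideal_quot in_submod})). Qed.

Lemma quotm_piZ a x : quotm_pi (a *: x) = quotm_scale a (quotm_pi x).
Proof.
apply/quotm_piP; rewrite -scalerBr; apply: in_submodZ.
by apply/quotm_piP; rewrite quotm_piK.
Qed.

Lemma quotm_scaleA a b x : quotm_scale a (quotm_scale b x) = quotm_scale (a * b) x.
Proof. by rewrite -(quotm_piK x) -!quotm_piZ scalerA. Qed.

Lemma quotm_scale1 : left_id 1 quotm_scale.
Proof. by move=> x; rewrite -(quotm_piK x) -quotm_piZ scale1r. Qed.

Lemma quotm_scaleDr : right_distributive quotm_scale +%R.
Proof.
move=> a x y; rewrite -(quotm_piK x) -(quotm_piK y) -quotm_piD -!quotm_piZ.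
by rewrite scalerDr quotm_piD.
Qed.

Lemma quotm_scaleDl x : {morph quotm_scale^~ x : a b / a + b}.
Proof. by move=> a b; rewrite -(quotm_piK x) -!quotm_piZ scalerDl quotm_piD. Qed.

HB.instance Definition _ := GRing.Zmodule_isLmodule.Build A quotm
  quotm_scaleA quotm_scale1 quotm_scaleDr quotm_scaleDl.

Lemma quotm_pi_zmod_morphism : zmod_morphism quotm_pi.
Proof. by move=> x y; rewrite /quotm_pi (raddfB \pi_({ideal_quot in_submod})). Qed.

Lemma quotm_pi_scalable : scalable quotm_pi.
Proof. by move=> a x; rewrite quotm_piZ. Qed.

HB.instance Definition _ :=
  GRing.isZmodMorphism.Build V quotm quotm_pi quotm_pi_zmod_morphism.
HB.instance Definition _ :=
  GRing.isScalable.Build A V quotm *:%R quotm_pi quotm_pi_scalable.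

End QuotientModule.

Definition short_exact (A : pzRingType) (M' M M'' : lmodType A) : Prop :=
  exists (f : {linear M' -> M}) (g : {linear M -> M''}),
    [/\ injective f, (forall z, exists y, g y = z)
      & forall y, g y = 0 <-> exists x, f x = y].

Section G0.
Variable A : pzRingType.

(* A small skeleton of the category of finitely generated A-modules: the
   quotients A^m / K.  By [fgmod_complete] below it meets every isomorphism
   class; it is used because the lmodTypes over A form a large type. *)
Record fgmod := FgMod { fg_rank : nat; fg_rel : submodule 'rV[A]_fg_rank }.

Definition fgmod_module (M : fgmod) : lmodType A := quotm (fg_rel M).

Lemma fgmod_complete (M : lmodType A) (m : nat) (x : 'I_m -> M) :
  (forall y : M, exists a : 'I_m -> A, y = \sum_i a i *: x i) ->
  exists (N : fgmod) (f : {linear fgmod_module N -> M}), bijective f.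
Proof.
move=> gen; pose h (v : 'rV[A]_m) : M := \sum_i v 0 i *: x i.
have hZ a v : h (a *: v) = a *: h v.
  by rewrite /h scaler_sumr; apply: eq_bigr => i _; rewrite mxE scalerA.
have hD u v : h (u + v) = h u + h v.
  by rewrite /h -big_split; apply: eq_bigr => i _; rewrite mxE scalerDl.
have hB u v : h (u - v) = h u - h v.
  rewrite hD; congr (_ + _); rewrite /h -sumrN.
  by apply: eq_bigr => i _; rewrite mxE scaleNr.
have h0 : h 0 = 0 by rewrite -(subrr 0) hB subrr.
have K_closed : GRing.submod_closed (fun v => h v == 0 : bool).
  split=> [|a u v /eqP hu /eqP hv]; apply/eqP; first exact: h0.
  by rewrite hD hZ hu hv scaler0 addr0.
pose N := FgMod (Submodule K_closed).
pose f (y : fgmod_module N) : M := h (repr y).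
have fE v : f (quotm_pi (fg_rel N) v) = h v.
  apply/eqP; rewrite -subr_eq0 -hB.
  by have /quotm_piP := quotm_piK (quotm_pi (fg_rel N) v).
have f_zmod : zmod_morphism f.
  move=> y z; rewrite -(quotm_piK y) -(quotm_piK z).
  by rewrite -(raddfB (quotm_pi (fg_rel N))) !fE hB.
have f_scal : scalable f.
  move=> a y; rewrite -(quotm_piK y) fE -hZ -fE; congr f.
  exact: esym (quotm_piZ _ _ _).
pose fa := GRing.isZmodMorphism.Build _ _ f f_zmod.
pose fs := GRing.isScalable.Build _ _ _ _ f f_scal.
pose fl : {linear fgmod_module N -> M} := HB.pack f fa fs.
exists N, fl.
have surj z : exists v, h v == z.
  have [a ->] := gen z; exists (\row_i a i); apply/eqP.
  by apply: eq_bigr => i _; rewrite mxE.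
exists (fun z => quotm_pi (fg_rel N) (xchoose (surj z))) => [y|z] /=; last first.
  by rewrite fE; apply/eqP/(xchooseP (surj z)).
rewrite -[RHS]quotm_piK; apply/quotm_piP.
rewrite -[_ \in _]/(h _ == 0) hB.
by rewrite (eqP (xchooseP (surj (f y)))) subrr.
Qed.

Definition mod_class (M : fgmod) : {malg int[{classic fgmod}]} :=
  @mkmalgU {classic fgmod} int M 1.

Definition exact_relations : set {malg int[{classic fgmod}]} :=
  [set x | exists M' M M'' : fgmod,
     short_exact (fgmod_module M') (fgmod_module M) (fgmod_module M'') /\
     x = mod_class M - mod_class M' - mod_class M''].

Definition G0 : zmodType := quotg exact_relations.

End G0.

(* Meant for A a commutative normal noetherian domain, although none of these
   properties is part of the type of A: then every f != 0 has exactly one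
   divisor, and Cl is the group of Weil divisors modulo principal ones. *)
Section ClassGroup.
Variable A : pzRingType.

Definition ideal (I : set A) : Prop :=
  subgroup I /\ forall a x, I x -> I (a * x).

Definition prime_ideal (p : set A) : Prop :=
  [/\ ideal p, ~ p 1 & forall a b, p (a * b) -> p a \/ p b].

Definition height_one (p : set A) : Prop :=
  [/\ prime_ideal p,
      exists q, prime_ideal q /\ q `<` p
    & ~ exists q q', [/\ prime_ideal q, prime_ideal q', q `<` q' & q' `<` p]].

Fixpoint ideal_pow (p : set A) (k : nat) : set A :=
  if k is k'.+1 then
    smallest ideal [set x | exists a b, [/\ p a, ideal_pow p k' b & x = a * b]]
  else setT.

(* p^k A_p `&` A *)
Definition symbolic_pow (p : set A) (k : nat) : set A :=
  [set f | exists s, ~ p s /\ ideal_pow p k (s * f)].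

Definition prime_divisor := {p : set A | `[< height_one p >]}.
HB.instance Definition _ := SubChoice.on prime_divisor.

(* D = div f: the coefficient of D at p is the valuation of f in the discrete
   valuation ring A_p, i.e. the k with f in p^k A_p but not in p^(k+1) A_p *)
Definition is_div (f : A) (D : {malg int[prime_divisor]}) : Prop :=
  forall p : prime_divisor, exists k : nat,
    [/\ mcoeff p D = k%:Z, symbolic_pow (val p) k f
      & ~ symbolic_pow (val p) k.+1 f].

Definition principal_divisors : set {malg int[prime_divisor]} :=
  [set D | exists f : A, f != 0 /\ is_div f D].

Definition Cl : zmodType := quotg principal_divisors.

End ClassGroup.

Section Lattices.
Variables (F : comNzRingType) (n : nat) (lam : 'I_n.+1 -> F).

Definition nu (i : 'I_n.+1) : F := \sum_(j < n.+1 | (j <= i)%N) lam j.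

(* 'rV[int]_n.+1 is the free abelian group on r_0, ..., r_n (resp. on
   t_0, ..., t_n), with basis vectors bas i *)
Definition bas (i : 'I_n.+1) : 'rV[int]_n.+1 := delta_mx 0 i.

Definition weight_lattice : zmodType :=
  quotg [set x : 'rV[int]_n.+1 | x = \sum_i bas i].

Definition wt (i : 'I_n.+1) : weight_lattice := quotg_pi _ (bas i).

Definition Qlambda_roots : set weight_lattice :=
  [set x | exists i j : 'I_n.+1, [/\ i != j, nu i = nu j & x = wt i - wt j]].

Definition L_mod_Qlambda : zmodType := quotg Qlambda_roots.

Definition P_lattice : zmodType :=
  spanned [set x : 'rV[int]_n.+1 | exists i j, x = bas i - bas j].

Definition P_relations : set P_lattice :=
  [set x | exists i : 'I_n.+1,
     lam i = 0 /\ sval x = bas i *+ 2 - bas (ord_pred i) - bas (ordS i)].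

Definition P_mod_relations : zmodType := quotg P_relations.

End Lattices.

(* The inequalities lambda_i >= 0 for complex lambda_i are read in an arbitrary
   translation-invariant order on C: this covers both "real and nonnegative"
   and the total lexicographic order, see the two lemmas below. *)
Definition additive_order (V : zmodType) (le : rel V) : Prop :=
  [/\ reflexive le, antisymmetric le, transitive le
    & forall z x y, le x y -> le (z + x) (z + y)].

Lemma additive_order_num (F : numDomainType) : additive_order (<=%R : rel F).
Proof.
by split; [exact: lexx | exact: le_anti | exact: le_trans | move=> z x y; rewrite lerD2l].
Qed.

Definition lex_le (R : realType) : rel R[i] := fun x y =>
  (complex.Re x < complex.Re y) ||
  ((complex.Re x == complex.Re y) && (complex.Im x <= complex.Im y)).

Lemma additive_order_lex (R : realType) : additive_order (@lex_le R).
Proof.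
split.
- by case=> a b; rewrite /lex_le /= eqxx lexx orbT.
- move=> [a b] [c d]; rewrite /lex_le /=.
  case: (ltgtP a c) => //= -> /andP[h1 h2].
  by congr Complex; apply/eqP; rewrite eq_le h1 h2.
- move=> [c d] [a b] [e f]; rewrite /lex_le /=.
  case/orP => [h1|/andP[/eqP-> h1]] /orP[h2|/andP[/eqP<- h2]].
  + by rewrite (lt_trans h1 h2).
  + by rewrite h1.
  + by rewrite h2.
  + by rewrite eqxx (le_trans h1 h2) orbT.
- by move=> [u v] [a b] [c d]; rewrite /lex_le /= ltrD2l lerD2l (inj_eq (addrI u)).
Qed.

(* Main.v *)
(* Put nu_i = lambda_0 + ... + lambda_i. The element z = sum_i (c_i d_i + nu_i e_i) is central
   in Pi^lambda, and e_0 Pi^lambda is spanned by the z^m times pure c- or pure d-paths; letting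
   c_0 ... c_n act as x and c_i d_i as z - nu_i on Frac F[z][x] shows that there are no further
   relations, so O^lambda = F[x, y, z] / (x y - prod_i (z - nu_i)).

   The primes over x are the P_i = (x, z - nu_i). Away from x the ring is F[z][x, 1/x], which is
   factorial with units F^* x^Z; hence Cl is generated by the [P_i] subject to P_i = P_j for
   nu_i = nu_j and div x = sum_i P_i = 0, and this is L / Q_lambda.

   For G_0, exact sequences 0 -> A/(I : a) -> A/I -> A/(I + a) -> 0 and noetherian induction show
   that G_0 is generated by [A] and the [A/P_i], and that sum_i [A/P_i] = 0. Conversely the rank
   and first Chern class of A^m / K are read off the ideals of leading coordinates of K; that
   they do not depend on the flag of coordinates reduces to submodules of A^2, where both flags
   compute the orders of the 2 x 2 minors. This gives a map G_0 -> Z + Cl inverse to the above. *)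
From HB Require Import structures.
Require Import Defs.
From mathcomp Require Import all_boot all_order all_algebra.
From mathcomp Require Import finmap monalg.
From mathcomp Require Import ring zify.
From mathcomp Require Import boolp classical_sets reals complex.

Set Implicit Arguments.
Unset Strict Implicit.
Unset Printing Implicit Defensive.

Import Order.TTheory GRing.Theory Num.Theory.
Local Open Scope ring_scope.
Local Open Scope classical_set_scope.
Local Open Scope quotient_scope.

(* [span] without prefix is the linear span of vector.v. *)
Local Notation span := Defs.span.
Local Notation "u %:F" := (tofrac u) : ring_scope.

(** * Abelian groups presented by generators *)

(** When some of the nu_i coincide the surface is singular, so a module need not have a finite free
    resolution and its first Chern class cannot be read off one; this is why it is assembled from
    ideals of leading coordinates instead. A single computation with one submodule of A^(m' + m'' +
    m) then gives additivity on short exact sequences, and with it independence of the presentation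
    A^m / K. Injectivity is settled once for both groups. The composite of Z + Z^(n+1) -> G_0, which
    sends the basis to [A] and the [A/P_i], with the invariant is the identity on Z and minus the
    map onto Cl on Z^(n+1); so its kernel is known as soon as the relations among the [P_i] in Cl
    are, and these come from a retraction of the divisor group. O^lambda is not commutative by
    construction: commutativity and the absence of zero divisors both come from its embedding into
    Frac F[z][x]. The sign condition enters in the comparison with P. It makes nu monotone, so that
    nu_i = nu_j forces lambda to vanish strictly after i up to j, and Q_lambda is spanned by the
    differences r_i - r_(i-1) with lambda_i = 0. *)

Lemma bij_of_inj_surj (V W : Type) (f : V -> W) : injective f -> (forall w, exists v, f v = w) ->
  bijective f.
Proof.
move=> finj /choice[g fg]; exists g => // v.
by apply: finj; rewrite fg.
Qed.

Section QuotientGroup.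
Variables (V W : zmodType).
Implicit Type S : set V.

Lemma mem_span S x : S x -> x \in span S.
Proof. by move=> Sx; apply/asboolP => H [_]; apply. Qed.

Lemma span_sub S (H : set V) : subgroup H -> S `<=` H ->
  forall x, x \in span S -> H x.
Proof. by move=> hH SH x /asboolP; apply. Qed.

Lemma quotg_piK S (q : quotg S) : quotg_pi S (repr q) = q.
Proof. exact: reprK. Qed.

Lemma quotg_pi_eq0 S x : quotg_pi S x = 0 <-> x \in span S.
Proof.
by rewrite -[X in _ = X](raddf0 (quotg_pi S)) quotg_piP subr0.
Qed.

Section Lift.
Variables (S : set V) (f : {additive V -> W}).
Hypothesis f_S : forall x, S x -> f x = 0.

Definition quotg_lift (q : quotg S) : W := f (repr q).

Lemma span_ker x : x \in span S -> f x = 0.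
Proof.
apply: (@span_sub S [set x | f x = 0]) => //; split=> [|y z /= fy fz].
  by rewrite /= raddf0.
by rewrite raddfB fy fz subrr.
Qed.

Lemma quotg_liftE x : quotg_lift (quotg_pi S x) = f x.
Proof.
apply/eqP; rewrite -subr_eq0 -raddfB; apply/eqP/span_ker.
by apply/quotg_piP; rewrite quotg_piK.
Qed.

Lemma quotg_lift_exists :
  exists g : {additive quotg S -> W}, forall x, g (quotg_pi S x) = f x.
Proof.
have g_zmod : zmod_morphism quotg_lift.
  move=> x y; rewrite -(quotg_piK x) -(quotg_piK y).
  by rewrite -(raddfB (quotg_pi S)) !quotg_liftE raddfB.
pose ga := GRing.isZmodMorphism.Build _ _ quotg_lift g_zmod.
pose g : {additive quotg S -> W} := HB.pack quotg_lift ga.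
by exists g => x; exact: quotg_liftE.
Qed.

End Lift.

Lemma first_iso (f : {additive V -> W}) S :
  (forall w, exists v, f v = w) ->
  (forall v, f v = 0 <-> v \in span S) -> zmod_iso (quotg S) W.
Proof.
move=> fsurj kerf; have [x Sx|g gE] := @quotg_lift_exists S f.
  exact/kerf/mem_span.
exists g; apply: bij_of_inj_surj => [q r|w].
  rewrite -(quotg_piK q) -(quotg_piK r) !gE => e.
  by apply/quotg_piP/kerf; rewrite raddfB e subrr.
by have [v <-] := fsurj w; exists (quotg_pi S v); rewrite gE.
Qed.

End QuotientGroup.

Lemma zmod_iso_sym (V W : zmodType) : zmod_iso V W -> zmod_iso W V.
Proof.
case=> f [g fK gK].
have g_zmod : zmod_morphism g.
  by move=> x y; apply: (can_inj fK); rewrite raddfB !gK.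
pose ga := GRing.isZmodMorphism.Build _ _ g g_zmod.
pose g' : {additive W -> V} := HB.pack g ga.
by exists g'; exists f.
Qed.

Lemma zmod_iso_trans (U V W : zmodType) :
  zmod_iso U V -> zmod_iso V W -> zmod_iso U W.
Proof. by case=> f fb [g gb]; exists (g \o f); exact: bij_comp. Qed.

(** * Homomorphisms out of free abelian groups *)

Section FreeAbelian.
Variables (K : choiceType) (W : zmodType) (g : K -> W).
Implicit Type D : {malg int[K]}.

Definition free_ext D : W := \sum_(k <- msupp D) g k *~ mcoeff k D.

Lemma free_ext_w D (d : {fset K}) : (msupp D `<=` d)%fset ->
  free_ext D = \sum_(k <- d) g k *~ mcoeff k D.
Proof.
move=> le; rewrite /free_ext (big_fset_incl _ le) // => k _ hk.
by rewrite mcoeff_outdom // mulr0z.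
Qed.

Lemma free_ext_zmod_morphism : zmod_morphism free_ext.
Proof.
move=> D E; pose d := (msupp D `|` msupp E)%fset.
rewrite (@free_ext_w _ d) ?msuppB_le // (@free_ext_w D d) ?fsubsetUl //.
rewrite (@free_ext_w E d) ?fsubsetUr // -sumrB.
by apply: eq_bigr => k _; rewrite mcoeffB mulrzBr.
Qed.

HB.instance Definition _ :=
  GRing.isZmodMorphism.Build _ _ free_ext free_ext_zmod_morphism.

Lemma free_extU k : free_ext (mkmalgU k 1) = g k.
Proof.
by rewrite (@free_ext_w _ [fset k]%fset) ?msuppU_le // big_seq_fset1 mcoeffUU.
Qed.

Lemma subgroup_sum (H : set W) (I : Type) (r : seq I) (P : pred I) (F : I -> W) :
  subgroup H -> (forall i, P i -> H (F i)) -> H (\sum_(i <- r | P i) F i).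
Proof.
case=> H0 hB HF; apply: (big_ind H) => // x y hx hy.
by rewrite -[y]opprK; apply: (hB) => //; rewrite -[- y]sub0r; apply: hB.
Qed.

Lemma subgroup_mulz (H : set W) w (m : int) : subgroup H -> H w -> H (w *~ m).
Proof.
move=> hH hw; have [H0 hB] := hH.
have pos k : H (w *+ k).
  rewrite -[k]card_ord -sumr_const; exact: subgroup_sum.
case: m => k; first exact: pos.
by rewrite NegzE mulrNz -sub0r; apply: hB => //; exact: pos.
Qed.

End FreeAbelian.

Lemma malgU_mulz (K : choiceType) (k : K) (m : int) :
  << m *g k >> = (mkmalgU k 1 : {malg int[K]}) *~ m.
Proof.
by apply/malgP => l; rewrite raddfMz /= !mcoeffU; case: eqP; rewrite ?mulr1n ?intz ?mulr0n ?mul0rz.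
Qed.

Lemma free_abelian_ind (K : choiceType) (H : set {malg int[K]}) :
  subgroup H -> (forall k, H (mkmalgU k 1)) -> forall D, H D.
Proof.
move=> hH hU D; rewrite [D]monalgE; apply: subgroup_sum => // k _.
rewrite malgU_mulz; exact: subgroup_mulz.
Qed.

Lemma free_abelian_finsupp (K : choiceType) (s : seq K) (v : K -> int) :
  (forall k, v k != 0 -> k \in s) -> exists D : {malg int[K]}, forall k, mcoeff k D = v k.
Proof.
move=> hs; exists (\sum_(k <- undup s) << v k *g k >>) => k.
rewrite raddf_sum /=; have [ks|nks] := boolP (k \in undup s).
  rewrite (bigD1_seq k) ?undup_uniq //= mcoeffUU big1 ?addr0 // => l lk.
  by rewrite mcoeffU (negPf lk).
rewrite big_seq big1 => [|l ls].
  by apply/esym/eqP; apply: contraNT nks => /hs; rewrite mem_undup.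
by rewrite mcoeffU; case: eqP => // lk; rewrite -lk ls in nks.
Qed.

(** * Additive invariants of modules from flags of ideals *)

Definition lin_closed (A : pzRingType) (V : lmodType A) (K : set V) : Prop :=
  K 0 /\ forall a x y, K x -> K y -> K (a *: x + y).

Record lform (A : pzRingType) (V : lmodType A) := LForm {
  lform_fun :> V -> A;
  lformP : forall a x y, lform_fun (a *: x + y) = a * lform_fun x + lform_fun y }.

Section FlagInvariant.
Variables (A : pzRingType) (G : zmodType) (psi : set A -> G).

Lemma lform0 (V : lmodType A) (l : lform V) : l 0 = 0.
Proof.
by have := lformP l (-1) 0 0; rewrite scaler0 addr0 mulN1r addNr.
Qed.

Fixpoint flag (V : lmodType A) (s : seq (lform V)) (K : set V) : G :=
  if s is l :: s' then psi (l @` K) + flag s' (K `&` [set v | l v = 0]) else 0.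

Hypothesis psiT : psi setT = 0.
(** R is a submodule of A^2, and the two sides are the values of its two coordinate flags. This
    exchange is all that is needed to reorder longer flags. *)
Hypothesis psi_swap : forall R : A -> A -> Prop, R 0 0 ->
  (forall a x y x' y', R x y -> R x' y' -> R (a * x + x') (a * y + y')) ->
  psi [set a | exists b, R a b] + psi [set b | R 0 b] =
  psi [set b | exists a, R a b] + psi [set a | R a 0].

Section OneModule.
Variable V : lmodType A.
Implicit Types (K : set V) (l : lform V) (s t : seq (lform V)).

Lemma lin_closed_ker K l : lin_closed K -> lin_closed (K `&` [set v | l v = 0]).
Proof.
case=> K0 KD; split=> [|a x y [Kx /= lx] [Ky /= ly]].
  by split=> //=; exact: lform0.
by split=> /=; [exact: KD | rewrite lformP lx ly mulr0 addr0].
Qed.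

(** The pairs (l v, m v) for v in K form a submodule of A^2 to which [psi_swap] applies; the forms
    in s see the same common kernel on both sides. *)
Lemma flag_swap K l m s : lin_closed K ->
  flag (l :: m :: s) K = flag (m :: l :: s) K.
Proof.
move=> [K0 KD] /=; rewrite !addrA setIAC; congr (_ + _).
pose R a b := exists v, [/\ K v, l v = a & m v = b].
have -> : l @` K = [set a | exists b, R a b].
  apply/predeqP => a; split=> [[v Kv <-]|[b [v [Kv <- _]]]]; last by exists v.
  by exists (m v), v.
have -> : m @` K = [set b | exists a, R a b].
  apply/predeqP => a; split=> [[v Kv <-]|[b [v [Kv _ <-]]]]; last by exists v.
  by exists (l v), v.
have -> : m @` (K `&` [set v | l v = 0]) = [set b | R 0 b].
  apply/predeqP => a; split=> [[v [Kv lv] <-]|[v [Kv lv <-]]]; last by exists v.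
  by exists v.
have -> : l @` (K `&` [set v | m v = 0]) = [set a | R a 0].
  apply/predeqP => a; split=> [[v [Kv lv] <-]|[v [Kv <- lv]]]; last by exists v.
  by exists v.
apply: psi_swap; first by exists 0; rewrite !lform0.
move=> a x y x' y' [v [Kv <- <-]] [w [Kw <- <-]].
by exists (a *: v + w); rewrite !lformP; split=> //; exact: KD.
Qed.

Lemma flag_move K l s t : lin_closed K -> flag (s ++ l :: t) K = flag (l :: s ++ t) K.
Proof.
elim: s K => //= m s IH K hK; rewrite -/(flag (m :: l :: s ++ t) K) /=.
by rewrite IH; [rewrite -[RHS]/(flag (l :: m :: s ++ t) K) flag_swap | exact: lin_closed_ker].
Qed.

Lemma flag_catC K s t : lin_closed K -> flag (s ++ t) K = flag (t ++ s) K.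
Proof.
elim: s K => [|l s IH] K hK; first by rewrite cats0.
rewrite flag_move //= IH //; exact: lin_closed_ker.
Qed.

Lemma flag_cat K s t :
  flag (s ++ t) K = flag s K + flag t (K `&` [set v | all (fun l : lform V => l v == 0) s]).
Proof.
elim: s K => [|l s IH] K /=.
  by rewrite add0r; congr flag; apply/predeqP => v; split=> [|[]].
rewrite IH addrA; congr (_ + flag _ _); apply/predeqP => v.
by split=> [[[Kv /= -> ] ->]|[Kv /= /andP[/eqP-> ->]]]; rewrite ?eqxx.
Qed.

(** When the forms take arbitrary joint values on K, every successive image is the whole ring and
    [psiT] kills its term. Asking c to vanish off s gives the head form the value 0 in the inductive
    step, so the vector found lies in its kernel. *)
Lemma flag_full (I : eqType) (s : seq I) (l : I -> lform V) K : uniq s ->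
  (forall c : I -> A, (forall i, i \notin s -> c i = 0) ->
     exists v, K v /\ forall i, i \in s -> l i v = c i) ->
  flag (map l s) K = 0.
Proof.
elim: s K => //= i s IH K /andP[ni us] full.
have -> : l i @` K = setT.
  apply/predeqP => a; split=> // _.
  have [j|v [Kv lv]] := full (fun j => if j == i then a else 0).
    by rewrite inE negb_or => /andP[/negPf->].
  by exists v => //; rewrite lv ?mem_head // eqxx.
rewrite psiT add0r; apply: IH => // c hc.
have [j|v [Kv lv]] := full c.
  by rewrite inE negb_or => /andP[_ /hc].
exists v; split=> [|j js]; last by rewrite lv // inE js orbT.
by split=> //=; rewrite lv ?mem_head // hc.
Qed.

End OneModule.

Lemma flag_transfer (V V' : lmodType A) (I : Type) (s : seq I)
    (l : I -> lform V) (l' : I -> lform V') (K : set V) (K' : set V') :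
  (forall v, K v -> exists v', K' v' /\ forall i, l i v = l' i v') ->
  (forall v', K' v' -> exists v, K v /\ forall i, l i v = l' i v') ->
  flag (map l s) K = flag (map l' s) K'.
Proof.
elim: s K K' => //= i s IH K K' h h'; congr (psi _ + _).
  apply/predeqP => a; split=> -[v].
    by move=> /h[v' [K'v' ->]] <-; exists v'.
  by move=> /h'[v' [K'v' e]] <-; exists v'.
apply: IH => v [] /=.
  by move=> /h[v' [K'v' e]] ei; exists v'; split=> //; split=> //=; rewrite -e.
by move=> /h'[v' [K'v' e]] ei; exists v'; split=> //; split=> //=; rewrite e.
Qed.

Lemma entry_subproof m (i : 'I_m) (a : A) (x y : 'rV[A]_m) :
  (a *: x + y) 0 i = a * x 0 i + y 0 i.
Proof. by rewrite !mxE. Qed.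

Definition entry m (i : 'I_m) : lform 'rV[A]_m := LForm (entry_subproof i).

Definition flag_inv (M : fgmod A) : G :=
  flag (map (@entry _) (enum 'I_(fg_rank M))) [set v | fg_rel M v].

Lemma quotm_pi_eq0 (M : fgmod A) v : quotm_pi (fg_rel M) v = 0 <-> fg_rel M v.
Proof.
rewrite -[X in _ = X](raddf0 (quotm_pi (fg_rel M))) quotm_piP subr0.
by rewrite -topredE.
Qed.

Lemma quotm_pi_mulmx (M : fgmod A) m (N : lmodType A) (f : {linear quotm (fg_rel M) -> N})
    (h : {linear 'rV[A]_m -> N}) (X : 'M[A]_(m, fg_rank M)) :
  (forall i, f (quotm_pi (fg_rel M) (row i X)) = h (delta_mx 0 i)) ->
  forall u, f (quotm_pi (fg_rel M) (u *m X)) = h u.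
Proof.
move=> hX u; rewrite mulmx_sum_row {2}[u]row_sum_delta !linear_sum /=.
by apply: eq_bigr => i _; rewrite !linearZ /= hX.
Qed.

Lemma row_choice m k (P : 'I_m -> 'rV[A]_k -> Prop) :
  (forall i, exists v, P i v) -> exists X : 'M[A]_(m, k), forall i, P i (row i X).
Proof.
by move=> /choice[r hr]; exists (\matrix_i r i) => i; rewrite rowK.
Qed.

(** X lifts f and Y lifts preimages of the generators of M''. Let K be the kernel of (u, w, v) |-> u
    X + w Y + v from A^(m' + m'' + m) to M. Reading w and u first, they are unconstrained and leave
    the relations of M on v. Reading v first, it is unconstrained, then w runs through the relations
    of M'' and u through those of M'. Both orders give the same flag value. *)
Lemma flag_inv_exact (M' M M'' : fgmod A) :
  short_exact (fgmod_module M') (fgmod_module M) (fgmod_module M'') ->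
  flag_inv M = flag_inv M' + flag_inv M''.
Proof.
case=> f [g [finj gsurj exact_fg]].
set pi' := quotm_pi (fg_rel M'); set pi := quotm_pi (fg_rel M).
set pi'' := quotm_pi (fg_rel M'').
have pi0 : pi 0 = 0 by rewrite /pi raddf0.
have piD : {morph pi : x y / x + y} by move=> x y; rewrite /pi raddfD.
have piN : {morph pi : x / - x} by move=> x; rewrite /pi raddfN.
have piZ a : {morph pi : x / a *: x} by move=> x; rewrite /pi linearZ.
have [X hX] : exists X : 'M[A]_(fg_rank M', fg_rank M), forall i,
    pi (row i X) = f (pi' (delta_mx 0 i)).
  by apply: (row_choice (P := fun i v => pi v = f (pi' (delta_mx 0 i)))) => i; exists (repr (f (pi' (delta_mx 0 i)))); exact: quotm_piK.
have [Y hY] : exists Y : 'M[A]_(fg_rank M'', fg_rank M), forall i,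
    g (pi (row i Y)) = pi'' (delta_mx 0 i).
  apply: (row_choice (P := fun i v => g (pi v) = pi'' (delta_mx 0 i))) => i.
  have [y ey] := gsurj (pi'' (delta_mx 0 i)); exists (repr y).
  by rewrite /pi quotm_piK.
have {}hX u : pi (u *m X) = f (pi' u).
  exact: (quotm_pi_mulmx (f := idfun) (h := f \o pi') hX).
have {}hY w : g (pi (w *m Y)) = pi'' w by exact: (quotm_pi_mulmx (h := pi'') hY).
have gf x : g (f x) = 0 by apply/exact_fg; exists x.
have gen v : exists u w, pi v = pi (u *m X) + pi (w *m Y).
  pose w := repr (g (pi v)).
  have /exact_fg[x fx] : g (pi v - pi (w *m Y)) = 0.
    by rewrite raddfB /= hY /w /pi'' quotm_piK subrr.
  exists (repr x), w.
  by rewrite hX /pi' quotm_piK fx subrK.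
pose V : lmodType A := ('rV[A]_(fg_rank M') * 'rV[A]_(fg_rank M'') * 'rV[A]_(fg_rank M))%type.
have luP (i : 'I_(fg_rank M')) (a : A) (x y : V) : (a *: x + y).1.1 0 i = a * x.1.1 0 i + y.1.1 0 i.
  exact: entry_subproof.
have lwP (i : 'I_(fg_rank M'')) (a : A) (x y : V) : (a *: x + y).1.2 0 i = a * x.1.2 0 i + y.1.2 0 i.
  exact: entry_subproof.
have lvP (i : 'I_(fg_rank M)) (a : A) (x y : V) : (a *: x + y).2 0 i = a * x.2 0 i + y.2 0 i.
  exact: entry_subproof.
pose lu i := LForm (luP i); pose lw i := LForm (lwP i); pose lv i := LForm (lvP i).
have allu (x : V) : all (fun l : lform V => l x == 0) (map lu (enum 'I_(fg_rank M'))) -> x.1.1 = 0.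
  rewrite all_map => /allP h; apply/rowP => i; rewrite mxE; apply/eqP.
  by apply: (h i); rewrite mem_enum.
have allw (x : V) : all (fun l : lform V => l x == 0) (map lw (enum 'I_(fg_rank M''))) -> x.1.2 = 0.
  rewrite all_map => /allP h; apply/rowP => i; rewrite mxE; apply/eqP.
  by apply: (h i); rewrite mem_enum.
have allv (x : V) : all (fun l : lform V => l x == 0) (map lv (enum 'I_(fg_rank M))) -> x.2 = 0.
  rewrite all_map => /allP h; apply/rowP => i; rewrite mxE; apply/eqP.
  by apply: (h i); rewrite mem_enum.
have allu0 (x : V) : x.1.1 = 0 -> all (fun l : lform V => l x == 0) (map lu (enum 'I_(fg_rank M'))).
  by move=> e; rewrite all_map; apply/allP => i _ /=; rewrite e mxE.
have allw0 (x : V) : x.1.2 = 0 -> all (fun l : lform V => l x == 0) (map lw (enum 'I_(fg_rank M''))).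
  by move=> e; rewrite all_map; apply/allP => i _ /=; rewrite e mxE.
have allv0 (x : V) : x.2 = 0 -> all (fun l : lform V => l x == 0) (map lv (enum 'I_(fg_rank M))).
  by move=> e; rewrite all_map; apply/allP => i _ /=; rewrite e mxE.
pose K : set V := [set x | pi (x.1.1 *m X) + pi (x.1.2 *m Y) + pi x.2 = 0].
have hK : lin_closed K.
  split=> [|a x y Kx Ky]; first by rewrite /K /= !mul0mx ?mul0mx !pi0 !addr0.
  have -> : K (a *: x + y) = (a *: (pi (x.1.1 *m X) + pi (x.1.2 *m Y) + pi x.2) +
      (pi (y.1.1 *m X) + pi (y.1.2 *m Y) + pi y.2) = 0).
    congr (_ = _); rewrite /= !mulmxDl -!scalemxAl !piD !piZ !scalerDr.
    by rewrite (addrACA (a *: _ + a *: _)) (addrACA (a *: pi (_ *m X))).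
  by rewrite Kx Ky scaler0 addr0.
(* The two readings of K; the three blocks that are unconstrained vanish by [flag_full]. *)
have := @flag_catC V K (map lw (enum 'I_(fg_rank M'')) ++ map lu (enum 'I_(fg_rank M')))
  (map lv (enum 'I_(fg_rank M))) hK.
rewrite !flag_cat.
rewrite flag_full ?enum_uniq //; last first.
  move=> c _; exists (0, \row_i c i, - ((\row_i c i) *m Y)) ; split=> [|i _]; last by rewrite /= mxE.
  by rewrite /K /= mul0mx ?mul0mx !pi0 add0r piN subrr.
rewrite flag_full ?enum_uniq //; last first.
  move=> c _; exists (\row_i c i, 0, - ((\row_i c i) *m X)) ; split=> [|i _]; last by rewrite /= mxE.
  split; last by apply: allw0.
  by rewrite /K /= mul0mx ?mul0mx !pi0 addr0 piN subrr.
rewrite [in RHS]flag_full ?enum_uniq //; last first.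
  move=> c _; have [u [w e]] := gen (- (\row_i c i)).
  exists (u, w, \row_i c i); split=> [|i _]; last by rewrite /= mxE.
  by rewrite /K /= -e piN addNr.
rewrite !add0r => e.
rewrite /flag_inv.
have <- : flag (map lv (enum 'I_(fg_rank M))) (K `&` [set v : V | all (fun l : lform V => l v == 0)
    (map lw (enum 'I_(fg_rank M'')) ++ map lu (enum 'I_(fg_rank M')))]) =
  flag (map (@entry _) (enum 'I_(fg_rank M))) [set v | fg_rel M v].
  apply: flag_transfer.
  - move=> [[u w] v] [] /=; rewrite all_cat /K /= => + /andP[/allw /= w0 /allu /= u0]; subst u w.
    rewrite !mul0mx ?mul0mx !pi0 !add0r => /quotm_pi_eq0 hv; by exists v.
  - move=> v hv; exists (0, 0, v); split=> //; split; last first.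
      by rewrite /= all_cat allu0 ?allw0.
    by rewrite /K /= !mul0mx ?mul0mx !pi0 !add0r; apply/quotm_pi_eq0.
rewrite e [RHS]addrC; congr (_ + _); apply: flag_transfer.
- move=> [[u w] v] [] /=; rewrite /K /= => + /allv /= v0; subst v; rewrite pi0 addr0 => h.
  exists w; split=> //; apply/quotm_pi_eq0; rewrite -/pi'' -hY.
  by rewrite -[RHS](raddf0 g) -h raddfD /= hX gf add0r.
- move=> w /quotm_pi_eq0; rewrite -/pi'' -hY => /exact_fg[z fz].
  exists (- repr z, w, 0); split=> //; split; last exact: allv0.
  by rewrite /K /= pi0 addr0 hX -fz -raddfD /= /pi' raddfN /= quotm_piK addNr raddf0.
- move=> [[u w] v] [[]] /=; rewrite /K /= => + /allv /= v0 /allw /= w0; subst v w.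
  rewrite mul0mx !pi0 !addr0 hX => h; exists u; split=> //; apply/quotm_pi_eq0.
  by apply: finj; rewrite h raddf0.
- move=> u /quotm_pi_eq0 h; exists (u, 0, 0); split=> //; split; last exact: allw0.
  split; last exact: allv0.
  by rewrite /K /= mul0mx !pi0 !addr0 hX /pi' h raddf0.
Qed.

Lemma G0_hom_of_flag : exists f : {additive G0 A -> G},
  forall M, f (quotg_pi _ (mod_class M)) = flag_inv M.
Proof.
pose h := free_ext (flag_inv : {classic fgmod A} -> G).
have hU M : h (mod_class M) = flag_inv M by exact: free_extU.
have hBB (x y z : {malg int[{classic fgmod A}]}) : h (x - y - z) = h x - h y - h z.
  by rewrite /h !free_ext_zmod_morphism.
have [x|f fE] := @quotg_lift_exists _ _ (@exact_relations A) h.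
  case=> M' [M [M'' [/flag_inv_exact ex ->]]].
  by rewrite [LHS]hBB !hU ex [flag_inv M' + _]addrC addrK subrr.
by exists f => M; rewrite fE.
Qed.

End FlagInvariant.

(** * Cyclic modules A/I *)

Section CyclicModules.
Variable A : pzRingType.

Lemma cyc_subproof (I : set A) : ideal I ->
  GRing.submod_closed (fun v : 'rV[A]_1 => `[< I (v 0 0) >]).
Proof.
case=> -[I0 IB] IM; split=> [|a u v /asboolP hu /asboolP hv].
  by apply/asboolP; rewrite mxE.
apply/asboolP; rewrite !mxE -[v 0 0]opprK; apply: (IB); first exact: IM.
by rewrite -sub0r; apply: (IB).
Qed.

Definition cyc (I : set A) (hI : ideal I) : fgmod A :=
  FgMod (Submodule (cyc_subproof hI)).

Lemma flag_inv_cyc (G : zmodType) (psi : set A -> G) I (hI : ideal I) :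
  flag_inv psi (cyc hI) = psi I.
Proof.
rewrite /flag_inv /=.
have -> : enum 'I_1 = [:: 0].
  by apply: (inj_map val_inj); rewrite val_enum_ord.
rewrite /= addr0; congr psi; apply/predeqP => a; split=> [[v /asboolP Iv <-] //|Ia].
by exists (const_mx a); rewrite /= mxE //; apply/asboolP.
Qed.

End CyclicModules.

(** * Divisors of a domain *)

Section Domain.
Variable A : comNzRingType.

Definition is_domain : Prop := forall a b : A, a * b = 0 -> a = 0 \/ b = 0.

(** Localisation is avoided by clearing denominators: in A_P, where s and u are units, every nonzero
    a is a unit times a power of t. For a nonzero prime P of a domain this makes A_P a discrete
    valuation ring. *)
Definition uniformizer (P : set A) (t : A) : Prop :=
  P t /\ forall a, a != 0 ->
    exists k s u, [/\ ~ P s, ~ P u & s * a = u * t ^+ k].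

Lemma ideal_mull (I : set A) a x : ideal I -> I x -> I (a * x).
Proof. by case=> _ h; exact: h. Qed.

Lemma ideal_mulr (I : set A) a x : ideal I -> I x -> I (x * a).
Proof. by rewrite mulrC; exact: ideal_mull. Qed.

Lemma ideal_opp (I : set A) x : ideal I -> I x -> I (- x).
Proof. by rewrite -mulN1r; exact: ideal_mull. Qed.

Lemma ideal_sub (I : set A) x y : ideal I -> I x -> I y -> I (x - y).
Proof. by case=> -[_ h] _; exact: h. Qed.

Lemma ideal_add (I : set A) x y : ideal I -> I x -> I y -> I (x + y).
Proof. by move=> hI hx hy; rewrite -[y]opprK; apply: ideal_sub => //; exact: ideal_opp. Qed.

Lemma ideal_zero (I : set A) : ideal I -> I 0.
Proof. by case=> -[]. Qed.

Lemma prime_not_mul (P : set A) a b : prime_ideal P -> ~ P a -> ~ P b -> ~ P (a * b).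
Proof. by case=> _ _ h na nb /h[]. Qed.

Lemma prime_not1 (P : set A) : prime_ideal P -> ~ P 1.
Proof. by case. Qed.

Lemma prime_exp (P : set A) a k : prime_ideal P -> P (a ^+ k) -> P a.
Proof.
move=> hP; elim: k => [|k IH]; first by rewrite expr0 => /(prime_not1 hP).
by rewrite exprS; case: hP => _ _ hP /hP[].
Qed.

Hypothesis dom : is_domain.

Lemma domain_mul_neq0 (a b : A) : a != 0 -> b != 0 -> a * b != 0.
Proof.
by move=> /eqP a0 /eqP b0; apply/eqP => /dom[].
Qed.

Lemma domain_exp_neq0 (a : A) k : a != 0 -> a ^+ k != 0.
Proof.
by move=> a0; elim: k => [|k IH]; rewrite ?expr0 ?oner_neq0 // exprS domain_mul_neq0.
Qed.

Lemma domain_mulIr (c a b : A) : c != 0 -> a * c = b * c -> a = b.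
Proof.
move=> /eqP c0 /eqP; rewrite -subr_eq0 -mulrBl => /eqP/dom[/eqP|//].
by rewrite subr_eq0 => /eqP.
Qed.

Lemma zero_prime : prime_ideal [set 0 : A].
Proof.
split=> //; last by apply/eqP; exact: oner_neq0.
by split=> [|a x ->]; [split=> // x y -> ->; rewrite /= subrr | rewrite /= mulr0].
Qed.

(** * The valuation at a prime with a uniformizer *)

Section OnePrime.
Variables (P : set A) (t : A).
Hypotheses (hP : prime_ideal P) (ht : uniformizer P t) (P_neq0 : exists2 a, P a & a != 0).

Let idP : ideal P. Proof. by case: hP. Qed.
Let Pt : P t. Proof. by case: ht. Qed.

Lemma uniformizer_neq0 : t != 0.
Proof.
apply/eqP => t0; have [a Pa a0] := P_neq0; have [_ /(_ a a0)] := ht.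
case=> -[|k] [s [u [ns nu e]]]; last first.
  rewrite t0 exprS mul0r mulr0 in e; case: (dom e) => [s0|/eqP]; last by rewrite (negPf a0).
  by apply: ns; rewrite s0; exact: ideal_zero.
by apply: nu; rewrite -[u]mulr1 -[1](expr0 t) -e; exact: ideal_mull.
Qed.

Definition has_val (a : A) (k : nat) : Prop :=
  exists s u, [/\ ~ P s, ~ P u & s * a = u * t ^+ k].

Definition val_ge (k : nat) : set A :=
  [set a | exists s c, ~ P s /\ s * a = c * t ^+ k].

Lemma val_geP a m k : has_val a m -> val_ge k a <-> (k <= m)%N.
Proof.
case=> s [u [ns nu e]]; split=> [[s' [c [ns' e']]]|km]; last first.
  by exists s, (u * t ^+ (m - k)); split=> //; rewrite e -mulrA -exprD subnK.
rewrite leqNgt; apply/negP => mk.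
have e1 : s * c * t ^+ (k - m) = s' * u.
  apply: (@domain_mulIr (t ^+ m)); first exact/domain_exp_neq0/uniformizer_neq0.
  by rewrite -!mulrA -exprD subnK 1?ltnW // -e -e' mulrCA.
have : ~ P (s' * u) by apply: prime_not_mul.
apply; rewrite -e1; apply: ideal_mull => //.
by rewrite -[(k - m)%N]prednK ?subn_gt0 // exprS; apply: ideal_mulr.
Qed.

Lemma has_val_exists a : a != 0 -> exists k, has_val a k.
Proof. by case: ht => _ h /h[k [s [u h']]]; exists k, s, u. Qed.

Lemma has_valM a b k m : has_val a k -> has_val b m -> has_val (a * b) (k + m).
Proof.
case=> s [u [ns nu e]] [s' [u' [ns' nu' e']]]; exists (s * s'), (u * u').
split; [exact: prime_not_mul | exact: prime_not_mul |].
by rewrite mulrACA e e' mulrACA exprD.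
Qed.

Lemma has_val_mem a k : has_val a k -> P a <-> (0 < k)%N.
Proof.
case=> s [u [ns nu e]]; split=> [Pa|].
  rewrite lt0n; apply/negP => /eqP k0; apply: nu.
  by rewrite -[u]mulr1 -(expr0 t) -k0 -e; exact: ideal_mull.
case: k e => // k e _; have : P (s * a).
  by rewrite e exprS; apply: ideal_mull => //; exact: ideal_mulr.
by case: hP => _ _ h /h[].
Qed.

Lemma has_val_div a b k m : has_val a k -> has_val b m -> (k <= m)%N ->
  exists s c, ~ P s /\ s * b = c * a.
Proof.
case=> s [u [ns nu e]] [s' [u' [ns' nu' e']]] km.
exists (s' * u), (u' * t ^+ (m - k) * s); split; first exact: prime_not_mul.
rewrite mulrAC e' -[RHS]mulrA e -[in LHS](subnK km) exprD; ring.
Qed.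

Lemma val_ge_ideal k : ideal (val_ge k).
Proof.
split; first split.
- by exists 1, 0; split; [exact: prime_not1 | rewrite mulr0 mul0r].
- move=> a b [s [c [ns e]]] [s' [c' [ns' e']]].
  exists (s * s'), (s' * c - s * c'); split; first exact: prime_not_mul.
  have -> : s * s' * (a - b) = s' * (s * a) - s * (s' * b) by ring.
  by rewrite e e'; ring.
- move=> a x [s [c [ns e]]]; exists s, (a * c); split=> //.
  by rewrite mulrCA e mulrA.
Qed.

Lemma ideal_pow_val_ge k : ideal_pow P k `<=` val_ge k.
Proof.
elim: k => [|k IH] a.
  by move=> _; exists 1, a; split; [exact: prime_not1 | rewrite mul1r mulr1].
apply; split; first exact: val_ge_ideal.
move=> _ [x [y [Px /IH[s [c [ns e]]] ->]]].
have [->|x0] := eqVneq x 0; first by rewrite mul0r; exact: (ideal_zero (val_ge_ideal _)).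
have [m hm] := has_val_exists x0.
have /(val_geP 1 hm)[s' [c' [ns' e']]] : (1 <= m)%N by exact: ((has_val_mem hm).1 Px).
exists (s' * s), (c' * c); split; first exact: prime_not_mul.
by rewrite mulrACA e' e expr1 exprS; ring.
Qed.

Lemma ideal_pow_uniformizer k c : ideal_pow P k (c * t ^+ k).
Proof.
elim: k c => //= k IH c M [_]; apply.
by exists t, (c * t ^+ k); split=> //; rewrite exprS mulrCA.
Qed.

(** Principal divisors are defined by symbolic powers, and this identifies those with the filtration
    by valuation: each factor from P contributes a power of t to a product in P^k, and conversely
    every c * t ^+ k lies in P^k. *)
Lemma symbolic_powP a k m : has_val a m -> symbolic_pow P k a <-> (k <= m)%N.
Proof.
move=> ham; rewrite -(val_geP k ham); split.
  move=> [s [ns /ideal_pow_val_ge[s' [c [ns' e]]]]].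
  by exists (s' * s), c; split; [exact: prime_not_mul | rewrite -mulrA].
move=> [s [c [ns e]]]; exists s; split=> //.
by rewrite e; exact: ideal_pow_uniformizer.
Qed.

(** A nonzero prime q' inside P contains some u * t ^+ k with u outside P, hence contains t. Every
    element of P is a multiple of t up to a factor outside P, so q' is all of P. *)
Lemma uniformizer_height_one : height_one P.
Proof.
split=> //.
  exists [set 0]; split; first exact: zero_prime.
  have [a Pa /eqP a0] := P_neq0.
  by split=> [_ ->|h]; [exact: ideal_zero | apply: a0; exact: h].
case=> q [q' [hq hq' [qq' nq'q] [q'P]]]; apply => b Pb.
have idq' : ideal q' by case: hq'.
have [a q'a a0] : exists2 a, q' a & a != 0.
  apply: contrapT => h; apply: nq'q => a q'a.
  have [->|a0] := eqVneq a 0; first by case: hq => /ideal_zero.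
  by case: h; exists a.
have q't : q' t.
  have [k [s [u [ns nu e]]]] : exists k, has_val a k by exact: has_val_exists.
  apply: (@prime_exp _ _ k) => //; case: hq' => _ _ /(_ u (t ^+ k)) [|/q'P //|//].
  by rewrite -e; exact: ideal_mull.
have [->|b0] := eqVneq b 0; first exact: ideal_zero.
have [k hk] := has_val_exists b0; have k0 : (0 < k)%N by exact: ((has_val_mem hk).1 Pb).
case: hk => s [u [ns nu e]]; case: hq' => _ _ /(_ s b) [|/q'P //|//].
rewrite e; apply: ideal_mull => //.
by rewrite -(prednK k0) exprS; exact: ideal_mulr.
Qed.

End OnePrime.

(** These two hypotheses stand in for normality and noetherianity: they make divisors of nonzero
    elements unique and finitely supported. The surface satisfies them by [surface_dvr] and
    [surface_finite_support]. *)
Hypothesis dvr : forall P : prime_divisor A, exists t, uniformizer (val P) t.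
Hypothesis finite_support : forall a : A, a != 0 ->
  exists s : seq (prime_divisor A), forall P : prime_divisor A, val P a -> P \in s.

(** * Divisors and divisor classes of elements and ideals *)

Section Divisors.

Implicit Types (P : prime_divisor A) (a b : A) (I : set A).

Lemma prime_divisorP P : height_one (val P).
Proof. by case: P => P /= /asboolP. Qed.

Lemma prime_divisor_prime P : prime_ideal (val P).
Proof. by case: (prime_divisorP P). Qed.

Lemma prime_divisor_ideal P : ideal (val P).
Proof. by case: (prime_divisor_prime P). Qed.

Lemma prime_divisor_neq0 P : exists2 a, val P a & a != 0.
Proof.
case: (prime_divisorP P) => _ [q [hq [qP nPq]]] _.
apply: contrapT => h; apply: nPq => a Pa.
have [->|a0] := eqVneq a 0; first by case: hq => /ideal_zero.
by case: h; exists a.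
Qed.

Lemma prime_divisor_min P (Q : set A) :
  prime_ideal Q -> (exists2 a, Q a & a != 0) -> Q `<=` val P -> Q = val P.
Proof.
move=> hQ [a Qa /eqP a0] QP; apply/seteqP; split=> //.
apply: contrapT => nPQ; case: (prime_divisorP P) => _ _; apply.
exists [set 0], Q; split=> //; first exact: zero_prime.
split=> [_ ->|h]; first by case: hQ => /ideal_zero.
by apply: a0; exact: h.
Qed.

(** Stated through symbolic powers, so that no uniformizer has to be chosen. The default 0 is the
    value at a = 0, which lies in every symbolic power. *)
Definition ord P a : nat :=
  xget 0%N [set k | symbolic_pow (val P) k a /\ ~ symbolic_pow (val P) k.+1 a].

Lemma ordP P a k : a != 0 ->
  (symbolic_pow (val P) k a /\ ~ symbolic_pow (val P) k.+1 a) <-> k = ord P a.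
Proof.
move=> a0; have [t ht] := dvr P; have hP := prime_divisor_prime P.
have [m hm] := has_val_exists ht a0.
have char j : (symbolic_pow (val P) j a /\ ~ symbolic_pow (val P) j.+1 a) <-> j = m.
  rewrite !(symbolic_powP hP ht (prime_divisor_neq0 P) _ hm).
  split=> [[jm /negP]|->]; last by rewrite ltnn.
  by rewrite -leqNgt => mj; apply/eqP; rewrite eqn_leq jm.
rewrite char /ord; case: xgetP => [j _ /char -> //|/(_ m)].
by case; exact/char.
Qed.

Lemma ordE P t a k : uniformizer (val P) t -> a != 0 -> has_val (val P) t a k -> ord P a = k.
Proof.
move=> ht a0 hk; apply/esym/ordP => //.
rewrite !(symbolic_powP (prime_divisor_prime P) ht (prime_divisor_neq0 P) _ hk).
by split=> //; rewrite ltnn.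
Qed.

Lemma has_val_ord P t a : uniformizer (val P) t -> a != 0 -> has_val (val P) t a (ord P a).
Proof.
by move=> ht a0; have [k hk] := has_val_exists ht a0; rewrite (ordE ht a0 hk).
Qed.

Lemma ordM P a b : a != 0 -> b != 0 -> ord P (a * b) = (ord P a + ord P b)%N.
Proof.
move=> a0 b0; have [t ht] := dvr P.
apply: (ordE ht); first exact: domain_mul_neq0.
exact: (has_valM (prime_divisor_prime P) (has_val_ord ht a0) (has_val_ord ht b0)).
Qed.

Lemma ord_gt0 P a : a != 0 -> (0 < ord P a)%N <-> val P a.
Proof.
move=> a0; have [t ht] := dvr P.
have := has_val_mem (prime_divisor_prime P) ht (has_val_ord ht a0); tauto.
Qed.

Lemma ord_eq0 P a : a != 0 -> ~ val P a -> ord P a = 0%N.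
Proof. by move=> a0 na; apply/eqP; rewrite -leqn0 leqNgt; apply/negP => /ord_gt0; auto. Qed.

Lemma ord_div P a b : a != 0 -> b != 0 -> (ord P a <= ord P b)%N ->
  exists s c, ~ val P s /\ s * b = c * a.
Proof.
move=> a0 b0; have [t ht] := dvr P.
exact: (has_val_div (prime_divisor_prime P) (has_val_ord ht a0) (has_val_ord ht b0)).
Qed.

Lemma ord_uniformizer P t : uniformizer (val P) t -> ord P t = 1%N.
Proof.
move=> ht; have hP := prime_divisor_prime P.
apply: (ordE ht); first exact: (uniformizer_neq0 hP ht (prime_divisor_neq0 P)).
by exists 1, 1; split; [exact: prime_not1.. | rewrite expr1].
Qed.

Lemma is_divE a (D : {malg int[prime_divisor A]}) : a != 0 ->
  is_div a D <-> forall P, mcoeff P D = (ord P a)%:Z.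
Proof.
move=> a0; split=> h P; last by exists (ord P a); rewrite h; have [] := (ordP P (ord P a) a0).2 erefl.
by have [k [-> h1 h2]] := h P; congr (_%:Z); apply/ordP.
Qed.

Lemma is_div_exists a : a != 0 -> exists D, is_div a D.
Proof.
move=> a0; have [s hs] := finite_support a0.
have [P|D hD] := @free_abelian_finsupp _ s (fun P => (ord P a)%:Z).
  by move=> n0; apply/hs/ord_gt0 => //; rewrite lt0n.
by exists D; apply/is_divE.
Qed.

Lemma is_divM a b D E : a != 0 -> b != 0 -> is_div a D -> is_div b E -> is_div (a * b) (D + E).
Proof.
move=> a0 b0 /(is_divE _ a0) hD /(is_divE _ b0) hE.
apply/is_divE; first exact: domain_mul_neq0.
by move=> P; rewrite mcoeffD hD hE ordM // PoszD.
Qed.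

Lemma is_div_uniq a D E : a != 0 -> is_div a D -> is_div a E -> D = E.
Proof.
by move=> a0 /(is_divE _ a0) hD /(is_divE _ a0) hE; apply/malgP => P; rewrite hD hE.
Qed.

Lemma is_div_principal a D : a != 0 -> is_div a D -> quotg_pi (@principal_divisors A) D = 0.
Proof. by move=> a0 h; apply/quotg_pi_eq0/mem_span; exists a. Qed.

Definition nonzero_set I : Prop := exists2 a, I a & a != 0.

Definition ideal_ord P I : nat :=
  xget 0%N [set k | (exists a, [/\ I a, a != 0 & ord P a = k]) /\
                    forall a, I a -> a != 0 -> (k <= ord P a)%N].

Lemma ideal_ordP P I : nonzero_set I ->
  (exists a, [/\ I a, a != 0 & ord P a = ideal_ord P I]) /\
  forall a, I a -> a != 0 -> (ideal_ord P I <= ord P a)%N.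
Proof.
move=> [a Ia a0]; rewrite /ideal_ord; case: xgetP => [k _ //|none].
have ex : exists k, `[< exists b, [/\ I b, b != 0 & ord P b = k] >].
  by exists (ord P a); apply/asboolP; exists a.
case: (none (ex_minn ex)); case: ex_minnP => m /asboolP hm min; split=> // b Ib b0.
by apply: min; apply/asboolP; exists b.
Qed.

Lemma ideal_ordE P I a : I a -> a != 0 -> (forall b, I b -> b != 0 -> (ord P a <= ord P b)%N) ->
  ideal_ord P I = ord P a.
Proof.
move=> Ia a0 min; have [[b [Ib b0 eb]] h] := ideal_ordP P (ex_intro2 _ _ a Ia a0).
by apply/eqP; rewrite eqn_leq h // -eb min.
Qed.

Definition ideal_div I : {malg int[prime_divisor A]} :=
  xget 0 [set D | forall P, mcoeff P D = (ideal_ord P I)%:Z].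

(** The order of I at P is at most that of any one nonzero element of I, so the support is
    finite. *)
Lemma ideal_divP I : nonzero_set I -> forall P, mcoeff P (ideal_div I) = (ideal_ord P I)%:Z.
Proof.
move=> hI; rewrite /ideal_div; case: xgetP => [D _ //|none].
have [a Ia a0] := hI; have [s hs] := finite_support a0.
have [P|D hD] := @free_abelian_finsupp _ s (fun P => (ideal_ord P I)%:Z); last by case: (none D).
move=> n0; apply/hs/ord_gt0 => //; have [_ /(_ a Ia a0)] := ideal_ordP P hI.
by apply: leq_trans; rewrite lt0n.
Qed.

(* The rank and, up to sign, the first Chern class of the torsion-free module I. *)
Definition ideal_class I : int * Cl A :=
  if `[< nonzero_set I >] then (0, - quotg_pi _ (ideal_div I)) else (1, 0).

Lemma ideal_class_zero I : ~ nonzero_set I -> ideal_class I = (1, 0).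
Proof. by rewrite /ideal_class; case: asboolP. Qed.

Lemma ideal_class_nonzero I : nonzero_set I ->
  ideal_class I = (0, - quotg_pi _ (ideal_div I)).
Proof. by rewrite /ideal_class; case: asboolP. Qed.

Lemma ideal_classT : ideal_class setT = 0.
Proof.
have nT : nonzero_set [set: A] by exists 1 => //; exact: oner_neq0.
rewrite ideal_class_nonzero //; have -> : ideal_div setT = 0; last by rewrite raddf0 oppr0.
apply/malgP => P; rewrite ideal_divP // mcoeff0.
have o1 : ord P 1 = 0%N.
  apply: ord_eq0; [exact: oner_neq0 | exact: (prime_not1 (prime_divisor_prime _))].
by rewrite (@ideal_ordE P setT 1) ?o1 ?oner_neq0.
Qed.

(** Distinct height one primes are incomparable, so for Q != P some element of P has order 0 at Q;
    at P itself a uniformizer realises order 1. *)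
Lemma ideal_class_prime P : ideal_class (val P) = (0, - quotg_pi _ (mkmalgU P 1)).
Proof.
have nP := prime_divisor_neq0 P; rewrite ideal_class_nonzero //; congr (_, - quotg_pi _ _).
apply/malgP => Q; rewrite ideal_divP // mcoeffU; case: eqP => [<-|PQ].
  have [t ht] := dvr P; have -> // : ideal_ord P (val P) = 1%N.
  rewrite -[RHS](ord_uniformizer ht); apply: ideal_ordE.
  - by case: ht.
  - exact: (uniformizer_neq0 (prime_divisor_prime P) ht nP).
  - by move=> b Pb b0; rewrite (ord_uniformizer ht); apply/ord_gt0.
have [a Pa nQa] : exists2 a, val P a & ~ val Q a.
  apply: contrapT => h; apply/PQ/val_inj/prime_divisor_min => //.
    exact: prime_divisor_prime.
  by move=> a Pa; apply: contrapT => nQa; apply: h; exists a.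
have a0 : a != 0 by apply/eqP => a0; apply: nQa; rewrite a0; exact: (ideal_zero (prime_divisor_ideal _)).
have oa : ord Q a = 0%N by exact: ord_eq0.
by rewrite (ideal_ordE Pa a0) ?oa.
Qed.

Section Swap.
Variable R : A -> A -> Prop.
Hypotheses (R0 : R 0 0)
  (RD : forall a x y x' y', R x y -> R x' y' -> R (a * x + x') (a * y + y')).
Let J1 := [set a | exists b, R a b].
Let J2 := [set b | exists a, R a b].
Let I1 := [set a | R a 0].
Let I2 := [set b | R 0 b].

(* If [a, b] in R and [c, 0] in R realise the minima of [ord P] on J2 and I1, then an
   elimination over the local ring at P bounds the order of the minor [b * c] from below. *)
Lemma swap_ord_le P : nonzero_set I1 -> nonzero_set I2 ->
  (ideal_ord P J1 + ideal_ord P I2 <= ideal_ord P J2 + ideal_ord P I1)%N.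
Proof.
move=> nI1 nI2.
have nJ1 : nonzero_set J1 by have [a Ia a0] := nI1; exists a => //; exists 0.
have nJ2 : nonzero_set J2 by have [a Ia a0] := nI2; exists a => //; exists 0.
have [_ minJ1] := ideal_ordP P nJ1; have [_ minI2] := ideal_ordP P nI2.
have [[b [[a Rab] b0 <-]] _] := ideal_ordP P nJ2.
have [[c [Rc c0 <-]] _] := ideal_ordP P nI1.
have sP s : ~ val P s -> s != 0 /\ ord P s = 0%N.
  move=> ns; have s0 : s != 0.
    by apply/eqP => s0; apply: ns; rewrite s0; exact: (ideal_zero (prime_divisor_ideal _)).
  by split=> //; exact: ord_eq0.
have [ca|ac] : (a = 0 \/ (ord P c <= ord P a)%N) \/ (a != 0 /\ (ord P a < ord P c)%N).
- by have [->|a0] := eqVneq a 0; [left; left | case: (leqP (ord P c) (ord P a)) => h; [left; right | right]].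
(* Locally c divides a: a multiple of [c, 0] clears the first entry of s * [a, b], so b has the
   order of an element of I2. *)
- have [s [t [ns e]]] : exists s t, ~ val P s /\ s * a = t * c.
    have [->|a0] := eqVneq a 0; last by apply: ord_div => //; case: ca => // a0'; rewrite a0' eqxx in a0.
    by exists 1, 0; split; [exact: (prime_not1 (prime_divisor_prime _)) | rewrite mulr0 mul0r].
  have [s0 os] := sP s ns.
  have : I2 (s * b).
    have := RD s Rab (RD (- t) Rc R0); rewrite !addr0 e mulr0 addr0.
    by rewrite mulNr subrr.
  move=> /minI2; rewrite domain_mul_neq0 // ordM // os => /(_ isT) h.
  have : (ideal_ord P J1 <= ord P c)%N by apply: minJ1 => //; exists 0.
  by lia.
(* Locally a divides c: clearing the first entry of s * [c, 0] with [a, b] leaves t * b in I2, and t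
   has order ord c - ord a. *)
case: ac => a0 ac; have [s [t [ns e]]] := ord_div a0 c0 (ltnW ac).
have [s0 os] := sP s ns.
have t0 : t != 0.
  apply/eqP => t0; have := domain_mul_neq0 s0 c0.
  by rewrite e t0 mul0r eqxx.
have : I2 (- t * b).
  have := RD s Rc (RD (- t) Rab R0); rewrite !addr0 e mulr0 add0r.
  by rewrite mulNr subrr.
rewrite mulNr => h; have {h} : I2 (t * b).
  by have := RD (-1) h R0; rewrite mulr0 addr0 mulN1r opprK addr0.
move=> /minI2; rewrite domain_mul_neq0 // ordM // => /(_ isT) h.
have : (ideal_ord P J1 <= ord P a)%N by apply: minJ1 => //; exists b.
have := congr1 (ord P) e; rewrite !ordM // os.
by lia.
Qed.

End Swap.

Lemma nonzero_setPn I : ~ nonzero_set I -> forall a, I a -> a = 0.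
Proof. by move=> h a Ia; apply/eqP; apply: contrapT => /negP a0; apply: h; exists a. Qed.

(** If I1 and I2 are both nonzero, R has rank 2 and [swap_ord_le], used for R and its transpose,
    compares orders at each prime. If just one is zero, a minor shows that R lies on a coordinate
    axis. If both are zero, R is zero or the graph of an isomorphism between J1 and J2, whose
    divisors then differ by a principal one. *)
Lemma ideal_class_swap (R : A -> A -> Prop) : R 0 0 ->
  (forall a x y x' y', R x y -> R x' y' -> R (a * x + x') (a * y + y')) ->
  ideal_class [set a | exists b, R a b] + ideal_class [set b | R 0 b] =
  ideal_class [set b | exists a, R a b] + ideal_class [set a | R a 0].
Proof.
move=> R0 RD; set J1 := [set a | _]; set I2 := [set b | _].
set J2 := [set b | _]; set I1 := [set a | _].
have det a b a' b' : R a b -> R a' b' -> R (b' * a - b * a') 0.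
  move=> Rab Rab'; have := RD b' _ _ _ _ Rab (RD (- b) _ _ _ _ Rab' R0).
  by rewrite !addr0 !mulNr (mulrC b' b) subrr.
have det' a b a' b' : R a b -> R a' b' -> R 0 (a' * b - a * b').
  move=> Rab Rab'; have := RD a' _ _ _ _ Rab (RD (- a) _ _ _ _ Rab' R0).
  by rewrite !addr0 !mulNr (mulrC a' a) subrr.
have [nI1|zI1] := pselect (nonzero_set I1); have [nI2|zI2] := pselect (nonzero_set I2).
- have nJ1 : nonzero_set J1 by have [a Ia a0] := nI1; exists a => //; exists 0.
  have nJ2 : nonzero_set J2 by have [a Ia a0] := nI2; exists a => //; exists 0.
  rewrite !ideal_class_nonzero //; congr (_, _).
  rewrite /= -!opprD -!(raddfD (quotg_pi _)); congr (- quotg_pi _ _).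
  apply/malgP => P; rewrite !mcoeffD !ideal_divP // -!PoszD; congr (_%:Z).
  apply/eqP; rewrite eqn_leq swap_ord_le //=.
  by apply: (@swap_ord_le (fun x y => R y x)) => // a x y x' y'; exact: RD.
- have zJ2 : forall b, J2 b -> b = 0.
    have [c Ic c0] := nI1 => b [a Rab]; have := nonzero_setPn zI2 (det' _ _ _ _ Rab Ic).
    by rewrite mulr0 subr0 => /dom[/eqP|//]; rewrite (negPf c0).
  have -> : J1 = I1.
    apply/predeqP => a; split=> [[b Rab]|Ia]; last by exists 0.
    by rewrite /I1 /= -(zJ2 b) //; exists a.
  rewrite addrC; congr (_ + _); rewrite !ideal_class_zero // => -[b /zJ2 ->].
  by rewrite eqxx.
- have zJ1 : forall a, J1 a -> a = 0.
    have [c Ic c0] := nI2 => a [b Rab]; have := nonzero_setPn zI1 (det _ _ _ _ Rab Ic).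
    by rewrite mulr0 subr0 => /dom[/eqP|//]; rewrite (negPf c0).
  have -> : J2 = I2.
    apply/predeqP => b; split=> [[a Rab]|Ib]; last by exists 0.
    by rewrite /I2 /= -(zJ1 a) //; exists b.
  rewrite addrC; congr (_ + _); rewrite !ideal_class_zero // => -[a /zJ1 ->].
  by rewrite eqxx.
rewrite (ideal_class_zero zI1) (ideal_class_zero zI2); congr (_ + _).
have inj a b : R a b -> (a == 0) = (b == 0).
  move=> Rab; apply/eqP/eqP => e; rewrite e in Rab.
    exact: (nonzero_setPn zI2).
  exact: (nonzero_setPn zI1).
have [nJ1|zJ1] := pselect (nonzero_set J1); last first.
  rewrite !ideal_class_zero // => -[b [a Rab] b0]; apply: zJ1.
  by exists a; [exists b | rewrite (inj _ _ Rab)].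
have [a0 [b0 R0ab] na0] := nJ1; have nb0 : b0 != 0 by rewrite -(inj _ _ R0ab).
have nJ2 : nonzero_set J2 by exists b0 => //; exists a0.
rewrite !ideal_class_nonzero //; congr (_, - _).
(* J2 is J1 scaled by the fraction b0 / a0, because the minor of [a, b] and [a0, b0] lies in I1 =
   0. *)
have prop a b : R a b -> b0 * a = a0 * b.
  move=> Rab; have /(nonzero_setPn zI1)/eqP := det _ _ _ _ Rab R0ab.
  by rewrite subr_eq0 (mulrC b) => /eqP.
have [D hD] := is_div_exists na0; have [E hE] := is_div_exists nb0.
apply/quotg_piP/quotg_pi_eq0.
have -> : ideal_div J1 - ideal_div J2 = D - E.
  apply/malgP => P; rewrite !mcoeffB !ideal_divP //.
  rewrite ((is_divE _ na0).1 hD) ((is_divE _ nb0).1 hE).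
  have [[a [[b Rab] na oa]] minJ1] := ideal_ordP P nJ1.
  have [[b' [[a' Rab'] nb' ob']] minJ2] := ideal_ordP P nJ2.
  have nb : b != 0 by rewrite -(inj _ _ Rab).
  have na' : a' != 0 by rewrite (inj _ _ Rab').
  have := congr1 (ord P) (prop _ _ Rab); have := congr1 (ord P) (prop _ _ Rab').
  rewrite !ordM // -oa -ob'.
  have : (ord P b' <= ord P b)%N by rewrite ob'; apply: minJ2 => //; exists a.
  have : (ord P a <= ord P a')%N by rewrite oa; apply: minJ1 => //; exists b'.
  by lia.
rewrite (raddfB (quotg_pi _)) /= (is_div_principal na0 hD) (is_div_principal nb0 hE).
by rewrite subrr.
Qed.

End Divisors.
End Domain.

(** * Factorisation in F[z][x] *)

(* [lia] does not identify the different canonical forms of [size p]. *)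
Ltac size_lia :=
  repeat match goal with H : context [@size _ _] |- _ => move: H end;
  repeat match goal with |- context [@size ?T ?s] => move: (@size T s) => ? end;
  move=> *; lia.

Section BivariateFactorial.
Variable F : closedFieldType.
Local Notation S := {poly {poly F}}.
Implicit Types (f g h q : S) (c : {poly F}) (a : F).

(** Exact divisibility in F[z][x]. The library relation [%|] on polynomials over F[z] allows a
    nonzero factor from F[z], that is, it is divisibility over F(z). *)
Definition divides f g : Prop := exists h, g = f * h.

(* An additive degree, in contrast with the total degree its additivity is immediate. *)
Definition mu f : nat := ((size f).-1 + (size (lead_coef f)).-1)%N.

Lemma muM f g : f != 0 -> g != 0 -> mu (f * g) = (mu f + mu g)%N.
Proof.
move=> f0 g0; rewrite /mu size_mul // lead_coefM size_mul ?lead_coef_eq0 //.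
have := f0; have := g0; rewrite -!size_poly_gt0 => sf sg.
have : (0 < size (lead_coef f))%N by rewrite size_poly_gt0 lead_coef_eq0.
have : (0 < size (lead_coef g))%N by rewrite size_poly_gt0 lead_coef_eq0.
by size_lia.
Qed.

Lemma mu_eq0 f : f != 0 -> mu f = 0%N -> exists2 a, a != 0 & f = a%:P%:P.
Proof.
move=> f0 m0; have sf : size f = 1%N.
  by move: m0; rewrite /mu; have := f0; rewrite -size_poly_gt0; size_lia.
have /size_poly1P[c c0 ec] : size f == 1%N by rewrite sf.
have /size_poly1P[a a0 ea] : size c == 1%N.
  move: m0; rewrite /mu ec lead_coefC; have := c0; rewrite -size_poly_gt0; size_lia.
by exists a; rewrite // ec ea.
Qed.

Lemma mu_const a : mu a%:P%:P = 0%N.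
Proof. by rewrite /mu lead_coefC !size_polyC; case: eqP; case: (a == 0). Qed.

Definition lin a : S := ('X - a%:P)%:P.

Lemma lin_neq0 a : lin a != 0.
Proof. by rewrite polyC_eq0 polyXsubC_eq0. Qed.

Lemma mu_lin a : mu (lin a) = 1%N.
Proof. by rewrite /mu lead_coefC size_XsubC size_polyC polyXsubC_eq0. Qed.

Lemma lin_dividesP a g : divides (lin a) g <-> map_poly (horner_eval a) g = 0.
Proof.
split=> [[h ->]|g0].
  by rewrite rmorphM /= map_polyC /= /horner_eval hornerXsubC subrr polyC0 mul0r.
exists (map_poly (fun c => c %/ ('X - a%:P)) g); apply/polyP => i.
rewrite coefCM coef_map_id0 ?div0p //.
have /polyP/(_ i) := g0; rewrite coef_map coef0 /= /horner_eval => /eqP.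
by rewrite -/(root _ a) -dvdp_XsubCl => /divpK h; rewrite mulrC h.
Qed.

Lemma lin_prime a g h : divides (lin a) (g * h) -> divides (lin a) g \/ divides (lin a) h.
Proof.
rewrite !lin_dividesP rmorphM /= => /eqP.
by rewrite mulf_eq0 => /orP[]/eqP; [left | right].
Qed.

Lemma poly_root c : (1 < size c)%N -> exists a c', c = ('X - a%:P) * c'.
Proof.
move=> sc; have /closed_rootP[a] : size c != 1%N by size_lia.
by rewrite -dvdp_XsubCl => /dvdpP[c' ->]; exists a, c'; rewrite mulrC.
Qed.

(** Over an algebraically closed field a non-unit content has a linear factor, so this says that the
    content of f is a unit. *)
Definition primitive f : Prop := forall a, ~ divides (lin a) f.

(* Gauss lemma: a linear factor of the content c divides f * q, hence q. *)
Lemma primitive_divides f h q c : c != 0 -> primitive f -> c%:P * h = f * q -> divides f h.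
Proof.
move=> c0 pf; move: {2}(size c) (leqnn (size c)) => m; elim: m => [|m IH] in c c0 q *.
  by rewrite leqn0 size_poly_eq0 (negPf c0).
move=> sc e; have [s1|s1] := leqP (size c) 1.
  have /size_poly1P[a a0 ea] : size c == 1%N by rewrite eqn_leq s1 size_poly_gt0.
  exists (a^-1%:P%:P * q); rewrite mulrCA -e mulrA ea -!polyCM mulVf //.
  by rewrite polyC1 mul1r.
have [a [c' ec]] := poly_root s1.
have c'0 : c' != 0 by apply: contraNneq c0 => c'0; rewrite ec c'0 mulr0.
have /lin_prime[/pf[]|[q' eq]] : divides (lin a) (f * q).
  by rewrite -e ec polyCM -mulrA; exists (c'%:P * h).
apply: (IH c' c'0 q').
  by move: sc; rewrite ec size_mul ?polyXsubC_eq0 // size_XsubC; size_lia.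
by apply: (mulfI (lin_neq0 a)); rewrite mulrA -polyCM -ec e eq mulrCA.
Qed.

Lemma primitive_part f : f != 0 ->
  exists c g, [/\ c != 0, primitive g, size g = size f & f = c%:P * g].
Proof.
move: {2}(mu f) (leqnn (mu f)) => m; elim: m f => [|m IH] f mf f0.
  exists 1, f; rewrite oner_neq0 polyC1 mul1r; split=> // a [h e].
  have h0 : h != 0 by apply: contraNneq f0 => h0; rewrite e h0 mulr0.
  by move: mf; rewrite e muM ?lin_neq0 // mu_lin.
have [[a [h e]]|pf] := pselect (exists a, divides (lin a) f); last first.
  exists 1, f; rewrite oner_neq0 polyC1 mul1r; split=> // a h.
  by apply: pf; exists a.
have h0 : h != 0 by apply: contraNneq f0 => h0; rewrite e h0 mulr0.
have [|c [g [c0 pg sg eh]]] := IH h _ h0.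
  by move: mf; rewrite e muM ?lin_neq0 // mu_lin.
exists (('X - a%:P) * c), g; rewrite mulf_neq0 ?polyXsubC_eq0 //; split=> //.
  rewrite sg e size_mul ?lin_neq0 // size_polyC polyXsubC_eq0 /=; size_lia.
by rewrite e eh polyCM mulrA.
Qed.

Definition irred f : Prop :=
  [/\ f != 0, mu f <> 0%N & forall g h, f = g * h -> mu g = 0%N \/ mu h = 0%N].

Lemma irred_mu1 f : mu f = 1%N -> irred f.
Proof.
move=> m1; have f0 : f != 0.
  by apply/eqP => f0; move: m1; rewrite f0 /mu lead_coef0 !size_poly0.
split=> //; first by rewrite m1.
move=> g h e; have g0 : g != 0 by apply: contraNneq f0 => z; rewrite e z mul0r.
have h0 : h != 0 by apply: contraNneq f0 => z; rewrite e z mulr0.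
by move: m1; rewrite e muM //; size_lia.
Qed.

Lemma irred_lin a : irred (lin a).
Proof. exact/irred_mu1/mu_lin. Qed.

Lemma irredX : irred 'X.
Proof. by apply: irred_mu1; rewrite /mu size_polyX lead_coefX size_poly1. Qed.

Lemma divides_trans f g h : divides f g -> divides g h -> divides f h.
Proof. by move=> [u ->] [v ->]; exists (u * v); rewrite mulrA. Qed.

Lemma irred_factor f g : irred f -> divides g f -> mu g <> 0%N -> divides f g.
Proof.
move=> [f0 _ hf] [q e] mg; have [//|mq] := hf _ _ e.
have q0 : q != 0 by apply: contraNneq f0 => z; rewrite e z mulr0.
have [a a0 eq] := mu_eq0 q0 mq; exists a^-1%:P%:P.
by rewrite e eq -mulrA -!polyCM mulfV // !polyC1 mulr1.
Qed.

Lemma irred_primitive f : irred f -> (1 < size f)%N -> primitive f.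
Proof.
move=> hf sf a [h e]; have [||q] := @irred_factor f (lin a) hf.
- by exists h.
- by rewrite mu_lin.
have f0 : f != 0 by case: hf.
move=> e'; have q0 : q != 0.
  by apply: contraTneq (lin_neq0 a) => z; rewrite e' z mulr0 eqxx.
have := congr1 (fun p : S => size p) e'; rewrite size_mul // size_polyC polyXsubC_eq0 /=.
by move: sf; have := q0; rewrite -size_poly_gt0; size_lia.
Qed.

(** [coprimep] is coprimality over F(z). The primitive part of a gcd of positive x-degree divides f
    and g exactly by the Gauss lemma; being irreducible, f divides that part and hence g. *)
Lemma irred_coprime f g : irred f -> (1 < size f)%N -> ~ divides f g -> coprimep f g.
Proof.
move=> hf sf nfg; apply: contrapT => ncop; apply: nfg.
have f0 : f != 0 by case: hf.
have d0 : gcdp f g != 0 by rewrite gcdp_eq0 (negPf f0).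
have [c [d [c0 pd sd ed]]] := primitive_part d0.
have dvd_d h : gcdp f g %| h -> divides d h.
  move=> /Pdiv.Idomain.dvdpP[[e q] /= e0 eh].
  apply: (primitive_divides (q := q * c%:P) e0 pd).
  by rewrite mul_polyC eh ed; ring.
apply: divides_trans (dvd_d g (dvdp_gcdr _ _)).
apply: irred_factor (dvd_d f (dvdp_gcdl _ _)) _ => //.
move: ncop; rewrite /coprimep -sd /mu => /eqP.
have : d != 0 by apply: contraNneq d0 => z; rewrite ed z mulr0.
by rewrite -size_poly_gt0; size_lia.
Qed.

(** An irreducible f of x-degree 0 is associate to some z - a, which is prime by evaluation at z =
    a. Otherwise f is primitive, and coprimality over F(z) gives divisibility up to a factor in
    F[z], which the Gauss lemma removes. *)
Lemma irred_prime f g h : irred f -> divides f (g * h) -> divides f g \/ divides f h.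
Proof.
move=> hf fgh; have f0 : f != 0 by case: hf.
have [s1|sf] := leqP (size f) 1.
  have /size_poly1P[c c0 ec] : size f == 1%N by rewrite eqn_leq s1 size_poly_gt0.
  have [|a [c' ec']] := @poly_root c.
    by case: hf => _ + _; rewrite ec /mu lead_coefC size_polyC c0; size_lia.
  have lf : divides (lin a) f by exists c'%:P; rewrite ec ec' polyCM.
  have fl : divides f (lin a) by apply: irred_factor => //; rewrite mu_lin.
  by have [] := lin_prime (divides_trans lf fgh); [left | right]; exact: divides_trans fl _.
have [|nfg] := pselect (divides f g); first by left.
right; have cop := irred_coprime hf sf nfg.
have : f %| h.
  by rewrite -(Gauss_dvdpr _ cop); case: fgh => q ->; rewrite Pdiv.CommonIdomain.dvdp_mulr.
move=> /Pdiv.Idomain.dvdpP[[e q] /= e0 eh].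
by apply: (primitive_divides (q := q) e0 (irred_primitive hf sf)); rewrite mul_polyC eh mulrC.
Qed.

Lemma irred_ind (Pr : S -> Prop) :
  (forall a, a != 0 -> Pr a%:P%:P) -> (forall f, irred f -> Pr f) ->
  (forall f g, f != 0 -> g != 0 -> Pr f -> Pr g -> Pr (f * g)) ->
  forall f, f != 0 -> Pr f.
Proof.
move=> Pc Pi PM f; move: {2}(mu f) (leqnn (mu f)) => m; elim: m f => [|m IH] f mf f0.
  by have [|a a0 ->] := mu_eq0 f0; [size_lia | exact: Pc].
have [[g [h [e mg mh]]]|hf] := pselect (exists g h, [/\ f = g * h, mu g <> 0%N & mu h <> 0%N]).
  have g0 : g != 0 by apply: contraNneq f0 => z; rewrite e z mul0r.
  have h0 : h != 0 by apply: contraNneq f0 => z; rewrite e z mulr0.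
  by rewrite e; move: mf; rewrite e muM // => mf; apply: PM => //; apply: IH => //; size_lia.
have [m0|m0] := eqVneq (mu f) 0%N.
  by have [|a a0 ->] := mu_eq0 f0; [size_lia | exact: Pc].
apply: Pi; split=> //; first by size_lia.
move=> g h e; apply: contrapT => /not_orP[mg mh]; apply: hf.
by exists g, h.
Qed.

Lemma irred_power f g : irred f -> g != 0 -> exists k u, ~ divides f u /\ g = f ^+ k * u.
Proof.
move=> hf; move: {2}(mu g) (leqnn (mu g)) => m; elim: m g => [|m IH] g mg g0.
all: have [[h e]|nfg] := pselect (divides f g); last by exists 0%N, g; rewrite mul1r.
all: have h0 : h != 0 by apply: contraNneq g0 => z; rewrite e z mulr0.
all: have := muM (let: And3 f0 _ _ := hf in f0) h0; rewrite -e; case: (hf) => f0 m0 _ me.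
  by size_lia.
have [|k [u [nu eu]]] := IH h _ h0; first by size_lia.
by exists k.+1, u; split=> //; rewrite exprS -mulrA -eu.
Qed.

Lemma irred_in_prime (H : set S) :
  (forall g h, H (g * h) -> H g \/ H h) -> (forall a, a != 0 -> ~ H a%:P%:P) ->
  forall g, H g -> g != 0 -> exists2 f, irred f & H f.
Proof.
move=> HM Hc g Hg g0; have : H g -> exists2 f, irred f & H f; last exact.
move: g g0 {Hg}; apply: irred_ind => [a a0 /(Hc a a0) //|f hf Hf|f g _ _ IHf IHg /HM[]//].
by exists f.
Qed.

End BivariateFactorial.

(** * Noetherian rings *)

Section Generated.
Variable A : comNzRingType.
Implicit Types (s t : seq A) (I J : set A).

Fixpoint generated s : set A :=
  if s is a :: s' then [set b | exists c, generated s' (b - c * a)] else [set 0].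

Lemma generated_ideal s : ideal (generated s).
Proof.
elim: s => [|a s IH] /=.
  split=> [|a x ->]; last by rewrite mulr0.
  by split=> // x y -> ->; rewrite subrr.
split=> [|b x [c hc]]; last first.
  by exists (b * c); rewrite -mulrA -mulrBr; exact: ideal_mull.
split=> [|x y [c hc] [d hd]]; first by exists 0; rewrite mul0r subr0; exact: ideal_zero.
exists (c - d); have -> : x - y - (c - d) * a = x - c * a - (y - d * a) by ring.
exact: ideal_sub.
Qed.

Lemma generated_cons a s b : generated s b -> generated (a :: s) b.
Proof. by exists 0; rewrite mul0r subr0. Qed.

Lemma generated_mem s a : a \in s -> generated s a.
Proof.
elim: s => //= b s IH; rewrite inE => /orP[/eqP->|/IH]; last exact: generated_cons.
by exists 1; rewrite mul1r subrr; exact: (ideal_zero (generated_ideal _)).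
Qed.

Lemma generated_min s I : ideal I -> (forall a, a \in s -> I a) -> generated s `<=` I.
Proof.
move=> hI; elim: s => [|a s IH] hs b /=; first by move=> ->; exact: ideal_zero.
move=> [c /IH h]; rewrite -(subrK (c * a) b); apply: ideal_add => //.
  by apply: h => d ds; apply: hs; rewrite inE ds orbT.
by apply: ideal_mull => //; apply: hs; exact: mem_head.
Qed.

Definition noetherian : Prop :=
  forall I, ideal I -> exists s, I = generated s.

Lemma bigcup_ideal (J : nat -> set A) : (forall n, ideal (J n)) ->
  (forall n, J n `<=` J n.+1) -> ideal [set a | exists n, J n a].
Proof.
move=> hJ inc; have mono m n : (m <= n)%N -> J m `<=` J n.
  by move=> mn; rewrite -(subnKC mn); elim: (n - m)%N => [|k IH]; rewrite ?addn0 // addnS => a /IH/inc.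
split=> [|a x [n hx]]; last by exists n; exact: ideal_mull.
split=> [|x y [m hx] [n hy]]; first by exists 0%N; exact: ideal_zero.
exists (maxn m n); apply: ideal_sub => //.
  exact: mono (leq_maxl _ _) _ hx.
exact: mono (leq_maxr _ _) _ hy.
Qed.

Lemma chain_stationary (J : nat -> set A) : noetherian -> (forall n, ideal (J n)) ->
  (forall n, J n `<=` J n.+1) -> exists N, forall n, J n `<=` J N.
Proof.
move=> hA hJ inc; have hU := bigcup_ideal hJ inc; have [s es] := hA _ hU.
have mono m n : (m <= n)%N -> J m `<=` J n.
  by move=> mn; rewrite -(subnKC mn); elim: (n - m)%N => [|k IH]; rewrite ?addn0 // addnS => a /IH/inc.
have [N hN] : exists N, forall a, a \in s -> J N a.
  have : forall a, a \in s -> exists n, J n a.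
    by move=> a /generated_mem; rewrite -es.
  elim: s {es} => [|a s IH] h; first by exists 0%N.
  have [N hN] : exists N, forall a, a \in s -> J N a.
    by apply: IH => b bs; apply: h; rewrite inE bs orbT.
  have [M hM] := h a (mem_head _ _); exists (maxn N M) => b.
  rewrite inE => /orP[/eqP->|/hN]; first exact: mono (leq_maxr _ _) _ hM.
  by apply: mono; exact: leq_maxl.
exists N => n a Ja; apply: (generated_min (hJ N) hN).
by rewrite -es; exists n.
Qed.

(** If Pr failed somewhere, each failing ideal would have a strictly larger failing one, and choice
    would give an ascending chain that never becomes stationary. *)
Lemma noetherian_ind (Pr : set A -> Prop) : noetherian ->
  (forall I, ideal I -> (forall J, ideal J -> I `<=` J -> (exists2 a, J a & ~ I a) -> Pr J) -> Pr I) ->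
  forall I, ideal I -> Pr I.
Proof.
move=> hA step I0 hI0; apply: contrapT => nI0.
pose T := {I : set A | ideal I /\ ~ Pr I}.
have next (I : T) : exists J : T, sval I `<=` sval J /\ exists2 a, sval J a & ~ sval I a.
  case: I => I [hI nI] /=; apply: contrapT => no; apply/nI/step => // J hJ IJ aJ.
  by apply: contrapT => nJ; apply: no; exists (exist _ J (conj hJ nJ)).
have [f hf] := choice next.
pose c := fix c n : T := if n is n'.+1 then f (c n') else exist _ I0 (conj hI0 nI0).
have [N hN] := @chain_stationary (fun n => sval (c n)) hA (fun n => (svalP (c n)).1) (fun n => (hf (c n)).1).
by have [_ [a ha]] := hf (c N); apply; exact: (hN N.+1).
Qed.

End Generated.

Lemma noetherian_surj (R A : comNzRingType) (f : {rmorphism R -> A}) :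
  (forall a, exists r, f r = a) -> noetherian R -> noetherian A.
Proof.
move=> fsurj hR I hI; pose I' := [set r | I (f r)].
have hI' : ideal I'.
  split; [split|] => [|x y Ix Iy|a x Ix]; rewrite /I' /=.
  - by rewrite rmorph0; exact: ideal_zero.
  - by rewrite rmorphB; exact: ideal_sub.
  - by rewrite rmorphM; exact: ideal_mull.
have [s es] := hR I' hI'; exists (map f s); apply/seteqP; split; last first.
  apply: generated_min => // _ /mapP[r rs ->].
  by have := generated_mem rs; rewrite -es.
move=> a; have [r <-] := fsurj a; rewrite -[I (f r)]/(I' r) es {a}.
elim: s r {es} => [r /= ->|b s IH r /= [c /IH h]]; first exact: rmorph0.
by exists (f c); rewrite rmorphB rmorphM in h.
Qed.

Lemma noetherian_field (F : fieldType) : noetherian F.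
Proof.
move=> I hI; have [[a Ia a0]|h] := pselect (exists2 a, I a & a != 0).
  exists [:: 1]; apply/predeqP => b; split=> _; first by exists b; rewrite mulr1 subrr.
  by rewrite -[b](mulfVK a0); apply: ideal_mull.
exists [::]; apply/predeqP => b; split=> [Ib|->]; last exact: ideal_zero.
by apply/eqP; apply: contrapT => /negP b0; apply: h; exists b.
Qed.

(** * The Hilbert basis theorem *)

Section HilbertBasis.
Variable R : comNzRingType.
Local Notation RX := {poly R}.

Lemma generated_lead_coef (s : seq RX) m b : (forall f, f \in s -> (size f <= m.+1)%N) ->
  generated (map lead_coef s) b ->
  exists g, [/\ generated s g, (size g <= m.+1)%N & g`_m = b].
Proof.
elim: s b => [b _ /= ->|f s IH b hs /= [c h]].
  by exists 0; rewrite size_poly0 coef0.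
have [|g [hg sg gm]] := IH _ _ h; first by move=> k ks; apply: hs; rewrite inE ks orbT.
have sf : (size f <= m.+1)%N by apply: hs; exact: mem_head.
(* The shift moves the leading term of f to degree m. *)
pose q : RX := c%:P * 'X^(m.+1 - size f).
exists (g + q * f); split; first by exists q; rewrite addrK.
  apply: leq_trans (size_polyD _ _) _; rewrite geq_max sg /=.
  rewrite /q -mulrA mul_polyC (leq_trans (size_scale_leq _ _)) //.
  by rewrite (leq_trans (size_polyMleq _ _)) // size_polyXn; move: sf; size_lia.
rewrite coefD gm /q -mulrA coefCM coefXnM.
have [f0|f0] := eqVneq f 0.
  by rewrite f0 lead_coef0 coef0 if_same mulr0 subr0 addr0.
have : (0 < size f)%N by rewrite size_poly_gt0.
move=> sf0; have -> : (m < m.+1 - size f)%N = false by lia.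
have -> : (m - (m.+1 - size f))%N = (size f).-1 by lia.
by rewrite -lead_coefE subrK.
Qed.

(** If I is not finitely generated, repeatedly pick an element of I of least size outside the ideal
    of those already picked. The ideals of leading coefficients become stationary, so a later pick
    can be reduced in size by earlier ones, against minimality. *)
Lemma hilbert_basis : noetherian R -> noetherian {poly R}.
Proof.
move=> hR I hI; apply: contrapT => nfg.
pose T := {s : seq RX | forall f, f \in s -> I f}.
have minimal (s : T) : exists f, [/\ I f, ~ generated (sval s) f &
    forall g, I g -> ~ generated (sval s) g -> (size f <= size g)%N].
  have ex : exists k, `[< exists f, [/\ I f, ~ generated (sval s) f & size f = k] >].
    suff [f If nf] : exists2 f, I f & ~ generated (sval s) f.
      by exists (size f); apply/asboolP; exists f.
    apply: contrapT => h; apply: nfg; exists (sval s); apply/seteqP; split.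
      by move=> f If; apply: contrapT => nf; apply: h; exists f.
    by apply: generated_min => //; exact: (svalP s).
  case: (ex_minnP ex) => _ /asboolP[f [If nf <-]] min; exists f; split=> // g Ig ng.
  by apply: min; apply/asboolP; exists g.
have [next hnext] := choice minimal.
have nextI (s : T) f : f \in next s :: sval s -> I f.
  by rewrite inE => /orP[/eqP->|/(svalP s)//]; have [] := hnext s.
have nilI f : f \in [::] -> I f by [].
pose L := fix L n : T := if n is n'.+1 then exist _ _ (nextI (L n')) else exist _ _ nilI.
pose f n := next (L n).
have [N hN] := @chain_stationary R (fun n => generated (map lead_coef (sval (L n)))) hR
  (fun n => generated_ideal _) (fun n => @generated_cons _ _ _).
have gen_mono m n : (m <= n)%N -> generated (sval (L m)) `<=` generated (sval (L n)).
  move=> mn; rewrite -(subnKC mn); elim: (n - m)%N => [|k IH]; rewrite ?addn0 // addnS => g /IH.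
  exact: generated_cons.
have [If nf min] := hnext (L N); rewrite -/(f N) in If nf min.
have f0 : f N != 0 by apply/eqP => e; apply: nf; rewrite e; exact: (ideal_zero (generated_ideal _)).
have sf : (0 < size (f N))%N by rewrite size_poly_gt0.
have lead_gen : generated (map lead_coef (sval (L N))) (lead_coef (f N)).
  by apply: (hN N.+1); apply: generated_mem; exact: mem_head.
(* The earlier picks were minimal while f N was already a candidate, so none of them is longer than
   f N. *)
have size_le n : (n <= N)%N -> forall g, g \in sval (L n) -> (size g <= size (f N))%N.
  elim: n => // n IH nN g /=; rewrite inE => /orP[/eqP->|/(IH (ltnW nN))//].
  have [_ _ minf] := hnext (L n); apply: minf => // h; apply: nf.
  by apply: (gen_mono n) => //; exact: ltnW.
have [|g [gg sg gm]] := generated_lead_coef (m := (size (f N)).-1) _ lead_gen.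
  by rewrite prednK //; exact: size_le.
rewrite prednK // in sg.
have : (size (f N) <= size (f N - g)%R)%N.
  apply: min.
    by apply: ideal_sub => //; apply: (generated_min hI _ gg); exact: (svalP (L N)).
  move=> h; apply: nf; rewrite -(subrK g (f N)).
  by apply: ideal_add => //; exact: generated_ideal.
apply/negP; rewrite -ltnNge -(prednK sf) ltnS; apply/leq_sizeP => j.
rewrite leq_eqVlt => /orP[/eqP<-|]; first by rewrite coefB gm lead_coefE subrr.
by rewrite prednK // => hj; rewrite coefB !nth_default ?subr0 // (leq_trans sg).
Qed.

End HilbertBasis.

(** * Height one primes of the surface x y = root_poly z *)

Section Surface.
Variables (F : closedFieldType) (n : nat) (r : 'I_n.+1 -> F).
Local Notation S := {poly {poly F}}.

Definition root_poly : {poly F} := \prod_i ('X - (r i)%:P).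

(* The ring F[x, y, z] / (x y - root_poly z), through its subrings F[z][x] and F[z][y]. *)
Definition is_surface (A : comNzRingType) (ix iy : {rmorphism S -> A}) : Prop :=
  [/\ is_domain A, (forall c : {poly F}, ix c%:P = iy c%:P),
      ix 'X * iy 'X = ix root_poly%:P, injective ix /\ injective iy
    & forall a, exists f g, a = ix f + iy g].

Lemma is_surface_sym (A : comNzRingType) (ix iy : {rmorphism S -> A}) :
  is_surface ix iy -> is_surface iy ix.
Proof.
case=> dom C xy [injx injy] gen; split=> //; first by rewrite mulrC xy C.
by move=> a; have [f [g ->]] := gen a; exists g, f; rewrite addrC.
Qed.

Definition ev (a : F) : S -> {poly F} := map_poly (horner_eval a).
HB.instance Definition _ a := GRing.RMorphism.on (ev a).

Lemma evM a f g : ev a (f * g) = ev a f * ev a g.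
Proof. exact: rmorphM. Qed.

Lemma evB a f g : ev a (f - g) = ev a f - ev a g.
Proof. exact: rmorphB. Qed.

Lemma ev_eq0 a g : ev a g = 0 <-> divides (lin a) g.
Proof. by rewrite lin_dividesP. Qed.

Lemma ev_lin a : ev a (lin a) = 0.
Proof. by apply/ev_eq0; exists 1; rewrite mulr1. Qed.

Lemma evX a : ev a 'X = 'X.
Proof. by rewrite /ev map_polyX. Qed.

Lemma evXn a N : ev a 'X^N = 'X^N.
Proof. by rewrite rmorphXn /= evX. Qed.

Lemma ev_polyC a (c : {poly F}) : ev a c%:P = c.[a]%:P.
Proof. by rewrite /ev map_polyC. Qed.

Lemma ev_map_polyC a (q : {poly F}) : ev a (map_poly polyC q) = q.
Proof.
rewrite /ev -map_poly_comp; apply: map_poly_id => c _.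
by rewrite /= /horner_eval hornerC.
Qed.

Lemma lin_divides_sub_ev a g : divides (lin a) (g - map_poly polyC (ev a g)).
Proof. by apply/ev_eq0; rewrite rmorphB /= ev_map_polyC subrr. Qed.

Lemma root_poly_neq0 : root_poly != 0.
Proof. by rewrite monic_neq0 // /root_poly; exact: monic_prod_XsubC. Qed.

Lemma root_poly_root i : root_poly.[r i] = 0.
Proof.
by rewrite /root_poly (bigD1 i) //= hornerM hornerXsubC subrr mul0r.
Qed.

Section Coordinates.
Variables (A : comNzRingType) (ix iy : {rmorphism S -> A}).
Hypothesis hA : is_surface ix iy.
Local Notation x := (ix 'X).
Local Notation y := (iy 'X).

Let dom : is_domain A. Proof. by case: hA. Qed.
Let ixyC (c : {poly F}) : ix c%:P = iy c%:P. Proof. by case: hA. Qed.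
Let xy : x * y = ix root_poly%:P. Proof. by case: hA. Qed.
Let ix_inj : injective ix. Proof. by case: hA => _ _ _ []. Qed.
Let iy_inj : injective iy. Proof. by case: hA => _ _ _ []. Qed.

Lemma ix_eq0 f : ix f = 0 -> f = 0.
Proof. by move=> e; apply: ix_inj; rewrite e rmorph0. Qed.

Lemma x_neq0 : x != 0.
Proof. by apply/eqP => /ix_eq0/eqP; rewrite polyX_eq0. Qed.

Lemma xn_neq0 N : x ^+ N != 0.
Proof. exact/domain_exp_neq0/x_neq0. Qed.

Lemma ix_lin a : ix (lin a) = iy (lin a).
Proof. exact: ixyC. Qed.

(** Since x * y is a polynomial in z, a factor x absorbs one power of y; so A lies inside
    F[z][x, 1/x]. Applied to [is_surface_sym] it clears x by powers of y. *)
Lemma clear_y_denominator a : exists N f, x ^+ N * a = ix f.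
Proof.
have [_ _ _ _ gen] := hA; have [f [g ->]] := gen a.
suff [N [h e]] : exists N h, x ^+ N * iy g = ix h.
  by exists N, ('X^N * f + h); rewrite mulrDr e rmorphD rmorphM rmorphXn.
elim/poly_ind: g => [|g c [N [h e]]].
  by exists 0%N, 0; rewrite !rmorph0 mulr0.
exists N.+1, (h * root_poly%:P + 'X^(N.+1) * c%:P).
rewrite !rmorphD !rmorphM rmorphXn /= -e -xy -ixyC exprS; ring.
Qed.

Lemma mod_x a : exists g u, a = iy g + x * u.
Proof.
have [_ _ _ _ gen] := hA; have [f [g ->]] := gen a.
elim/poly_ind: f => [|f c _]; first by exists g, 0; rewrite rmorph0 add0r mulr0 addr0.
exists (g + c%:P), (ix f); rewrite !rmorphD rmorphM /= ixyC; ring.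
Qed.

End Coordinates.

(** * The primes over x and the primes away from x *)

Section Primes.
Variables (A : comNzRingType) (ix iy : {rmorphism S -> A}).
Hypothesis hA : is_surface ix iy.
Local Notation x := (ix 'X).
Local Notation y := (iy 'X).

Let dom : is_domain A. Proof. by case: hA. Qed.
Let hA' := is_surface_sym hA.
Let xy : x * y = ix root_poly%:P. Proof. by case: hA. Qed.
Let ixyC (c : {poly F}) : ix c%:P = iy c%:P. Proof. by case: hA. Qed.

Definition xdiv i : set A := [set a | exists u v, a = x * u + ix (lin (r i)) * v].

Lemma xdiv_ideal i : ideal (xdiv i).
Proof.
split; first split.
- by exists 0, 0; rewrite !mulr0 addr0.
- by move=> _ _ [u [v ->]] [u' [v' ->]]; exists (u - u'), (v - v'); ring.
- by move=> a _ [u [v ->]]; exists (a * u), (a * v); ring.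
Qed.

Lemma xdiv_x i : xdiv i x.
Proof. by exists 1, 0; rewrite mulr1 mulr0 addr0. Qed.

Lemma xdiv_lin i : xdiv i (ix (lin (r i))).
Proof. by exists 0, 1; rewrite mulr1 mulr0 add0r. Qed.

(** After multiplication by a power of y the equation lives in F[z][y], with x * y replaced by
    [root_poly]. Setting z = r i kills both generators and leaves a power of y times g(r i, y). *)
Lemma xdiv_iyP i g : xdiv i (iy g) <-> divides (lin (r i)) g.
Proof.
split=> [[u [v e]]|[h ->]]; last first.
  by exists 0, (iy h); rewrite mulr0 add0r rmorphM /= (ix_lin hA).
apply/ev_eq0; have [N [u' eu]] := clear_y_denominator hA' u.
have [M [v' ev']] := clear_y_denominator hA' v.
have : 'X^((N + M).+1) * g = root_poly%:P * ('X^M * u') + lin (r i) * ('X^(N.+1) * v').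
  have [_ _ _ [_ iy_inj] _] := hA; apply: iy_inj.
  rewrite !(rmorphD, rmorphM, rmorphXn) /= e -eu -ev' -ixyC -xy -(ix_lin hA) !exprS exprD; ring.
move=> /(congr1 (ev (r i))); rewrite !(rmorphD, rmorphM, rmorphXn) /=.
rewrite ev_polyC root_poly_root ev_lin !mul0r addr0 evX => /eqP.
by rewrite mulf_eq0 expf_eq0 /= polyX_eq0 => /eqP.
Qed.

(* A / xdiv i is the polynomial ring F[y]. *)
Lemma xdiv_mod i a : exists q b, xdiv i b /\ a = iy (map_poly polyC q) + b.
Proof.
have [g [u ->]] := mod_x hA a; exists (ev (r i) g), (iy (g - map_poly polyC (ev (r i) g)) + x * u).
split; last by rewrite rmorphB /=; ring.
apply: ideal_add; first exact: xdiv_ideal.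
  exact/xdiv_iyP/lin_divides_sub_ev.
exact: (ideal_mulr _ (xdiv_ideal i) (xdiv_x i)).
Qed.

Lemma xdiv_constP i q : xdiv i (iy (map_poly polyC q)) -> q = 0.
Proof. by move=> /xdiv_iyP/ev_eq0; rewrite ev_map_polyC. Qed.

Lemma xdiv_prime i : prime_ideal (xdiv i).
Proof.
have hI := xdiv_ideal i; split=> //.
  move=> h; have /xdiv_constP/eqP : xdiv i (iy (map_poly polyC 1)) by rewrite !rmorph1.
  by rewrite oner_eq0.
move=> a b; have [q [a' [ha ->]]] := xdiv_mod i a; have [s [b' [hb ->]]] := xdiv_mod i b.
set u := iy _; set v := iy _ => h.
have : xdiv i (u * v).
  have -> : u * v = (u + a') * (v + b') - ((u + a') * b' + a' * v) by ring.
  by apply: ideal_sub => //; apply: ideal_add => //; [exact: ideal_mull | exact: ideal_mulr].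
rewrite -rmorphM -rmorphM /= => /xdiv_constP/eqP; rewrite mulf_eq0 => /orP[]/eqP e.
  by left; rewrite /u e !rmorph0 add0r.
by right; rewrite /v e !rmorph0 add0r.
Qed.

Lemma xdiv_y i : ~ xdiv i y.
Proof.
move=> /xdiv_iyP/ev_eq0; rewrite evX => /eqP; by rewrite polyX_eq0.
Qed.

Lemma xdiv_neq0 i : exists2 a, xdiv i a & a != 0.
Proof. by exists x; [exact: xdiv_x | exact: (x_neq0 hA)]. Qed.

(** As y is not in [xdiv i], it is a unit in the localisation, which is therefore that of F[z][y] at
    the prime element z - r i. *)
Lemma xdiv_uniformizer i : uniformizer (xdiv i) (ix (lin (r i))).
Proof.
split; first exact: xdiv_lin.
move=> a a0; have [N [g e]] := clear_y_denominator hA' a.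
have g0 : g != 0.
  apply: contra_neq a0 => g0; move: e; rewrite g0 rmorph0 => /dom[/eqP|//].
  by rewrite (negPf (xn_neq0 hA' N)).
have [k [u [nu eg]]] := irred_power (irred_lin (r i)) g0.
exists k, (y ^+ N), (iy u); split.
- by move=> /(prime_exp (xdiv_prime i))/xdiv_y.
- by move=> /xdiv_iyP.
- by rewrite e eg rmorphM rmorphXn /= (ix_lin hA) mulrC.
Qed.

Lemma xdiv_height_one i : height_one (xdiv i).
Proof.
exact: (uniformizer_height_one dom (xdiv_prime i) (xdiv_uniformizer i) (xdiv_neq0 i)).
Qed.

Definition Xdiv i : prime_divisor A := exist (fun P => `[< height_one P >]) (xdiv i) (asboolT (xdiv_height_one i)).

Lemma prime_over_x P : prime_ideal P -> P x -> exists i, xdiv i `<=` P.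
Proof.
move=> hP Px; have idP : ideal P by case: hP.
have : P (ix root_poly%:P) by rewrite -xy; exact: ideal_mulr.
rewrite /root_poly => Pp; have [i Pi] : exists i, P (ix (lin (r i))).
  move: Pp; rewrite rmorph_prod rmorph_prod /=; elim/big_rec: _ => [|i a _ IH].
    by move=> /(prime_not1 hP).
  by case: hP => _ _ /[apply] -[h|/IH//]; exists i.
by exists i => _ [u [v ->]]; apply: ideal_add => //; exact: ideal_mulr.
Qed.

(** The contraction to A of the ideal generated by f in F[z][x, 1/x]. *)
Definition fdiv f : set A := [set a | exists N g, x ^+ N * a = ix (f * g)].

Section IrredDivisor.
Variable f : S.
Hypotheses (hf : irred f) (fX : ~ divides f 'X).

Let f0 : f != 0. Proof. by case: hf. Qed.

Lemma irred_not_expX N : ~ divides f 'X^N.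
Proof.
elim: N => [|N IH] h; last by rewrite exprS in h; case: (irred_prime hf h).
case: h => g e; case: hf => _ m0 _; have g0 : g != 0.
  by apply/eqP => g0; move/eqP: e; rewrite g0 mulr0 oner_eq0.
by have := muM f0 g0; rewrite -e expr0 -(rmorph1 polyC) -(rmorph1 polyC) mu_const; lia.
Qed.

(** Membership can be tested on any numerator g of a, because an irreducible f that does not divide
    x divides no power of x. *)
Lemma fdivP a N g : x ^+ N * a = ix g -> fdiv f a <-> divides f g.
Proof.
move=> e; split=> [[M [h e']]|[h eg]]; last by exists N, h; rewrite e eg.
have : 'X^M * g = f * (h * 'X^N).
  have [_ _ _ [ix_inj _] _] := hA; apply: ix_inj.
  by rewrite mulrA rmorphM [RHS]rmorphM !rmorphXn /= -e mulrCA e' mulrC.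
by move=> eg; have [|/irred_not_expX//|] := @irred_prime _ f 'X^M g hf; first by exists (h * 'X^N).
Qed.

Lemma fdiv_ixP g : fdiv f (ix g) <-> divides f g.
Proof. by apply: (@fdivP _ 0); rewrite mul1r. Qed.

Lemma fdiv_ideal : ideal (fdiv f).
Proof.
split; first split.
- by exists 0%N, 0; rewrite !mulr0 rmorph0.
- move=> a b [N [g e]] [M [h e']]; exists (N + M)%N, ('X^M * g - 'X^N * h).
  rewrite exprD mulrBr; transitivity (x ^+ M * (x ^+ N * a) - x ^+ N * (x ^+ M * b)); first by ring.
  by rewrite e e' mulrBr rmorphB !(rmorphM, rmorphXn) /=; ring.
- move=> b a [N [g e]]; have [M [h e']] := clear_y_denominator hA b.
  exists (M + N)%N, (h * g); rewrite exprD; transitivity ((x ^+ M * b) * (x ^+ N * a)); first by ring.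
  by rewrite e e' !rmorphM /=; ring.
Qed.

Lemma fdiv_prime : prime_ideal (fdiv f).
Proof.
split; first exact: fdiv_ideal.
  by rewrite -(rmorph1 ix) fdiv_ixP; exact: (@irred_not_expX 0).
move=> a b; have [N [g e]] := clear_y_denominator hA a; have [M [h e']] := clear_y_denominator hA b.
have e'' : x ^+ (N + M) * (a * b) = ix (g * h) by rewrite exprD mulrACA e e' rmorphM.
rewrite (fdivP e) (fdivP e') (fdivP e''); exact: irred_prime.
Qed.

Lemma fdiv_x : ~ fdiv f x.
Proof. by rewrite fdiv_ixP. Qed.

Lemma fdiv_f : fdiv f (ix f).
Proof. by apply/fdiv_ixP; exists 1; rewrite mulr1. Qed.

Lemma fdiv_neq0 : exists2 a, fdiv f a & a != 0.
Proof.
by exists (ix f); [exact: fdiv_f | apply/eqP => /(ix_eq0 hA)/eqP; rewrite (negPf f0)].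
Qed.

Lemma fdiv_uniformizer : uniformizer (fdiv f) (ix f).
Proof.
split; first exact: fdiv_f.
move=> a a0; have [N [g e]] := clear_y_denominator hA a.
have g0 : g != 0.
  apply: contra_neq a0 => g0; move: e; rewrite g0 rmorph0 => /dom[/eqP|//].
  by rewrite (negPf (xn_neq0 hA N)).
have [k [u [nu eg]]] := irred_power hf g0.
exists k, (x ^+ N), (ix u); split.
- by move=> /(prime_exp fdiv_prime)/fdiv_x.
- by move=> /fdiv_ixP.
- by rewrite e eg rmorphM rmorphXn mulrC.
Qed.

Lemma fdiv_height_one : height_one (fdiv f).
Proof. exact: (uniformizer_height_one dom fdiv_prime fdiv_uniformizer fdiv_neq0). Qed.

Lemma fdiv_min P : prime_ideal P -> ~ P x -> P (ix f) -> fdiv f `<=` P.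
Proof.
move=> hP nx Pf a [N [g e]]; case: (hP) => idP _ /(_ (x ^+ N) a) [|/(prime_exp hP)//|//].
by rewrite e rmorphM; exact: ideal_mulr.
Qed.

End IrredDivisor.

Lemma prime_off_x P : prime_ideal P -> ~ P x -> (exists2 a, P a & a != 0) ->
  exists f, [/\ irred f, ~ divides f 'X & P (ix f)].
Proof.
move=> hP nx [a Pa a0]; have idP : ideal P by case: hP.
have [N [g e]] := clear_y_denominator hA a.
have Pg : P (ix g) by rewrite -e; exact: ideal_mull.
have g0 : g != 0.
  apply: contra_neq a0 => g0; move: e; rewrite g0 rmorph0 => /dom[/eqP|//].
  by rewrite (negPf (xn_neq0 hA N)).
have [||f hf Pf] := @irred_in_prime _ [set f | P (ix f)] _ _ g Pg g0.
- by move=> f h; rewrite /= rmorphM; case: hP => _ _ hPM; exact: hPM.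
- move=> c c0 /= Pc; apply: (prime_not1 hP).
  have -> : 1 = ix c^-1%:P%:P * ix c%:P%:P; last exact: ideal_mull.
  by rewrite -rmorphM /= -!polyCM mulVf // !polyC1 rmorph1.
exists f; split=> // -[h eX]; apply: nx; rewrite eX rmorphM; exact: ideal_mulr.
Qed.

Lemma height_one_off_x (P : prime_divisor A) : ~ val P x -> forall f, irred f -> val P (ix f) ->
  val P = fdiv f.
Proof.
move=> nx f hf Pf; have hP := prime_divisor_prime P.
have fX : ~ divides f 'X.
  by move=> [h eX]; apply: nx; rewrite eX rmorphM; apply: ideal_mulr => //; case: hP.
apply/esym/(prime_divisor_min dom); first exact: fdiv_prime.
  exact: fdiv_neq0.
exact: fdiv_min.
Qed.

Lemma height_one_on_x (P : prime_divisor A) : val P x -> exists i, P = Xdiv i.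
Proof.
move=> Px; have [i iP] := prime_over_x (prime_divisor_prime P) Px.
exists i; apply/val_inj/esym/(prime_divisor_min dom) => //; first exact: xdiv_prime.
exact: xdiv_neq0.
Qed.

Lemma surface_dvr (P : prime_divisor A) : exists t, uniformizer (val P) t.
Proof.
have [/height_one_on_x[i ->]|nx] := pselect (val P x).
  by exists (ix (lin (r i))); exact: xdiv_uniformizer.
have [f [hf fX Pf]] := prime_off_x (prime_divisor_prime P) nx (prime_divisor_neq0 P).
exists (ix f); rewrite (height_one_off_x nx hf Pf); exact: fdiv_uniformizer.
Qed.

Lemma surface_finite_support (a : A) : a != 0 ->
  exists s : seq (prime_divisor A), forall P : prime_divisor A, val P a -> P \in s.
Proof.
move=> a0; have [N [g e]] := clear_y_denominator hA a.
have g0 : g != 0.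
  apply: contra_neq a0 => g0; move: e; rewrite g0 rmorph0 => /dom[/eqP|//].
  by rewrite (negPf (xn_neq0 hA N)).
suff [s hs] : exists s : seq (prime_divisor A), forall P : prime_divisor A, val P (ix g) -> P \in s.
  by exists s => P Pa; apply: hs; rewrite -e; apply: ideal_mull => //; exact: prime_divisor_ideal.
move: g g0 {e}; apply: irred_ind => [c c0|f hf|f g _ _ [s hs] [t ht]].
- exists [::] => P Pc; case: (prime_not1 (prime_divisor_prime P)).
  have -> : 1 = ix c^-1%:P%:P * ix c%:P%:P; last by apply: ideal_mull => //; exact: prime_divisor_ideal.
  by rewrite -rmorphM /= -!polyCM mulVf // !polyC1 rmorph1.
- have [/asboolP h1|h1] := pselect `[< height_one (fdiv f) >].
    pose Q : prime_divisor A := exist (fun P => `[< height_one P >]) (fdiv f) (asboolT h1).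
    exists (Q :: map Xdiv (enum 'I_n.+1)) => P Pf.
    have [/height_one_on_x[i ->]|nx] := pselect (val P x).
      by rewrite inE map_f ?orbT ?mem_enum.
    by rewrite inE; apply/orP; left; apply/eqP/val_inj; exact: height_one_off_x.
  (* A prime divisor off x containing ix f would equal [fdiv ix f], which here is not of height one;
     so only the primes over x remain. *)
  exists (map Xdiv (enum 'I_n.+1)) => P Pf.
  have [/height_one_on_x[i ->]|nx] := pselect (val P x); first by rewrite map_f ?mem_enum.
  case: h1; rewrite -(height_one_off_x nx hf Pf); exact: (svalP P).
- exists (s ++ t) => P; rewrite mem_cat rmorphM; case: (prime_divisor_prime P) => _ _ /[apply].
  by case=> [/hs->|/ht->]; rewrite ?orbT.
Qed.

End Primes.
End Surface.

(** * Classes of cyclic modules *)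

Section ModuleClasses.
Variable A : comNzRingType.

Lemma quotm_map_exists (V W : lmodType A) (K : submodule V) (L : submodule W)
    (f : {linear V -> W}) : (forall v, K v -> L (f v)) ->
  exists g : {linear quotm K -> quotm L}, forall v, g (quotm_pi K v) = quotm_pi L (f v).
Proof.
move=> fKL; pose g (q : quotm K) : quotm L := quotm_pi L (f (repr q)).
have gE v : g (quotm_pi K v) = quotm_pi L (f v).
  apply/quotm_piP; rewrite -raddfB; apply: fKL.
  by have /quotm_piP := quotm_piK (quotm_pi K v).
have g_zmod : zmod_morphism g.
  move=> q q'; rewrite -(quotm_piK q) -(quotm_piK q').
  by rewrite -(raddfB (quotm_pi K)) !gE raddfB (raddfB (quotm_pi L)).
have g_scal : scalable g.
  move=> a q; transitivity (g (quotm_pi K (a *: repr q))).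
    by rewrite quotm_piZ quotm_piK.
  by rewrite gE linearZ quotm_piZ.
pose ga := GRing.isZmodMorphism.Build _ _ g g_zmod.
pose gs := GRing.isScalable.Build _ _ _ _ g g_scal.
pose gl : {linear quotm K -> quotm L} := HB.pack g ga gs.
by exists gl.
Qed.

Definition G0_class (M : fgmod A) : G0 A := quotg_pi _ (mod_class M).

Lemma G0_class_exact (M' M M'' : fgmod A)
    (f : {linear 'rV[A]_(fg_rank M') -> 'rV[A]_(fg_rank M)})
    (g : {linear 'rV[A]_(fg_rank M) -> 'rV[A]_(fg_rank M'')}) :
  (forall u, fg_rel M' u <-> fg_rel M (f u)) ->
  (forall w, exists v, fg_rel M'' (w - g v)) ->
  (forall v, fg_rel M'' (g v) <-> exists u, fg_rel M (v - f u)) ->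
  G0_class M = G0_class M' + G0_class M''.
Proof.
move=> h1 h2 h3; rewrite /G0_class -(raddfD (quotg_pi _)) /=.
apply/quotg_piP/mem_span; exists M', M, M''; rewrite opprD addrA; split=> //.
have [u /h1//|f' fE] := @quotm_map_exists _ _ (fg_rel M') (fg_rel M) f.
have [v Kv|g' gE] := @quotm_map_exists _ _ (fg_rel M) (fg_rel M'') g.
  by apply/h3; exists 0; rewrite raddf0 subr0.
exists f', g'; split.
- move=> q q'; rewrite -(quotm_piK q) -(quotm_piK q') !fE => /quotm_piP.
  by rewrite -raddfB => /h1 ?; apply/quotm_piP.
- move=> q; have [v hv] := h2 (repr q); exists (quotm_pi _ v).
  by rewrite gE -(quotm_piK q); apply/esym/quotm_piP.
- move=> q; rewrite -(quotm_piK q) gE; split.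
    move=> /quotm_pi_eq0/h3[u hu]; exists (quotm_pi _ u); rewrite fE.
    exact/esym/quotm_piP.
  case=> q'; rewrite -(quotm_piK q') fE => /esym/quotm_piP h.
  by apply/quotm_pi_eq0/h3; exists (repr q').
Qed.

Definition cls (I : set A) : G0 A :=
  if pselect (ideal I) is left h then G0_class (cyc h) else 0.

Lemma clsE I (h : ideal I) : cls I = G0_class (cyc h).
Proof.
rewrite /cls; case: pselect => [h'|//]; congr G0_class.
by rewrite (Prop_irrelevance h h').
Qed.

Definition colon (I : set A) a : set A := [set b | I (b * a)].
Definition adjoin (I : set A) a : set A := [set b | exists c, I (b - c * a)].

Lemma colon_ideal I a : ideal I -> ideal (colon I a).
Proof.
move=> hI; split; first split.
- by rewrite /colon /= mul0r; exact: ideal_zero.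
- by move=> b c hb hc; rewrite /colon /= mulrBl; exact: ideal_sub.
- by move=> b c hc; rewrite /colon /= -mulrA; exact: ideal_mull.
Qed.

Lemma adjoin_ideal I a : ideal I -> ideal (adjoin I a).
Proof.
move=> hI; split; first split.
- by exists 0; rewrite mul0r subr0; exact: ideal_zero.
- move=> b c [d hd] [e he]; exists (d - e).
  have -> : b - c - (d - e) * a = (b - d * a) - (c - e * a) by ring.
  exact: ideal_sub.
- move=> b c [d hd]; exists (b * d); rewrite -mulrA -mulrBr; exact: ideal_mull.
Qed.

Lemma sub_adjoin I a : I `<=` adjoin I a.
Proof. by move=> b Ib; exists 0; rewrite mul0r subr0. Qed.

Lemma adjoin_mem I a : ideal I -> adjoin I a a.
Proof. by exists 1; rewrite mul1r subrr; exact: ideal_zero. Qed.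

Lemma adjoin_min I J a : ideal J -> I `<=` J -> J a -> adjoin I a `<=` J.
Proof.
move=> hJ IJ Ja b [c /IJ h]; rewrite -(subrK (c * a) b).
by apply: ideal_add => //; exact: ideal_mull.
Qed.

Lemma cls_split I a : ideal I -> cls I = cls (colon I a) + cls (adjoin I a).
Proof.
move=> hI; rewrite (clsE hI) (clsE (colon_ideal a hI)) (clsE (adjoin_ideal a hI)).
have mulE (u : 'rV[A]_1) : (u *m a%:M) 0 0 = u 0 0 * a.
  by rewrite !mxE big_ord1 !mxE.
have subE (v u : 'rV[A]_1) : (v - u *m a%:M) 0 0 = v 0 0 - u 0 0 * a.
  by rewrite !mxE big_ord1 !mxE.
apply: (@G0_class_exact (cyc (colon_ideal a hI)) (cyc hI) (cyc (adjoin_ideal a hI)) (mulmxr a%:M) idfun).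
- by move=> u; split=> /asboolP h; apply/asboolP; move: h; rewrite mulE.
- by move=> w; exists w; apply/asboolP; rewrite subrr mxE; exact: (ideal_zero (adjoin_ideal _ _)).
- move=> v; split=> [/asboolP[c hc]|[u /asboolP]].
    by exists (const_mx c); apply/asboolP; rewrite subE mxE.
  by rewrite subE => h; apply/asboolP; exists (u 0 0).
Qed.

Lemma clsT : cls setT = 0.
Proof.
have hT : ideal [set: A] by [].
have := cls_split 0 hT; have -> : colon setT (0 : A) = setT by apply/predeqP.
have -> : adjoin setT (0 : A) = setT by apply/predeqP => b; split=> // _; exists 0.
by move=> /(congr1 (fun u => u - cls setT)); rewrite addrK subrr.
Qed.

(** If a is regular modulo I, multiplication by a embeds A/I into itself, and the exact sequence
    cancels its class. *)
Lemma cls_adjoin0 I a : ideal I -> (forall b, I (b * a) -> I b) -> cls (adjoin I a) = 0.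
Proof.
move=> hI reg; have := cls_split a hI; have -> : colon I a = I.
  by apply/seteqP; split=> b; [exact: reg | exact: ideal_mulr].
by move=> /(congr1 (fun u => u - cls I)); rewrite subrr addrC addKr => <-.
Qed.

(** The inductive step that reduces to primes: if a * b is in I but neither a nor b is, then both I
    : a and I + (a) are strictly larger than I. *)
Lemma cls_strict_split (G : set (G0 A)) I : subgroup G -> ideal I ->
  (forall J, ideal J -> I `<=` J -> (exists2 a, J a & ~ I a) -> G (cls J)) ->
  (prime_ideal I -> G (cls I)) -> G (cls I).
Proof.
move=> [G0 GB] hI IH hP; have [I1|nI1] := pselect (I 1).
  have -> : I = setT by apply/seteqP; split=> // a _; rewrite -[a]mulr1; exact: ideal_mull.
  by rewrite clsT.
have [[a [b [na nb ab]]]|np] := pselect (exists a b, [/\ ~ I a, ~ I b & I (a * b)]); last first.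
  apply: hP; split=> // a b ab; apply: contrapT => /not_orP[na nb]; apply: np.
  by exists a, b.
have GD x y : G x -> G y -> G (x + y).
  by move=> hx hy; rewrite -[y]opprK; apply: (GB) => //; rewrite -sub0r; exact: GB.
rewrite (cls_split a hI); apply: GD; apply: IH.
- exact: colon_ideal.
- by move=> c Ic; exact: ideal_mulr.
- by exists b => //; rewrite /colon /= mulrC.
- exact: adjoin_ideal.
- exact: sub_adjoin.
- by exists a => //; exact: adjoin_mem.
Qed.

(** The first coordinate line meets K in an ideal I, and A^(m+1) / K is an extension of a quotient
    of A^m by A/I. *)
Lemma G0_gen_cls (G : set (G0 A)) : subgroup G -> (forall I, ideal I -> G (cls I)) ->
  forall xi, G xi.
Proof.
move=> hG Gcls; have [G0 GB] := hG.
have GD x y : G x -> G y -> G (x + y).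
  by move=> hx hy; rewrite -[y]opprK; apply: (GB) => //; rewrite -sub0r; exact: GB.
have GM (M : fgmod A) : G (G0_class M).
  case: M => m K; elim: m K => [|m IH] K.
    (* For m = 0 the module is zero, so its class equals twice itself. *)
    have e : G0_class (FgMod K) = G0_class (FgMod K) + G0_class (FgMod K).
      apply: (@G0_class_exact (FgMod K) (FgMod K) (FgMod K) idfun idfun) => //.
        by move=> w; exists w; rewrite subrr; have [] := submodP K.
      have K1 v : K v by rewrite (thinmx0 v); have [] := submodP K.
      by move=> v; split=> // _; exists 0.
    by move: e => /(congr1 (fun u => u - G0_class (FgMod K))); rewrite addrK subrr => <-.
  move: K; rewrite -[m.+1]/(1 + m)%N => K.
  have [K0 KD] := submodP K.
  pose K1 (w : 'rV[A]_m) := `[< exists a : 'rV[A]_1, K (row_mx a w) >].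
  have hK1 : GRing.submod_closed K1.
    split=> [|a u v /asboolP[b hb] /asboolP[c hc]]; apply/asboolP.
      by exists 0; rewrite row_mx0.
    exists (a *: b + c); have := KD a _ _ hb hc.
    by rewrite scale_row_mx add_row_mx.
  pose I := [set a : A | K (row_mx (const_mx a : 'rV_1) 0)].
  have hI : ideal I.
    split; first split.
    - by rewrite /I /= (_ : const_mx 0 = 0) ?row_mx0.
    - move=> a b ha hb; rewrite /I /=; have := KD (-1) _ _ hb ha.
      rewrite scale_row_mx add_row_mx scaler0 addr0; congr (is_true (K (row_mx _ _))).
      by apply/rowP => i; rewrite !mxE mulN1r addrC.
    - move=> a b hb; rewrite /I /=; have := KD a _ _ hb K0.
      rewrite addr0 scale_row_mx scaler0; congr (is_true (K (row_mx _ _))).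
      by apply/rowP => i; rewrite !mxE.
  have -> : G0_class (FgMod K) = cls I + G0_class (FgMod (Submodule hK1)).
    rewrite (clsE hI).
    apply: (@G0_class_exact (cyc hI) (FgMod K) (FgMod (Submodule hK1))
              (mulmxr (row_mx 1%:M 0 : 'M_(1, 1 + m))) (mulmxr (col_mx 0 1%:M : 'M_(1 + m, m)))).
    - move=> u /=; rewrite mul_mx_row mulmx1 mulmx0.
      have {2}-> : u = const_mx (u 0 0) by apply/rowP => i; rewrite mxE ord1.
      by split=> /asboolP.
    - move=> w; exists (row_mx 0 w); rewrite /= mul_row_col mul0mx mulmx1 add0r subrr.
      by have [] := hK1.
    - move=> v; rewrite -[v]hsubmxK /= mul_row_col mulmx0 mulmx1 add0r; split.
        move=> /asboolP[a ha]; exists (lsubmx v - a).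
        rewrite mul_mx_row mulmx1 mulmx0 opp_row_mx add_row_mx oppr0 addr0.
        by rewrite opprB addrC subrK.
      move=> [u]; rewrite mul_mx_row mulmx1 mulmx0 opp_row_mx add_row_mx oppr0 addr0.
      by move=> h; apply/asboolP; exists (lsubmx v - u).
  by apply: GD; [exact: Gcls | exact: IH].
move=> xi; rewrite -(quotg_piK xi).
apply: (free_abelian_ind (H := [set D | G (quotg_pi _ D)])) => [|M].
  split=> [|D E hD hE]; rewrite /= ?raddf0 //.
  by rewrite (raddfB (quotg_pi _)); exact: GB.
exact: GM.
Qed.

End ModuleClasses.

(** * Generators of the Grothendieck group of the surface *)

Section SurfaceG0.
Variables (F : closedFieldType) (n : nat) (r : 'I_n.+1 -> F).
Local Notation S := {poly {poly F}}.
Variables (A : comNzRingType) (ix iy : {rmorphism S -> A}).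
Hypothesis hA : is_surface r ix iy.
Local Notation x := (ix 'X).
Local Notation y := (iy 'X).
Local Notation xdiv := (xdiv r ix).
Local Notation fdiv := (fdiv ix).

Let dom : is_domain A. Proof. by case: hA. Qed.
Let hA' := is_surface_sym hA.
Let xy : x * y = ix (root_poly r)%:P. Proof. by case: hA. Qed.
Let ixyC (c : {poly F}) : ix c%:P = iy c%:P. Proof. by case: hA. Qed.

Lemma surface_noetherian : noetherian A.
Proof.
have cfu : commr_rmorph ix y by move=> f; exact: mulrC.
pose h := horner_morph cfu.
apply: (@noetherian_surj {poly S} A h); last exact/hilbert_basis/hilbert_basis/hilbert_basis/noetherian_field.
move=> a; have [_ _ _ _ gen] := hA; have [f [g ->]] := gen a.
exists (f%:P + map_poly polyC g); rewrite rmorphD /= /h horner_morphC; congr (_ + _).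
elim/poly_ind: g => [|g c IH]; first by rewrite !rmorph0.
rewrite !(rmorphD, rmorphM) /= IH map_polyX map_polyC /= horner_morphX.
by rewrite horner_morphC ixyC.
Qed.

Lemma fieldpoly_root_in_prime (phi : {rmorphism {poly F} -> A}) P c : prime_ideal P -> c != 0 ->
  P (phi c) -> exists a, P (phi ('X - a%:P)).
Proof.
move=> hP; have idP : ideal P by case: hP.
move: {2}(size c) (leqnn (size c)) => m; elim: m c => [|m IH] c.
  by rewrite leqn0 size_poly_eq0 => ->.
move=> sc c0 Pc; have [s1|s1] := leqP (size c) 1.
  have /size_poly1P[a a0 ea] : size c == 1%N by rewrite eqn_leq s1 size_poly_gt0.
  case: (prime_not1 hP); have -> : 1 = phi a^-1%:P * phi c; last exact: ideal_mull.
  by rewrite -rmorphM ea /= -polyCM mulVf // !rmorph1.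
have [a [c' ec]] := poly_root s1.
have c'0 : c' != 0 by apply: contraNneq c0 => c'0; rewrite ec c'0 mulr0.
case: (hP) => _ _ /(_ (phi ('X - a%:P)) (phi c')) []; first by rewrite -rmorphM -ec.
  by exists a.
apply: IH => //; move: sc; rewrite ec size_mul ?polyXsubC_eq0 // size_XsubC; size_lia.
Qed.

(* The ideal generated by x and c, which is all of the ideal (x) if c = root_poly. *)
Definition xideal (c : {poly F}) : set A := [set a | exists u v, a = x * u + ix c%:P * v].

Lemma xideal_ideal c : ideal (xideal c).
Proof.
split; first split.
- by exists 0, 0; rewrite !mulr0 addr0.
- by move=> _ _ [u [v ->]] [u' [v' ->]]; exists (u - u'), (v - v'); ring.
- by move=> a _ [u [v ->]]; exists (a * u), (a * v); ring.
Qed.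

Lemma xideal_x c u : xideal c (x * u).
Proof. by exists u, 0; rewrite mulr0 addr0. Qed.

Lemma xideal_c c v : xideal c (ix c%:P * v).
Proof. by exists 0, v; rewrite mulr0 add0r. Qed.

Lemma divides_expX (c : {poly F}) k (g : S) : c != 0 ->
  divides c%:P ('X^k * g) -> divides c%:P g.
Proof.
move=> c0; elim: k => [|k IH]; first by rewrite mul1r.
rewrite exprS -mulrA => -[h e]; apply: IH.
have /factor_theorem[h' eh] : root h 0.
  have := congr1 (fun q : S => q.[0]) e; rewrite !hornerE => /esym/eqP.
  by rewrite mulf_eq0 (negPf c0).
exists h'; apply: (@mulfI _ 'X); first by rewrite polyX_eq0.
by rewrite e eh subr0; ring.
Qed.

(** As x * y = c * d, multiplication by powers of y turns membership into divisibility by c in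
    F[z][y]; the powers of y cancel since c involves z alone. *)
Lemma xideal_iyP c d g : root_poly r = c * d -> c != 0 -> xideal c (iy g) <-> divides c%:P g.
Proof.
move=> ecd c0; split=> [[u [v e]]|[h ->]]; last first.
  by rewrite rmorphM /= -ixyC; exact: xideal_c.
have [N [u' eu]] := clear_y_denominator hA' u.
have [M [v' ev']] := clear_y_denominator hA' v.
apply: (@divides_expX _ (N + M).+1) => //.
exists (d%:P * ('X^M * u') + 'X^(N.+1) * v').
have [_ _ _ [_ iy_inj] _] := hA; apply: iy_inj.
rewrite !(rmorphD, rmorphM, rmorphXn) /= e -eu -ev' -!ixyC !exprS exprD.
have xycd : x * y = ix c%:P * ix d%:P by rewrite xy ecd polyCM rmorphM.
transitivity (x * y * y ^+ N * y ^+ M * u + ix c%:P * (y * y ^+ N * (y ^+ M * v))); first by ring.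
by rewrite xycd; ring.
Qed.

(** One factor is peeled off at a time: for I = (x, (z - r i) c), the ideal I : c is [xdiv i] and I
    + (c) is (x, c). The colon is computed modulo x, in F[z][y], which is why the product must
    divide [root_poly]. *)
Lemma cls_xideal (s : seq 'I_n.+1) d : root_poly r = (\prod_(i <- s) ('X - (r i)%:P)) * d ->
  cls (xideal (\prod_(i <- s) ('X - (r i)%:P))) = \sum_(i <- s) cls (xdiv i).
Proof.
elim: s d => [|i s IH] d.
  rewrite !big_nil => _; have -> : xideal 1 = setT; last exact: clsT.
  by apply/predeqP => a; split=> // _; exists 0, a; rewrite !rmorph1 mulr0 add0r mul1r.
rewrite !big_cons => ed; set c := \prod_(j <- s) _.
have c0 : c != 0 by apply: contraNneq (root_poly_neq0 r) => c0; rewrite ed -/c c0 mulr0 mul0r.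
have hI := xideal_ideal (('X - (r i)%:P) * c).
rewrite (cls_split (ix c%:P) hI).
have -> : colon (xideal (('X - (r i)%:P) * c)) (ix c%:P) = xdiv i.
  apply/predeqP => b; have [g [u ->]] := mod_x hA b.
  have -> : colon (xideal (('X - (r i)%:P) * c)) (ix c%:P) (iy g + x * u) <->
            xideal (('X - (r i)%:P) * c) (iy (g * c%:P)).
    rewrite /colon /= [(iy g + _) * _]mulrDl rmorphM /= -ixyC -mulrA; split=> h.
      by rewrite -[X in xideal _ X](addrK (x * (u * ix c%:P))); apply: ideal_sub => //; exact: xideal_x.
    by apply: ideal_add => //; exact: xideal_x.
  have -> : xdiv i (iy g + x * u) <-> xdiv i (iy g).
    have pxu : xdiv i (x * u) by exact: (ideal_mulr _ (xdiv_ideal _ _ i) (xdiv_x _ _ i)).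
    split=> h; last by apply: ideal_add => //; exact: xdiv_ideal.
    by rewrite -[iy g](addrK (x * u)); apply: ideal_sub => //; exact: xdiv_ideal.
  rewrite (xideal_iyP _ (d := d)) // ?mulf_neq0 ?polyXsubC_eq0 // (xdiv_iyP hA).
  split=> -[h e]; exists h.
    apply: (@mulIf _ c%:P); first by rewrite polyC_eq0.
    by rewrite e polyCM /lin; ring.
  by rewrite e polyCM /lin; ring.
rewrite -(IH (('X - (r i)%:P) * d)); last by rewrite ed; ring.
have -> // : adjoin (xideal (('X - (r i)%:P) * c)) (ix c%:P) = xideal c.
apply/seteqP; split.
  apply: adjoin_min; first exact: xideal_ideal.
    move=> _ [u [v ->]]; exists u, (ix ('X - (r i)%:P)%:P * v).
    by rewrite polyCM rmorphM /=; ring.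
  by rewrite -[ix _]mulr1; exact: xideal_c.
move=> _ [u [v ->]]; exists v; rewrite [v * _]mulrC addrK; exact: xideal_x.
Qed.

Lemma set0_ideal : ideal [set (0 : A)].
Proof. by case: (zero_prime dom). Qed.

Lemma cls_principal (a : A) : a != 0 -> cls [set b | exists c, b = c * a] = 0.
Proof.
move=> a0; have -> : [set b | exists c, b = c * a] = adjoin [set 0] a.
  apply/predeqP => b; split=> -[c h]; exists c; first by rewrite h /= subrr.
  by apply/eqP; rewrite -subr_eq0 h.
apply: cls_adjoin0; first exact: set0_ideal.
by move=> b /dom[//|/eqP]; rewrite (negPf a0).
Qed.

Lemma sum_cls_xdiv : \sum_i cls (xdiv i) = 0.
Proof.
rewrite -(@cls_xideal _ 1) ?mulr1 // -/(root_poly r).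
rewrite -(cls_principal (x_neq0 hA)); congr cls; apply/predeqP => a; split.
  by move=> [u [v ->]]; exists (u + y * v); rewrite -xy; ring.
by move=> [c ->]; rewrite mulrC; exact: xideal_x.
Qed.

Section Generation.
Variable G : set (G0 A).
Hypotheses (hG : subgroup G) (G_free : G (cls [set 0])) (G_xdiv : forall i, G (cls (xdiv i))).

Let G0' : G 0. Proof. by case: hG. Qed.
Let GB u v : G u -> G v -> G (u - v). Proof. by case: hG => _; apply. Qed.

(** A / [xdiv i] is the principal ideal domain F[y], so I adds one generator, a polynomial of least
    degree, which is regular modulo the prime. *)
Lemma cls_xdiv_proper I i : ideal I -> xdiv i `<=` I -> (exists2 a, I a & ~ xdiv i a) -> cls I = 0.
Proof.
move=> hI iI [a Ia na].
pose e (q : {poly F}) := iy (map_poly polyC q).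
have eI b q b' : b = e q + b' -> xdiv i b' -> I b -> I (e q).
  move=> -> hb' Ib; have -> : e q = e q + b' - b' by rewrite addrK.
  by apply: ideal_sub => //; exact: iI.
have ex : exists m, `[< exists q, [/\ q != 0, I (e q) & size q = m] >].
  have [q [b [hb ea]]] := xdiv_mod hA i a.
  exists (size q); apply/asboolP; exists q; split=> //; last exact: (eI a q b).
  by apply: contra_notN na => /eqP q0; rewrite ea q0 !rmorph0 add0r.
case: (ex_minnP ex) => _ /asboolP[q [q0 Iq <-]] min.
have -> : I = adjoin (xdiv i) (e q).
  apply/seteqP; split; last exact: adjoin_min.
  move=> b Ib; have [s [b' [hb' eb]]] := xdiv_mod hA i b.
  have Is := eI _ _ _ eb hb' Ib.
  have es : e s = e (s %/ q) * e q + e (s %% q).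
    by rewrite /e {1}(divp_eq s q) !rmorphD !rmorphM.
  have m0 : s %% q = 0.
    apply/eqP; apply: contrapT => /negP m0.
    have /min : `[< exists q', [/\ q' != 0, I (e q') & size q' = size (s %% q)] >].
      apply/asboolP; exists (s %% q); split=> //.
      have -> : e (s %% q) = e s - e (s %/ q) * e q by rewrite es; ring.
      by apply: ideal_sub => //; exact: ideal_mull.
    by rewrite leqNgt ltn_modp q0.
  exists (e (s %/ q)); rewrite eb -/(e s) es m0 /e !rmorph0 addr0.
  by rewrite addrAC subrr add0r.
apply: cls_adjoin0; first exact: xdiv_ideal.
move=> b; case: (xdiv_prime hA i) => _ _ /[apply] -[//|].
by move=> /(xdiv_constP hA) q00; rewrite q00 eqxx in q0.
Qed.

(** Noetherian induction: a prime containing a power of x lies over x, so it is some [xdiv i] or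
    strictly contains one. *)
Lemma cls_torsion I : ideal I -> (exists N, I (x ^+ N)) -> G (cls I).
Proof.
move: I; apply: (noetherian_ind surface_noetherian) => I hI IH [N IxN].
apply: cls_strict_split => //.
  by move=> J hJ IJ aJ; apply: IH => //; exists N; exact: IJ.
move=> hP; have Ix : I x by exact: prime_exp IxN.
have [i iI] := prime_over_x hA hP Ix.
have [Ii|nIi] := pselect (I `<=` xdiv i).
  have -> : I = xdiv i by exact/seteqP.
  exact: G_xdiv.
rewrite (@cls_xdiv_proper I i) //; apply: contrapT => h; apply: nIi => a Ia.
by apply: contrapT => na; apply: h; exists a.
Qed.

(** Start from the principal ideal of ix f, whose quotient has class 0, and adjoin the generators of
    [fdiv f] one by one. Each generator is carried into (ix f) by a power of x, so the colon ideals
    are covered by [cls_torsion]. *)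
Lemma cls_fdiv f : irred f -> ~ divides f 'X -> G (cls (fdiv f)).
Proof.
move=> hf fX; have hI := fdiv_ideal hA f.
have [s es] := surface_noetherian hI.
have fs g : g \in s -> fdiv f g by rewrite es; exact: generated_mem.
suff [J [hJ Jf Js GJ]] : exists J, [/\ ideal J, J `<=` fdiv f, (forall g, g \in s -> J g) & G (cls J)].
  have <- // : J = fdiv f; apply/seteqP; split=> //.
  by rewrite es; exact: generated_min.
suff [J [hJ Jf Js GJ _]] : exists J, [/\ ideal J, J `<=` fdiv f, (forall g, g \in s -> J g), G (cls J) & J (ix f)].
  by exists J.
elim: s fs {es} => [|g s IH] fs.
  exists [set b | exists c, b = c * ix f]; rewrite cls_principal; last first.
    by apply/eqP => /(ix_eq0 hA)/eqP; case: hf => /negPf->.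
  split=> //; last by exists 1; rewrite mul1r.
    split; first split.
    - by exists 0; rewrite mul0r.
    - by move=> _ _ [u ->] [v ->]; exists (u - v); rewrite mulrBl.
    - by move=> b _ [u ->]; exists (b * u); rewrite mulrA.
  move=> _ [u ->]; apply: ideal_mull => //; exact: (fdiv_f hA).
have [J [hJ Jf Js GJ Jix]] : exists J, [/\ ideal J, J `<=` fdiv f, (forall g, g \in s -> J g), G (cls J) & J (ix f)].
  by apply: IH => h hs; apply: fs; rewrite inE hs orbT.
have fg : fdiv f g by apply: fs; exact: mem_head.
exists (adjoin J g); split.
- exact: adjoin_ideal.
- exact: adjoin_min.
- move=> h; rewrite inE => /orP[/eqP->|/Js]; first exact: adjoin_mem.
  exact: sub_adjoin.
- have := cls_split g hJ => /(congr1 (fun u => u - cls (colon J g))).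
  rewrite [in X in _ = X]addrC addKr => <-; apply: GB => //.
  apply: cls_torsion; first exact: colon_ideal.
  case: fg => N [h e]; exists N; rewrite /colon /= e rmorphM; exact: ideal_mulr.
- exact: sub_adjoin.
Qed.

(** Modulo x - a with a != 0, x acts as an invertible constant. *)
Lemma expX_cancel J a b N : ideal J -> a != 0 -> J ((x - ix a%:P%:P) * b) -> J (x ^+ N * b) -> J b.
Proof.
move=> hJ a0 hb; elim: N => [|N IH]; first by rewrite mul1r.
move=> h; apply: IH.
have -> : x ^+ N * b = ix a^-1%:P%:P * (x ^+ N.+1 * b - x ^+ N * ((x - ix a%:P%:P) * b)).
  have e : ix a^-1%:P%:P * ix a%:P%:P = 1 by rewrite -rmorphM -!polyCM mulVf // !rmorph1.
  transitivity (ix a^-1%:P%:P * ix a%:P%:P * (x ^+ N * b)); first by rewrite e mul1r.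
  by rewrite exprS; ring.
apply: ideal_mull => //; apply: ideal_sub => //; exact: ideal_mull.
Qed.

(** Such an I is the ideal of a point z = b0, x = a0 with a0 != 0. Off x it is generated by the
    regular sequence z - b0, x - a0, so A/I has class 0. *)
Lemma cls_maximal f I : irred f -> ~ divides f 'X -> prime_ideal I -> ~ I x -> I (ix f) ->
  (exists2 a, I a & ~ fdiv f a) -> cls I = 0.
Proof.
move=> hf fX hP nx If [b Ib nb]; have hI : ideal I by case: hP.
have [N [g eg]] := clear_y_denominator hA b.
have Ig : I (ix g) by rewrite -eg; exact: ideal_mull.
have nfg : ~ divides f g by move=> h; apply/nb/(fdivP hA hf fX eg).
have f0 : f != 0 by case: hf.
(* Eliminating x from the coprime f and g leaves a nonzero polynomial in z; one of its roots gives
   b0. *)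
have [c c0 Ic] : exists2 c : {poly F}, c != 0 & I (ix c%:P).
  have [s1|sf] := leqP (size f) 1.
    have /size_poly1P[c c0 ec] : size f == 1%N by rewrite eqn_leq s1 size_poly_gt0.
    by exists c; rewrite // -ec.
  have cop := irred_coprime hf sf nfg.
  have [[u v] /= /eqp_size] := Bezoutp f g; rewrite (eqP cop) => /eqP/size_poly1P[c c0 ec].
  exists c => //; rewrite -ec rmorphD !rmorphM /=.
  by apply: ideal_add => //; exact: ideal_mull.
have [b0 Ib0] := @fieldpoly_root_in_prime (ix \o polyC) I c hP c0 Ic.
rewrite /= -/(lin b0) in Ib0.
(* An element of I that stays nonzero at z = b0 is needed, so that it restricts to a nonzero
   polynomial in x with a root a0. If f vanishes there, f is associate to z - b0 and g does not
   vanish. *)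
have [h Ih nh] : exists2 h, I (ix h) & ~ divides (lin b0) h.
  have [lf|nlf] := pselect (divides (lin b0) f); last by exists f.
  exists g => // lg; apply: nfg; apply: divides_trans lg.
  by apply: irred_factor => //; rewrite mu_lin.
pose e (q : {poly F}) := ix (map_poly polyC q).
have mod_lin k : exists2 k', ix k = e (ev b0 k) + ix k' & divides (lin b0) k'.
  exists (k - map_poly polyC (ev b0 k)); first by rewrite /e -rmorphD addrC subrK.
  exact: lin_divides_sub_ev.
have I_lin k : divides (lin b0) k -> I (ix k).
  by move=> [k' ->]; rewrite rmorphM; exact: ideal_mulr.
have q0 : ev b0 h != 0 by apply/eqP => /ev_eq0.
have Iq : I (e (ev b0 h)).
  have [k ek /I_lin Ik] := mod_lin h.
  by have -> : e (ev b0 h) = ix h - ix k; [rewrite ek addrK | exact: ideal_sub].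
have [a0 Ia0] := @fieldpoly_root_in_prime (ix \o map_poly polyC) I _ hP q0 Iq.
have {Ia0} : I (x - ix a0%:P%:P).
  by move: Ia0; rewrite /= !rmorphB /= map_polyX map_polyC.
set X0 := x - _ => IX0.
have na0 : a0 != 0.
  by apply: contra_notN nx => /eqP a00; move: IX0; rewrite /X0 a00 !rmorph0 subr0.
pose Z0 := ix (lin b0).
pose J1 : set A := adjoin [set 0] Z0.
have hJ1 : ideal J1 by exact/adjoin_ideal/set0_ideal.
have J1P k : divides (lin b0) k -> J1 (ix k).
  by move=> [k' ->]; exists (ix k'); rewrite /= rmorphM mulrC subrr.
have J1I : J1 `<=` I.
  by apply: adjoin_min => // _ ->; exact: ideal_zero.
(* Modulo z - b0 and x - a0 a numerator of d becomes the constant q.[a0], which lies in I and hence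
   is 0; a0 != 0 then allows the power of x to be cancelled. *)
have -> : I = adjoin J1 X0.
  apply/seteqP; split; last exact: adjoin_min.
  have hJ2 := adjoin_ideal X0 hJ1; have J2X0 := adjoin_mem X0 hJ1.
  move=> d Id; have [M [w ew]] := clear_y_denominator hA d.
  apply: (@expX_cancel _ a0 d M) => //; first exact: ideal_mulr.
  have [k ek lk] := mod_lin w; set q := ev b0 w in ek.
  have [q' eq'] : exists q', q = q' * ('X - a0%:P) + q.[a0]%:P.
    have /factor_theorem[q' e'] : root (q - q.[a0]%:P) a0.
      by rewrite /root !hornerE subrr.
    by exists q'; rewrite -e' subrK.
  have eX0 : e ('X - a0%:P) = X0 by rewrite /e !rmorphB /= map_polyX map_polyC.
  have ew' : x ^+ M * d = e q' * X0 + e q.[a0]%:P + ix k.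
    suff <- : e q = e q' * X0 + e q.[a0]%:P by rewrite ew ek.
    by rewrite -eX0 /e -!rmorphM -!rmorphD -eq'.
  have : I (e q.[a0]%:P).
    have -> : e q.[a0]%:P = x ^+ M * d - (e q' * X0 + ix k) by rewrite ew'; ring.
    apply: ideal_sub => //; first exact: ideal_mull.
    by apply: ideal_add => //; [exact: ideal_mull | exact: I_lin].
  have [qa0 _|qa0 Iqa] := eqVneq q.[a0] 0.
    rewrite ew' qa0 /e !rmorph0 addr0; apply: ideal_add => //; first exact: ideal_mull.
    by apply: sub_adjoin; exact: J1P.
  case: (prime_not1 hP).
  have -> : 1 = ix (q.[a0])^-1%:P%:P * e (q.[a0])%:P; last exact: ideal_mull.
  by rewrite /e map_polyC -rmorphM /= -!polyCM mulVf // !rmorph1.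
(* Regularity of x - a0 modulo z - b0: clear denominators and evaluate at z = b0, where x - a0
   remains nonzero. *)
apply: cls_adjoin0 => // d [k /= ek].
have [M [w ew]] := clear_y_denominator hA d; have [M' [w' ew']] := clear_y_denominator hA k.
have JdX0 : J1 (d * X0) by exists k.
apply: (@expX_cancel _ a0 d M) => //; first by rewrite -/X0 mulrC.
rewrite ew; apply: J1P.
have e2 : 'X^M' * w * ('X - a0%:P%:P) = 'X^M * w' * lin b0.
  have [_ _ _ [ix_inj _] _] := hA; apply: ix_inj.
  rewrite !(rmorphB, rmorphM, rmorphXn) /= -ew -ew' -/Z0.
  have -> : x ^+ M' * (x ^+ M * d) * (x - ix a0%:P%:P) = x ^+ M' * x ^+ M * (d * X0).
    by rewrite /X0; ring.
  have -> : d * X0 = k * Z0 by apply/eqP; rewrite -subr_eq0 ek.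
  by ring.
apply/ev_eq0; have := congr1 (ev b0) e2.
rewrite !evM evB ev_lin mulr0 !evXn evX ev_polyC hornerC => /eqP.
by rewrite !mulf_eq0 expf_eq0 polyX_eq0 andbF polyXsubC_eq0 orbF => /eqP.
Qed.

Lemma G0_generated xi : G xi.
Proof.
apply: G0_gen_cls => //; apply: (noetherian_ind surface_noetherian) => I hI IH.
apply: cls_strict_split => // hP.
have [Ix|nx] := pselect (I x); first by apply: cls_torsion => //; exists 1%N.
have [aI|zI] := pselect (exists2 a, I a & a != 0); last first.
  have -> // : I = [set 0].
  apply/predeqP => a; split=> [Ia|->]; last exact: ideal_zero.
  by apply/eqP; apply: contrapT => /negP a0; apply: zI; exists a.
have [f [hf fX If]] := prime_off_x hA hP nx aI.
have [h|nI] := pselect (exists2 a, I a & ~ fdiv f a).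
  by rewrite (cls_maximal hf fX hP nx If h).
have -> : I = fdiv f; last exact: cls_fdiv.
apply/seteqP; split; last exact: fdiv_min.
by move=> a Ia; apply: contrapT => na; apply: nI; exists a.
Qed.

End Generation.
End SurfaceG0.

(** * The class group and the Grothendieck group of the surface *)

Section SurfaceClassGroup.
Variables (F : closedFieldType) (n : nat) (r : 'I_n.+1 -> F).
Local Notation S := {poly {poly F}}.
Variables (A : comNzRingType) (ix iy : {rmorphism S -> A}).
Hypothesis hA : is_surface r ix iy.
Local Notation x := (ix 'X).
Local Notation y := (iy 'X).
Local Notation X_ := (Xdiv hA).
Local Notation div_class := (quotg_pi (@principal_divisors A)).

Let dom : is_domain A. Proof. by case: hA. Qed.
Let hA' := is_surface_sym hA.
Let xy : x * y = ix (root_poly r)%:P. Proof. by case: hA. Qed.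
Let ixyC (c : {poly F}) : ix c%:P = iy c%:P. Proof. by case: hA. Qed.
Let dvr := surface_dvr hA.
Let fin := surface_finite_support hA.

(** A presentation of L / Q_lambda directly on Z^(n+1); the class group and both lattice quotients
    are compared with it. *)
Definition class_relations : set 'rV[int]_n.+1 :=
  [set v | v = \sum_i bas i \/ exists i j, r i = r j /\ v = bas i - bas j].

Local Notation Q := (quotg class_relations).
Local Notation pi := (quotg_pi class_relations).

Lemma pi_bas_eq i j : r i = r j -> pi (bas i) = pi (bas j).
Proof. by move=> e; apply/quotg_piP/mem_span; right; exists i, j. Qed.

Lemma Xdiv_eq i j : (X_ i == X_ j) = (r i == r j).
Proof.
apply/eqP/eqP => [/(congr1 val) /= e|e]; last by apply: val_inj; rewrite /= /xdiv e.
have : xdiv r ix j (iy (lin (r i))) by rewrite -e -(ix_lin hA); exact: xdiv_lin.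
move=> /(xdiv_iyP hA)/ev_eq0; rewrite /lin ev_polyC hornerXsubC => /eqP.
by rewrite polyC_eq0 subr_eq0 => /eqP.
Qed.

(** At [X_ j] the factor y is a unit, so x has the order of the product of the z - r i; those with r
    i != r j are units and each of the others is the uniformizer. *)
Lemma ord_Xdiv_x j : ord (X_ j) x = (\sum_i (X_ i == X_ j))%N.
Proof.
pose t := ix (lin (r j)).
apply: (ordE dom dvr (t := t)); [exact: (xdiv_uniformizer hA j) | exact: (x_neq0 hA) |].
exists y, (\prod_(i | r i != r j) ix (lin (r i))); split.
- exact: (xdiv_y hA).
- elim/big_rec: _ => [|i a ij na]; first exact: (prime_not1 (xdiv_prime hA j)).
  case: (xdiv_prime hA j) => _ _ /[apply] -[|//].
  rewrite (ix_lin hA) => /(xdiv_iyP hA)/ev_eq0; rewrite /lin ev_polyC hornerXsubC => /eqP.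
  by rewrite polyC_eq0 subr_eq0 eq_sym (negPf ij).
rewrite mulrC xy /root_poly rmorph_prod rmorph_prod /= (bigID (fun i => r i == r j)) /= mulrC.
congr (_ * _); transitivity (\prod_(i | r i == r j) t).
  by apply: eq_bigr => i /eqP e; rewrite /t /lin e.
rewrite prodr_const; congr (_ ^+ _); rewrite -sum1_card big_mkcond /=.
by apply: eq_bigr => i _; rewrite Xdiv_eq -[i \in _]/(r i == r j); case: (r i == r j).
Qed.

Lemma is_div_x : is_div x (\sum_i mkmalgU (X_ i) 1).
Proof.
apply/(is_divE dom dvr _ (x_neq0 hA)) => P; rewrite raddf_sum /=.
under eq_bigr do rewrite mcoeffU.
have [Px|nPx] := pselect (val P x).
  have [j ->] := height_one_on_x hA Px; rewrite ord_Xdiv_x.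
  by rewrite -natz natr_sum; apply: eq_bigr => i _; rewrite -mulr_natl mulr1.
rewrite (ord_eq0 dom dvr (x_neq0 hA) nPx) big1 // => i _.
by case: eqP => // e; case: nPx; rewrite -e; exact: xdiv_x.
Qed.

Definition chi (v : 'rV[int]_n.+1) : Cl A := \sum_i div_class (mkmalgU (X_ i) 1) *~ v 0 i.

Lemma chi_zmod_morphism : zmod_morphism chi.
Proof.
by move=> u v; rewrite /chi -sumrB; apply: eq_bigr => i _; rewrite !mxE mulrzBr.
Qed.

HB.instance Definition _ := GRing.isZmodMorphism.Build _ _ chi chi_zmod_morphism.

Lemma chi_bas i : chi (bas i) = div_class (mkmalgU (X_ i) 1).
Proof.
rewrite /chi (bigD1 i) //= /bas mxE !eqxx big1 ?addr0 // => j ji.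
by rewrite mxE eqxx (negPf ji).
Qed.

Lemma chi_relations v : class_relations v -> chi v = 0.
Proof.
move=> [->|[i [j [e ->]]]].
  rewrite raddf_sum /=; under eq_bigr do rewrite chi_bas.
  rewrite -(raddf_sum div_class); exact: is_div_principal (x_neq0 hA) is_div_x.
have /eqP eX : X_ i == X_ j by rewrite Xdiv_eq e.
by rewrite raddfB /= !chi_bas eX subrr.
Qed.

(* A divisor supported on x = 0 is sent to the combination of the r_i it stands for; a
   component fdiv f is linearly equivalent to minus the rest of the divisor of f. *)
Lemma class_retraction : exists (th0 th : prime_divisor A -> Q),
  [/\ forall i, th0 (X_ i) = pi (bas i),
      forall P : prime_divisor A, ~ val P x -> th0 P = 0,
      forall P : prime_divisor A, val P x -> th P = th0 P &
      forall P : prime_divisor A, ~ val P x -> exists f D,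
        [/\ irred f, val P (ix f), is_div (ix f) D & th P = - free_ext th0 D]].
Proof.
have /choice[th0 h0] : forall P : prime_divisor A, exists w : Q,
    (forall i, P = X_ i -> w = pi (bas i)) /\ (~ val P x -> w = 0).
  move=> P.
  have [Px|nPx] := pselect (val P x); last first.
    by exists 0; split=> // i e; case: nPx; rewrite e; exact: xdiv_x.
  have [i ->] := height_one_on_x hA Px; exists (pi (bas i)).
  split=> [j /eqP|nx]; first by rewrite Xdiv_eq => /eqP/pi_bas_eq.
  by case: nx; exact: xdiv_x.
have /choice[th h] : forall P : prime_divisor A, exists w : Q,
    (val P x -> w = th0 P) /\ (~ val P x -> exists f D,
        [/\ irred f, val P (ix f), is_div (ix f) D & w = - free_ext th0 D]).
  move=> P.
  have [Px|nPx] := pselect (val P x); first by exists (th0 P).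
  have [f [hf fX Pf]] := prime_off_x hA (prime_divisor_prime P) nPx (prime_divisor_neq0 P).
  have f0 : ix f != 0 by apply/eqP => /(ix_eq0 hA)/eqP; case: hf => /negPf->.
  have [D hD] := is_div_exists dom dvr fin f0.
  by exists (- free_ext th0 D); split=> // _; exists f, D.
by exists th0, th; split=> [i|P|P|P]; [exact: (h0 _).1 | exact: (h0 _).2 | exact: (h _).1 | exact: (h _).2].
Qed.

Lemma eq_free_ext_supp (g h : prime_divisor A -> Q) D :
  (forall P, mcoeff P D != 0 -> g P = h P) -> free_ext g D = free_ext h D.
Proof.
move=> e; apply: eq_bigr => P _; have [->|/e->//] := eqVneq (mcoeff P D) 0.
by rewrite !mulr0z.
Qed.

(** The retraction uses one chosen irreducible per prime; associates have the same divisor, so any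
    other choice can be substituted. *)
Lemma irred_assoc f g (D E : {malg int[prime_divisor A]}) : irred f -> irred g -> divides f g ->
  is_div (ix f) D -> is_div (ix g) E -> D = E.
Proof.
move=> hf hg fg; have [h eg] := fg; have [h' ef] : divides g f.
  by apply: irred_factor => //; case: hf.
have f0 : ix f != 0 by apply/eqP => /(ix_eq0 hA)/eqP; case: hf => /negPf->.
have g0 : ix g != 0 by apply/eqP => /(ix_eq0 hA)/eqP; case: hg => /negPf->.
move=> /(is_divE dom dvr _ f0) hD /(is_divE dom dvr _ g0) hE; apply/malgP => P.
rewrite hD hE; congr (_%:Z); apply/eqP; rewrite eqn_leq.
have h0 : ix h != 0 by apply: contraNneq g0 => e; rewrite eg rmorphM e mulr0.
have h'0 : ix h' != 0 by apply: contraNneq f0 => e; rewrite ef rmorphM e mulr0.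
apply/andP; split.
  by rewrite eg rmorphM (ordM dom dvr) // leq_addr.
by rewrite ef rmorphM (ordM dom dvr) // leq_addr.
Qed.

(** By multiplicativity it suffices to treat units, x and the irreducibles f not associate to x; a
    general a has x ^+ N * a = ix g, and the divisor of x ^+ N is already known to go to 0. *)
Lemma retraction_principal (th0 th : prime_divisor A -> Q) :
    (forall i, th0 (X_ i) = pi (bas i)) ->
    (forall P : prime_divisor A, ~ val P x -> th0 P = 0) ->
    (forall P : prime_divisor A, val P x -> th P = th0 P) ->
    (forall P : prime_divisor A, ~ val P x -> exists f D,
        [/\ irred f, val P (ix f), is_div (ix f) D & th P = - free_ext th0 D]) ->
  forall D, @principal_divisors A D -> free_ext th D = 0.
Proof.
move=> th0X th0n thx thn.
have div_x D : is_div x D -> free_ext th D = 0.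
  move=> hD; rewrite (is_div_uniq dom dvr (x_neq0 hA) hD is_div_x) raddf_sum /=.
  transitivity (\sum_i pi (bas i)).
    by apply: eq_bigr => i _; rewrite free_extU thx ?th0X //; exact: xdiv_x.
  rewrite -(raddf_sum pi); apply/quotg_pi_eq0/mem_span; by left.
have div_ix g : g != 0 -> forall D, is_div (ix g) D -> free_ext th D = 0.
  move: g; apply: irred_ind => [c c0|f hf|f g f0 g0 IHf IHg] D.
  - have c0' : ix c%:P%:P != 0 by apply/eqP => /(ix_eq0 hA)/eqP; rewrite !polyC_eq0 (negPf c0).
    move=> /(is_divE dom dvr _ c0') hD; have -> : D = 0; last by rewrite raddf0.
    apply/malgP => P; rewrite hD mcoeff0 (ord_eq0 dom dvr) // => Pc.
    apply: (prime_not1 (prime_divisor_prime P)).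
    have -> : 1 = ix c^-1%:P%:P * ix c%:P%:P; last by apply: ideal_mull => //; exact: prime_divisor_ideal.
    by rewrite -rmorphM /= -!polyCM mulVf // !rmorph1.
  - have f0 : ix f != 0 by apply/eqP => /(ix_eq0 hA)/eqP; case: hf => /negPf->.
    have [fX|nfX] := pselect (divides f 'X).
      move=> hD; apply: div_x; rewrite (irred_assoc hf (irredX F) fX hD is_div_x).
      exact: is_div_x.
    move=> hD; have hP := fdiv_height_one hA hf nfX.
    pose P : prime_divisor A := exist (fun P => `[< height_one P >]) (fdiv ix f) (asboolT hP).
    have nPx : ~ val P x by exact: (fdiv_x hA).
    have [f' [D' [hf' Pf' hD' thP]]] := thn P nPx.
    have ff' : divides f f' by exact/(fdiv_ixP hA hf nfX).
    have DD' : D = D' by exact: irred_assoc hD hD'.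
    (* P occurs in div f with multiplicity one and the rest is supported over x, so the value chosen
       for th P cancels it. *)
    rewrite -[D](subrK (mkmalgU P 1)) raddfD /= free_extU thP -DD'.
    rewrite (@eq_free_ext_supp th th0); last first.
      move=> R; rewrite mcoeffB mcoeffU ((is_divE dom dvr _ f0).1 hD) => nR.
      apply: thx; apply: contrapT => nRx; move/eqP: nR; apply.
      have [eP|nPR] := eqVneq P R.
        rewrite -eP (ord_uniformizer dom dvr) ?subrr //; exact: (fdiv_uniformizer hA hf nfX).
      rewrite (ord_eq0 dom dvr) ?subrr // => Rf; move/eqP: nPR; apply; apply/val_inj.
      by rewrite (height_one_off_x hA nRx hf Rf).
    by rewrite raddfB /= free_extU (th0n P nPx) subr0 subrr.
  have if0 : ix f != 0 by apply: contraNneq f0 => /(ix_eq0 hA) ->.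
  have ig0 : ix g != 0 by apply: contraNneq g0 => /(ix_eq0 hA) ->.
  rewrite rmorphM => hD.
  have [Df hDf] := is_div_exists dom dvr fin if0; have [Dg hDg] := is_div_exists dom dvr fin ig0.
  have -> : D = Df + Dg.
    apply: (is_div_uniq dom dvr (domain_mul_neq0 dom if0 ig0) hD).
    exact: (is_divM dom dvr).
  by rewrite raddfD /= (IHf _ hDf) (IHg _ hDg) addr0.
move=> D [a [a0 hD]]; have [N [g e]] := clear_y_denominator hA a.
have xN0 := xn_neq0 hA N.
have g0 : g != 0.
  by apply: contraTneq (domain_mul_neq0 dom xN0 a0) => g0; rewrite e g0 rmorph0 eqxx.
have [E hE] := is_div_exists dom dvr fin xN0.
have E0 : free_ext th E = 0.
  by apply: (div_ix 'X^N); [rewrite expf_neq0 // polyX_eq0 | rewrite rmorphXn].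
have := div_ix g g0 (E + D); rewrite -e raddfD /= E0 add0r; apply.
exact: (is_divM dom dvr).
Qed.

(** The retraction induces a homomorphism from Cl whose composite with [chi] is the projection [pi],
    so [chi] has no further kernel. *)
Lemma chi_eq0 v : chi v = 0 <-> v \in span class_relations.
Proof.
split; last first.
  apply: (span_sub (H := [set w | chi w = 0])) => [|w]; last exact: chi_relations.
  by split=> [|u w /= hu hw]; rewrite /= ?raddf0 // raddfB /= hu hw subrr.
have [th0 [th [h1 h2 h3 h4]]] := class_retraction.
have [|g gE] := @quotg_lift_exists _ _ (@principal_divisors A) (free_ext th).
  exact: (retraction_principal h1 h2 h3 h4).
move=> chi0; apply/quotg_pi_eq0; rewrite -[RHS](raddf0 g) -chi0 /chi raddf_sum /=.
transitivity (\sum_i pi (bas i) *~ v 0 i).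
  have {1}-> : v = \sum_i (bas i) *~ v 0 i.
    rewrite {1}[v]row_sum_delta; apply: eq_bigr => i _.
    by rewrite -[X in X *: _]intz scaler_int.
  by rewrite raddf_sum; apply: eq_bigr => i _; rewrite raddfMz.
apply: eq_bigr => i _; rewrite raddfMz /=; congr (_ *~ _).
rewrite gE; transitivity (th (X_ i)); last exact/esym/free_extU.
by rewrite h3 ?h1 //; exact: xdiv_x.
Qed.

(** For P off x, the divisor of the irreducible f defining P is P plus components over x, so P is
    equivalent to a combination of the [X_ i]. *)
Lemma chi_surj w : exists v, chi v = w.
Proof.
rewrite -(quotg_piK w); move: (repr w) => {w}.
pose H := [set D | exists v, chi v = div_class D].
have sub : subgroup H.
  split=> [|D E [v hv] [u hu]]; first by exists 0; rewrite !raddf0.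
  by exists (v - u); rewrite !raddfB /= hv hu.
have X_sub D : (forall P, mcoeff P D != 0 -> val P x) -> H D.
  move=> hD; have -> : D = free_ext (fun P : prime_divisor A => mkmalgU P (1 : int)) D.
    by rewrite {1}[D]monalgE; apply: eq_bigr => P _; exact: malgU_mulz.
  rewrite /free_ext big_seq; apply: subgroup_sum => // P; rewrite -mcoeff_neq0 => /hD.
  move=> /(height_one_on_x hA)[i ->]; apply: subgroup_mulz => //.
  by exists (bas i); exact: chi_bas.
apply: (free_abelian_ind (H := H) sub) => P.
have [Px|nPx] := pselect (val P x).
  have [i ->] := height_one_on_x hA Px; exists (bas i); exact: chi_bas.
have [f [hf fX Pf]] := prime_off_x hA (prime_divisor_prime P) nPx (prime_divisor_neq0 P).
have f0 : ix f != 0 by apply/eqP => /(ix_eq0 hA)/eqP; case: hf => /negPf->.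
have [D hD] := is_div_exists dom dvr fin f0.
have [|v hv] := X_sub (mkmalgU P 1 - D); last first.
  exists v; rewrite hv (raddfB div_class) /= (is_div_principal f0 hD) subr0 //.
move=> R; rewrite mcoeffB mcoeffU ((is_divE dom dvr _ f0).1 hD) => nR.
apply: contrapT => nRx; move/eqP: nR; apply.
have [eP|nPR] := eqVneq P R.
  rewrite -eP (ord_uniformizer dom dvr) ?subrr // (height_one_off_x hA nPx hf Pf).
  exact: (fdiv_uniformizer hA hf fX).
rewrite (ord_eq0 dom dvr) ?subrr // => Rf; move/eqP: nPR; apply; apply/val_inj.
by rewrite (height_one_off_x hA nRx hf Rf) (height_one_off_x hA nPx hf Pf).
Qed.

Theorem surface_Cl : zmod_iso (quotg class_relations) (Cl A).
Proof. exact: (first_iso (f := chi) chi_surj chi_eq0). Qed.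

Definition gam (w : int * 'rV[int]_n.+1) : G0 A :=
  cls [set 0] *~ w.1 + \sum_i cls (xdiv r ix i) *~ w.2 0 i.

Lemma gam_zmod_morphism : zmod_morphism gam.
Proof.
move=> [a u] [b v]; rewrite /gam /= mulrzBr opprD addrACA -sumrB; congr (_ + _).
by apply: eq_bigr => i _; rewrite !mxE mulrzBr.
Qed.

HB.instance Definition _ := GRing.isZmodMorphism.Build _ _ gam gam_zmod_morphism.

Lemma gam_bas i : gam (0, bas i) = cls (xdiv r ix i).
Proof.
rewrite /gam /= mulr0z add0r (bigD1 i) //= /bas mxE !eqxx big1 ?addr0 // => j ji.
by rewrite mxE eqxx (negPf ji).
Qed.

Lemma gam_surj xi : exists w, gam w = xi.
Proof.
apply: (G0_generated hA (G := [set xi | exists w, gam w = xi])).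
- split=> [|_ _ [v <-] [w <-]]; first by exists 0; rewrite raddf0.
  by exists (v - w); rewrite raddfB.
- by exists (1, 0); rewrite /gam /= big1 ?addr0 // => i _; rewrite mxE.
- by move=> i; exists (0, bas i); exact: gam_bas.
Qed.

Lemma gamB u v : gam (0, u - v) = gam (0, u) - gam (0, v).
Proof. by rewrite -raddfB; congr (gam (_, _)); rewrite /= subrr. Qed.

Lemma gam_relations v : v \in span class_relations -> gam (0, v) = 0.
Proof.
apply: (span_sub (H := [set v | gam (0, v) = 0])).
  split=> [|u w /= hu hw]; first exact: (raddf0 gam).
  by rewrite gamB hu hw subrr.
move=> _ /= [->|[i [j [e ->]]]]; last by rewrite gamB !gam_bas /xdiv e subrr.
rewrite -[RHS](sum_cls_xdiv hA) /gam /= mulr0z add0r; apply: eq_bigr => i _.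
rewrite summxE (bigD1 i) //= /bas mxE !eqxx big1 ?addr0 // => j ji.
by rewrite mxE eqxx eq_sym (negPf ji).
Qed.

(** By [f_gam] an element of the kernel of f is gam (0, v) with chi v = 0. Then v is a combination
    of [class_relations], and these already hold among the classes of the A / [xdiv i]. *)
Theorem surface_G0 : zmod_iso (G0 A) (int * Cl A)%type.
Proof.
have [f fE] := @G0_hom_of_flag A _ (@ideal_class A) (ideal_classT dom dvr fin) (ideal_class_swap dom dvr fin).
have f_cls I : ideal I -> f (cls I) = ideal_class I.
  by move=> hI; rewrite (clsE hI) /G0_class fE flag_inv_cyc.
have f_gam w : f (gam w) = (w.1, - chi w.2).
  rewrite /gam raddfD raddf_sum raddfMz /= f_cls; last exact: (set0_ideal hA).
  rewrite ideal_class_zero; last by case=> a -> /eqP.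
  under eq_bigr => i _.
    rewrite raddfMz /= f_cls; last exact: (xdiv_ideal r ix i).
    rewrite (ideal_class_prime dom dvr fin (X_ i)); over.
  rewrite [LHS]surjective_pairing; congr pair.
    rewrite raddfD raddfMz raddf_sum /= intz big1 ?addr0 // => i _.
    by rewrite raddfMz /= mul0rz.
  rewrite raddfD raddfMz raddf_sum /= mul0rz add0r /chi -sumrN; apply: eq_bigr => i _.
  by rewrite raddfMz /= mulNrz.
exists f; apply: bij_of_inj_surj => [u v|[a c]].
  have [w <-] := gam_surj u; have [w' <-] := gam_surj v => /eqP.
  rewrite -subr_eq0 -!raddfB => e; apply/eqP; rewrite -subr_eq0 -raddfB; apply/eqP.
  move: e; case: (w - w') => a b; rewrite f_gam /= => /eqP[-> /eqP].
  by rewrite oppr_eq0 => /eqP/chi_eq0/gam_relations.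
have [v hv] := chi_surj (- c); exists (gam (a, v)).
by rewrite f_gam /= hv opprK.
Qed.

End SurfaceClassGroup.

(** * Recognising the surface *)

Lemma cancel_div (K : fieldType) (a b c d : K) : b != 0 -> b * d * (a * (c / b)) = a * c * d.
Proof. by move=> b0; field. Qed.

Section Recognition.
Variables (F : closedFieldType) (n : nat) (r : 'I_n.+1 -> F).
Local Notation S := {poly {poly F}}.
Local Notation K := {fraction S}.
Local Notation p := (root_poly r).

(** A spanning set and a homomorphism to Frac F[z][x] suffice: in the field, f(x) + g(p / x)
    vanishes only if f and g are opposite constants, so j is injective. Commutativity and
    integrality of A follow. The conclusion is an equality of rings, so that statements about A can
    be rewritten along it. *)
Lemma surface_recognition (A : pzRingType) (j : {rmorphism A -> K})
    (k : {rmorphism F -> A}) (x y z : A) :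
  (forall c, GRing.comm z (k c)) -> (forall c, GRing.comm x (k c)) ->
  (forall c, GRing.comm y (k c)) -> GRing.comm x z -> GRing.comm y z ->
  (forall c, j (k c) = c%:P%:P%:F) -> j z = 'X%:P%:F ->
  j x = 'X%:F -> j y = p%:P%:F / 'X%:F ->
  (forall H : A -> Prop, H 0 -> (forall u v, H u -> H v -> H (u + v)) ->
    (forall c m i, H (k c * z ^+ m * x ^+ i)) -> (forall c m i, H (k c * z ^+ m * y ^+ i)) ->
    forall a, H a) ->
  exists A' : comNzRingType, (A' : pzRingType) = A /\
  exists ix iy : {rmorphism S -> A'}, is_surface r ix iy.
Proof.
(* The structure of A is unpacked so that the richer one built on it extends it by conversion. *)
case: A j k x y z => T cA; set A : pzRingType := GRing.PzRing.Pack cA.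
move=> j k x y z kz kx ky zx zy jk jz jx jy gen.
have nz : (1 : A) != 0.
  apply/eqP => /(congr1 j)/eqP; by rewrite rmorph1 rmorph0 oner_eq0.
pose nzm := GRing.PzSemiRing_isNonZero.Build A nz.
pose A1 : nzRingType := HB.pack (GRing.PzRing.sort A) nzm.
pose j1 : {rmorphism A1 -> K} := j.
pose k1 : {rmorphism F -> A1} := k.
have cz : commr_rmorph k1 (z : A1) by move=> c; exact: kz.
pose h : {rmorphism {poly F} -> A1} := horner_morph cz.
have comm_h u : GRing.comm (u : A1) z -> (forall c, GRing.comm (u : A1) (k c)) -> forall q, GRing.comm (u : A1) (h q).
  move=> uz uk; elim/poly_ind => [|q c IH]; first by rewrite rmorph0; exact: commr0.
  rewrite rmorphD rmorphM /= /h horner_morphX horner_morphC.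
  by apply: commrD => //; apply: commrM.
have cx : commr_rmorph h (x : A1) by exact: comm_h.
have cy : commr_rmorph h (y : A1) by exact: comm_h.
pose ix : {rmorphism S -> A1} := horner_morph cx.
pose iy : {rmorphism S -> A1} := horner_morph cy.
have jh q : j1 (h q) = q%:P%:F.
  elim/poly_ind: q => [|q c IH]; first by rewrite !rmorph0.
  by rewrite !(rmorphD, rmorphM) /= IH /h horner_morphX horner_morphC /j1 /k1 jz jk.
have jix f : j1 (ix f) = f%:F.
  elim/poly_ind: f => [|f q IH]; first by rewrite !rmorph0.
  by rewrite !(rmorphD, rmorphM) /= IH /ix horner_morphX horner_morphC jh /j1 jx.
have jiyX : j1 (iy 'X) = p%:P%:F / 'X%:F by rewrite /iy /= horner_morphX.
have X0 : 'X%:F != 0 :> K by rewrite tofrac_eq0 polyX_eq0.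
(* Multiplying by 'X ^+ N turns g(p / 'X) into a polynomial whose coefficient i is that of g at N -
   i times a power of p. *)
have jiy (N : nat) (g : S) : (size g <= N.+1)%N ->
    'X%:F ^+ N * j1 (iy g) = (\poly_(i < N.+1) (g`_(N - i) * p ^+ (N - i)))%:F.
  move=> sg.
  have eg : j1 (iy g) = \sum_(i < N.+1) (g`_i)%:P%:F * (p%:P%:F / 'X%:F) ^+ i.
    have {1}-> : g = \sum_(i < N.+1) (g`_i)%:P * 'X^i.
      rewrite -{1}(coefK g) poly_def (big_ord_widen N.+1 (fun i => g`_i *: 'X^i)) //.
      rewrite big_mkcond; apply: eq_bigr => i _; rewrite mul_polyC.
      by case: leqP => // gi; rewrite nth_default // scale0r.
    rewrite !rmorph_sum; apply: eq_bigr => i _.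
    by rewrite !(rmorphM, rmorphXn) /= /iy horner_morphX horner_morphC jh /j1 jy.
  rewrite eg mulr_sumr poly_def rmorph_sum (reindex_inj rev_ord_inj) /=.
  apply: eq_bigr => i _; rewrite -mul_polyC !(rmorphM, rmorphXn) /= subSS.
  have iN : (i <= N)%N by rewrite -ltnS.
  have -> : 'X%:F ^+ N = 'X%:F ^+ (N - i) * 'X%:F ^+ i :> K by rewrite -exprD subnK.
  rewrite expr_div_n; apply: cancel_div; exact: expf_neq0.
have inj_aux (f g : S) : j1 (ix f + iy g) = 0 ->
    [/\ forall i, f`_i.+1 = 0, forall i, g`_i.+1 = 0 & f`_0 + g`_0 = 0].
  pose N := size g; have sg : (size g <= N.+1)%N by exact: leqnSn.
  move=> /(congr1 (fun u => 'X%:F ^+ N * u)); rewrite mulr0 rmorphD mulrDr jiy // jix.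
  rewrite -rmorphXn -rmorphM -rmorphD /= => /eqP; rewrite tofrac_eq0 => /eqP/polyP e.
  (* Powers of x from f land in degrees at least N, those from g in degrees at most N; they overlap
     in degree N alone, at the constant terms. *)
  have coefE i : (if (i < N)%N then 0 else f`_(i - N)) +
      (if (i < N.+1)%N then g`_(N - i) * p ^+ (N - i) else 0) = 0.
    by have := e i; rewrite coefD coefXnM coef_poly coef0.
  have p0 : p != 0 := root_poly_neq0 r.
  split=> [i|i|].
  - have := coefE (N + i.+1)%N; rewrite ltnNge leq_addr /= addKn.
    by rewrite ltnS addnS ltnNge leq_addr /= addr0.
  - have [iN|Ni] := ltnP i N; last by rewrite nth_default // (leq_trans Ni).
    have := coefE (N - i.+1)%N; rewrite -subn_gt0 subKn // /= add0r ltnS leq_subr.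
    by move=> /eqP; rewrite mulf_eq0 expf_eq0 (negPf p0) andbF orbF => /eqP.
  - by have := coefE N; rewrite ltnn subnn ltnSn mulr1.
have const_eq (c : {poly F}) : ix c%:P = iy c%:P by rewrite /ix /iy /= !horner_morphC.
have gen_xy a : exists f g, a = ix f + iy g.
  apply: (gen (fun a => exists f g, a = ix f + iy g)).
  - by exists 0, 0; rewrite !rmorph0 addr0.
  - move=> u v [f [g ->]] [f' [g' ->]]; exists (f + f'), (g + g').
    by rewrite !rmorphD /= addrACA.
  - move=> c m i; exists ((c%:P * 'X^m)%:P * 'X^i), 0; rewrite rmorph0 addr0.
    rewrite rmorphM rmorphXn /= /ix horner_morphC horner_morphX rmorphM rmorphXn /=.
    by rewrite /h horner_morphC horner_morphX.
  move=> c m i; exists 0, ((c%:P * 'X^m)%:P * 'X^i); rewrite rmorph0 add0r.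
  rewrite rmorphM rmorphXn /= /iy horner_morphC horner_morphX rmorphM rmorphXn /=.
  by rewrite /h horner_morphC horner_morphX.
have polyC_of (f : S) : (forall i, f`_i.+1 = 0) -> f = (f`_0)%:P :> S.
  by move=> f0; apply/polyP => -[|i]; rewrite coefC //= f0.
have j_inj : injective j1.
  move=> u v /eqP; rewrite -subr_eq0 -rmorphB => /eqP; have [f [g]] := gen_xy (u - v).
  move=> e; rewrite e => /inj_aux[f0 g0 fg0]; apply/eqP; rewrite -subr_eq0 e.
  by rewrite (polyC_of f f0) (polyC_of g g0) const_eq -rmorphD -polyCD fg0 !rmorph0.
have mulC : commutative (@GRing.mul A1).
  by move=> u v; apply: j_inj; rewrite !rmorphM mulrC.
pose cm := GRing.PzRing_hasCommutativeMul.Build A1 mulC.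
pose A2 : comNzRingType := HB.pack (GRing.PzRing.sort A) nzm cm.
pose ix2 : {rmorphism S -> A2} := ix. pose iy2 : {rmorphism S -> A2} := iy.
exists A2; split; first reflexivity.
exists ix2, iy2.
split=> //.
- move=> u v uv; have /eqP : j1 u * j1 v = 0 by rewrite -rmorphM uv rmorph0.
  by rewrite mulf_eq0 => /orP[]/eqP e; [left | right]; apply: j_inj; rewrite e rmorph0.
- apply: j_inj; transitivity (j1 (ix 'X) * j1 (iy 'X)); first exact: rmorphM.
  rewrite jiyX [j1 (ix 'X)]jix; transitivity (p%:P%:F : K); last exact/esym/jix.
  by rewrite mulrC divfK.
split.
  by move=> f g /(congr1 j1); rewrite !jix => /eqP; rewrite tofrac_eq => /eqP.
move=> f g /eqP; rewrite -subr_eq0 -rmorphB => /eqP e.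
have [|_ fg0 fg] := inj_aux 0 (f - g); first by rewrite e rmorph0 addr0 rmorph0.
rewrite coef0 add0r in fg; apply/eqP; rewrite -subr_eq0 (polyC_of (f - g)) ?fg ?polyC0 //.
Qed.

End Recognition.

(** * Matrix representations of the path algebra *)

Section QuotientRing.
Variables (A : pzRingType) (S : set A).

Lemma quotr_pi_mul a b : quotr_pi S (a * b) = quotr_pi S a * quotr_pi S b.
Proof. exact: quotr_piM. Qed.

Lemma quotr_pi_sub a b : quotr_pi S (a - b) = quotr_pi S a - quotr_pi S b.
Proof. exact: quotr_pi_zmod_morphism. Qed.

Lemma quotr_pi_zero : quotr_pi S 0 = 0.
Proof. exact: (raddf0 (quotr_pi S)). Qed.

Lemma quotr_pi_sum (I : Type) (r : seq I) (E : I -> A) :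
  quotr_pi S (\sum_(i <- r) E i) = \sum_(i <- r) quotr_pi S (E i).
Proof. exact: (raddf_sum (quotr_pi S)). Qed.

Lemma quotr_pi_relation a : S a -> quotr_pi S a = 0.
Proof.
move=> Sa; rewrite -quotr_pi_zero; apply/quotr_piP; rewrite subr0.
by apply/asboolP => I [_]; apply.
Qed.

End QuotientRing.

Section PathAlgebra.
Variables (F : comNzRingType) (Q : quiver).
Implicit Types (f g : pathalg F Q) (p q : qpath Q) (a : arrow Q) (i : vertex Q).

Lemma pathalg_scalerAl c f g : c *: (f * g) = (c *: f) * g.
Proof. exact/esym/lin_extZ. Qed.

Lemma pathalg_scalerAr c f g : c *: (f * g) = f * (c *: g).
Proof.
rewrite -[f * g]/(pathalg_mul f g) -[f * (c *: g)]/(pathalg_mul f (c *: g)) /pathalg_mul.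
rewrite {1}/lin_ext scaler_sumr; apply: eq_bigr => p _.
by rewrite lin_extZ !scalerA mulrC.
Qed.

Lemma path_eltM p q : path_elt F p * path_elt F q = path_mul F p q.
Proof.
by rewrite -[LHS]/(pathalg_mul _ _) /pathalg_mul !lin_extU.
Qed.

Lemma trivial_arrow i a :
  trivial_elt F i * arrow_elt F a = if i == src a then arrow_elt F a else 0.
Proof. by rewrite path_eltM path_mul_trivl. Qed.

Lemma arrow_trivial i a :
  arrow_elt F a * trivial_elt F i = if i == tgt a then arrow_elt F a else 0.
Proof. by rewrite path_eltM path_mul_trivr. Qed.

Lemma trivial_trivial i j :
  trivial_elt F i * trivial_elt F j = if i == j then trivial_elt F i else 0.
Proof. by rewrite path_eltM path_mul_trivl; case: eqP => [->|]. Qed.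

Lemma path_elt_rcons p s a : parrows p = rcons s a -> exists q,
  [/\ parrows q = s & path_elt F p = path_elt F q * arrow_elt F a].
Proof.
move=> ps; have := valP p; rewrite -/(parrows p) -/(pstart p) ps -cats1 is_path_cat.
move=> /andP[hs /= /andP[/eqP ha _]].
pose q : qpath Q := exist (fun u : vertex Q * seq (arrow Q) => is_path u.1 u.2) (pstart p, s) hs.
exists q; split=> //; rewrite path_eltM /path_mul.
have [r hr] := @pcat_some Q q (arrow_path a) (esym ha).
have [_ h1 _ h2] := pend_cat hr; rewrite hr /=; congr path_elt; apply: qpath_inj.
  by rewrite h1.
by rewrite h2 ps cats1.
Qed.

Lemma pathalg_expand f : f = \sum_(p <- msupp f) mcoeff p f *: path_elt F p.
Proof. by rewrite -{1}[f]lin_ext_id. Qed.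

End PathAlgebra.

Section Representation.
Variables (F K : comNzRingType) (n : nat) (iota : {rmorphism F -> K}).
Local Notation Qbar := (double_cyclic_quiver n).
Variable wt : arrow Qbar -> K.
Local Notation FQ := (pathalg F Qbar).
Implicit Types (f g : FQ) (p q : qpath Qbar).

(** Paths compose from left to right, so the matrix unit from start to end makes concatenation a
    matrix product, with 0 for paths that do not match. *)
Definition path_mx p : 'M[K]_n.+1 :=
  (\prod_(a <- parrows p) wt a) *: delta_mx (pstart p) (pend p).

Definition rho f : 'M[K]_n.+1 := \sum_(p <- msupp f) iota (mcoeff p f) *: path_mx p.

Lemma rho_w f (d : {fset qpath Qbar}) : (msupp f `<=` d)%fset ->
  rho f = \sum_(p <- d) iota (mcoeff p f) *: path_mx p.
Proof.
move=> le; rewrite /rho (big_fset_incl _ le) // => p _ hp.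
by rewrite mcoeff_outdom // rmorph0 scale0r.
Qed.

Lemma rhoD : {morph rho : f g / f + g}.
Proof.
move=> f g; pose d := (msupp f `|` msupp g)%fset.
rewrite (@rho_w _ d) ?msuppD_le // (@rho_w f d) ?fsubsetUl //.
rewrite (@rho_w g d) ?fsubsetUr // -big_split /=.
by apply: eq_bigr => p _; rewrite mcoeffD rmorphD scalerDl.
Qed.

Lemma rhoZ c f : rho (c *: f) = iota c *: rho f.
Proof.
rewrite (@rho_w _ (msupp f)) ?msuppZ_le // scaler_sumr.
by apply: eq_bigr => p _; rewrite mcoeffZ rmorphM scalerA.
Qed.

Lemma rho0 : rho 0 = 0.
Proof. by rewrite /rho msupp0 big_seq_fset0. Qed.

Lemma rhoB : {morph rho : f g / f - g}.
Proof. by move=> f g; rewrite rhoD -scaleN1r rhoZ rmorphN1 scaleN1r. Qed.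

Lemma rho_sum (I : Type) (r : seq I) (E : I -> FQ) :
  rho (\sum_(i <- r) E i) = \sum_(i <- r) rho (E i).
Proof. exact: (big_morph _ rhoD rho0). Qed.

Lemma rho_path p : rho (path_elt F p) = path_mx p.
Proof.
by rewrite (@rho_w _ [fset p]%fset) ?msuppU_le // big_seq_fset1 mcoeffUU rmorph1 scale1r.
Qed.

Lemma rho_path_mul p q : rho (path_mul F p q) = path_mx p * path_mx q.
Proof.
rewrite /path_mx -mulmxE -scalemxAl -scalemxAr mul_delta_mx_cond /path_mul.
case: (eqVneq (pend p) (pstart q)) => [e|ne]; last first.
  by rewrite pcat_none ?rho0 ?mulr0n ?scaler0 //; exact/eqP.
have [r hr] := pcat_some e; have [_ h1 h2 h3] := pend_cat hr.
by rewrite hr /= rho_path /path_mx h1 h2 h3 big_cat scalerA mulr1n.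
Qed.

Lemma rhoM : {morph rho : f g / f * g}.
Proof.
move=> f g; rewrite -[f * g]/(pathalg_mul f g) /pathalg_mul /lin_ext rho_sum /rho mulr_suml.
apply: eq_bigr => p _; rewrite -/(rho _) rhoZ rho_sum -scalerAl mulr_sumr; congr (_ *: _).
by apply: eq_bigr => q _; rewrite rhoZ rho_path_mul scalerAr.
Qed.

Lemma rho1 : rho 1 = 1.
Proof.
rewrite -[1]/(pathalg_one F Qbar) /pathalg_one rho_sum -[RHS]/(1%:M) mx1_sum_delta.
by apply: eq_bigr => i _; rewrite rho_path /path_mx /= big_nil scale1r.
Qed.

Variable lam : 'I_n.+1 -> F.
Hypothesis rho_relations : forall f, preproj_relations lam f -> rho f = 0.

Lemma rho_preproj : exists rb : {rmorphism preproj lam -> 'M[K]_n.+1},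
  forall f, rb (quotr_pi _ f) = rho f.
Proof.
have kerMl u v : rho v = 0 -> rho (u * v) = 0 by rewrite rhoM => ->; rewrite mulr0.
have kerMr u v : rho v = 0 -> rho (v * u) = 0 by rewrite rhoM => ->; rewrite mul0r.
have ker f : f \in ideal_span (preproj_relations lam) -> rho f = 0.
  move=> /asboolP /(_ [set f | rho f = 0]); apply; split; last exact: rho_relations.
  split; first by split=> [|u v hu hv]; [exact: rho0 | rewrite /mkset rhoB hu hv subrr].
  by move=> u v hv; split; [exact: kerMl | exact: kerMr].
pose rb (q : preproj lam) := rho (repr q).
have rbE f : rb (quotr_pi _ f) = rho f.
  apply/eqP; rewrite -subr_eq0 -rhoB; apply/eqP/ker/quotr_piP.
  exact: quotr_piK.
have rb_zmod : zmod_morphism rb.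
  move=> u v; rewrite -(quotr_piK u) -(quotr_piK v).
  by rewrite -(raddfB (quotr_pi _)) /= !rbE rhoB.
have rb_mon : monoid_morphism rb.
  split=> [|u v]; first by rewrite -[1]/(quotr_pi (preproj_relations lam) 1) rbE rho1.
  rewrite -(quotr_piK u) -(quotr_piK v).
  by rewrite -(rmorphM (quotr_pi _)) /= !rbE rhoM.
pose rba := GRing.isZmodMorphism.Build _ _ rb rb_zmod.
pose rbm := GRing.isMonoidMorphism.Build _ _ rb rb_mon.
pose rbr : {rmorphism preproj lam -> 'M[K]_n.+1} := HB.pack rb rba rbm.
by exists rbr.
Qed.

End Representation.

(** * The corner of the deformed preprojective algebra *)

Section CyclicOrdinals.
Variable n : nat.

Lemma iter_ordS m (i : 'I_n.+1) : iter m (@ordS n.+1) i = ((i + m) %% n.+1)%N :> nat.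
Proof.
elim: m => [|m IH]; first by rewrite addn0 modn_small.
by rewrite iterS /= IH -addn1 modnDml addn1 addnS.
Qed.

Lemma iter_ord_predK m (i : 'I_n.+1) : iter m (@ordS n.+1) (iter m (@ord_pred n.+1) i) = i.
Proof.
elim: m i => //= m IH i; rewrite -iterS iterSr.
by rewrite ord_predK IH.
Qed.

Lemma iter_ord_pred_period (i : 'I_n.+1) : iter n.+1 (@ord_pred n.+1) i = i.
Proof.
have per (k : 'I_n.+1) : iter n.+1 (@ordS n.+1) k = k.
  by apply: val_inj; rewrite [LHS]iter_ordS modnDr modn_small.
by rewrite -[LHS]per iter_ord_predK.
Qed.

Lemma iter_ord_pred0 m : (m <= n)%N -> iter m.+1 (@ord_pred n.+1) ord0 = (n - m)%N :> nat.
Proof.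
have vp (k : 'I_n.+1) : ord_pred k = ((k + n.+1).-1 %% n.+1)%N :> nat by [].
elim: m => [_|m IH mn]; first by rewrite vp add0n modn_small ?subn0.
rewrite iterS vp IH 1?ltnW //.
have -> : (n - m + n.+1).-1 = ((n - m.+1) + n.+1)%N by lia.
by rewrite modnDr modn_small //; lia.
Qed.

(** At i = n the index wraps around to 0, and nu n is the full sum, which vanishes. *)
Lemma nuS (F : comNzRingType) (lam : 'I_n.+1 -> F) i : \sum_k lam k = 0 ->
  nu lam (ordS i) = nu lam i + lam (ordS i).
Proof.
move=> s0; have [iN|] := ltnP i n.
  have vS : ordS i = i.+1 :> nat by rewrite /= modn_small.
  rewrite /nu (bigD1 (ordS i)) //= addrC; congr (_ + _); apply: eq_bigl => k.
  by rewrite -val_eqE /= modn_small // andbC -ltn_neqAle ltnS.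
move=> ni; have iN : i = n :> nat by apply/eqP; rewrite eqn_leq ni -ltnS ltn_ord.
have S0 : ordS i = ord0 by apply: val_inj; rewrite /= iN modnn.
have -> : nu lam i = 0.
  by rewrite -[RHS]s0; apply: eq_bigl => k; rewrite iN -ltnS ltn_ord.
by rewrite add0r S0 /nu (big_pred1 ord0) // => k; rewrite leqn0.
Qed.

End CyclicOrdinals.

Section Corner.
Variables (A : pzRingType) (e : A) (ee : e * e = e).

Lemma corner_valP (u : corner ee) : e * val u = val u /\ val u * e = val u.
Proof. by apply/in_cornerP; [exact: ee | exact: valP u]. Qed.

(** The factor e accounts for m = 0, since the unit of the corner is e. *)
Lemma corner_val_exp (u : corner ee) m : val (u ^+ m) = e * val u ^+ m.
Proof.
have [eu ue] := corner_valP u.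
elim: m => [|m IH]; first by rewrite mulr1.
by rewrite !exprS -[LHS]/(val u * val (u ^+ m)) IH !mulrA eu ue.
Qed.

(** Since e goes to a diagonal matrix unit, the corner lands in the matrices concentrated at (0, 0),
    a copy of K. *)
Lemma corner_entry_rmorphism (K : comNzRingType) n (rb : {rmorphism A -> 'M[K]_n.+1}) :
  rb e = delta_mx 0 0 ->
  exists j : {rmorphism corner ee -> K}, forall u, j u = rb (val u) 0 0.
Proof.
move=> rbe; pose j (u : corner ee) : K := rb (val u) 0 0.
have j_zmod : zmod_morphism j.
  by move=> u v; rewrite /j -[val (u - v)]/(val u - val v) rmorphB !mxE.
have j_mon : monoid_morphism j.
  have v1 : val (1 : corner ee) = e by [].
  split=> [|u v]; first by rewrite /j v1 rbe mxE eqxx.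
  rewrite /j -[val (u * v)]/(val u * val v) rmorphM -mulmxE mxE (bigD1 0) //= big1 ?addr0 //.
  move=> k k0; have [ev _] := corner_valP v.
  have -> : rb (val v) = delta_mx 0 0 *m rb (val v) by rewrite mulmxE -rbe -rmorphM ev.
  rewrite [X in _ * X]mxE big1 ?mulr0 // => l _.
  by rewrite mxE (negPf k0) mul0r.
pose ja := GRing.isZmodMorphism.Build _ _ j j_zmod.
pose jm := GRing.isMonoidMorphism.Build _ _ j j_mon.
pose jr : {rmorphism corner ee -> K} := HB.pack j ja jm.
by exists jr.
Qed.

End Corner.

(** * Normal forms for the elements of e_0 Pi *)

Section NormalForms.
Variables (F : closedFieldType) (n : nat) (lam : 'I_n.+1 -> F).
Hypothesis lam_sum : \sum_i lam i = 0.
Variables (Pi : pzRingType) (E_ C_ D_ : 'I_n.+1 -> Pi) (kap : {rmorphism F -> Pi}).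
Local Notation Sn := (@ordS n.+1).
Local Notation pn := (@ord_pred n.+1).
Hypotheses (EE : forall i k, E_ i * E_ k = if i == k then E_ i else 0)
  (EC : forall i k, E_ i * C_ k = if i == k then C_ k else 0)
  (CE : forall i k, C_ k * E_ i = if i == Sn k then C_ k else 0)
  (ED : forall i k, E_ i * D_ k = if i == Sn k then D_ k else 0)
  (DE : forall i k, D_ k * E_ i = if i == k then D_ k else 0)
  (kapC : forall c u, kap c * u = u * kap c)
  (preproj_rel : forall i, D_ (pn i) * C_ (pn i) - C_ i * D_ i = kap (lam i) * E_ i).

(* The local forms of the central element z = sum_i (c_i d_i + nu_i e_i). *)
Definition zi i : Pi := C_ i * D_ i + kap (nu lam i) * E_ i.

Lemma CD_zi i : C_ i * D_ i = zi i - kap (nu lam i) * E_ i.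
Proof. by rewrite addrK. Qed.

(** The relation at i+1 adds lambda_(i+1), which cancels the difference between nu_(i+1) and nu_i.
    So d_i c_i and c_i d_i are z minus the same constant, and z commutes with the arrows. *)
Lemma DC_zi i : D_ i * C_ i = zi (Sn i) - kap (nu lam i) * E_ (Sn i).
Proof.
have := preproj_rel (Sn i); rewrite ordSK => /eqP; rewrite subr_eq => /eqP ->.
by rewrite CD_zi nuS // rmorphD mulrDl addrC opprD addrA subrK.
Qed.

Lemma E_C i : E_ i * C_ i = C_ i. Proof. by rewrite EC eqxx. Qed.
Lemma C_E i : C_ i * E_ (Sn i) = C_ i. Proof. by rewrite CE eqxx. Qed.
Lemma E_D i : E_ (Sn i) * D_ i = D_ i. Proof. by rewrite ED eqxx. Qed.
Lemma D_E i : D_ i * E_ i = D_ i. Proof. by rewrite DE eqxx. Qed.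

Lemma zi_C i : zi i * C_ i = C_ i * zi (Sn i).
Proof.
rewrite /zi mulrDl -mulrA DC_zi mulrBr -!mulrA E_C.
by rewrite [C_ i * (kap _ * _)]mulrA -kapC -[kap _ * C_ i * _]mulrA C_E subrK.
Qed.

Lemma D_zi i : D_ i * zi i = zi (Sn i) * D_ i.
Proof.
rewrite {1}/zi mulrDr mulrA DC_zi mulrBl -[kap _ * E_ _ * D_ i]mulrA E_D.
by rewrite [D_ i * _]mulrA -kapC -mulrA D_E subrK.
Qed.

Lemma zi_E i : zi i * E_ i = zi i.
Proof. by rewrite /zi mulrDl -!mulrA D_E EE eqxx. Qed.

Lemma E_zi i : E_ i * zi i = zi i.
Proof. by rewrite /zi mulrDr mulrA E_C [E_ i * _]mulrA -kapC -mulrA EE eqxx. Qed.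

Definition cvertex k : 'I_n.+1 := iter k Sn ord0.
Definition dvertex k : 'I_n.+1 := iter k pn ord0.

Fixpoint CC k : Pi := if k is k'.+1 then CC k' * C_ (cvertex k') else E_ ord0.
(** The arrow d_i runs from i+1 to i and so is indexed by its target: the last factor carries
    dvertex k, not dvertex k'. *)
Fixpoint DD k : Pi := if k is k'.+1 then DD k' * D_ (dvertex k) else E_ ord0.

Local Notation Z := (zi ord0).

Lemma Sn_dvertex k : Sn (dvertex k.+1) = dvertex k.
Proof. exact: ord_predK. Qed.

Lemma CC_E k i : CC k * E_ i = if i == cvertex k then CC k else 0.
Proof.
case: k => [|k] /=; last by rewrite -mulrA CE; case: eqP; rewrite ?mulr0.
by rewrite EE eq_sym.
Qed.

Lemma DD_E k i : DD k * E_ i = if i == dvertex k then DD k else 0.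
Proof.
case: k => [|k] /=; last by rewrite -mulrA DE; case: eqP; rewrite ?mulr0.
by rewrite EE eq_sym.
Qed.

Lemma E_CC k : E_ ord0 * CC k = CC k.
Proof. by elim: k => [|k IH] /=; rewrite ?EE ?mulrA ?IH. Qed.

Lemma E_DD k : E_ ord0 * DD k = DD k.
Proof. by elim: k => [|k IH] /=; rewrite ?EE ?mulrA ?IH. Qed.

Lemma zi_CC k : Z * CC k = CC k * zi (cvertex k).
Proof.
elim: k => [|k IH] /=; first by rewrite zi_E E_zi.
by rewrite mulrA IH -!mulrA zi_C.
Qed.

Lemma zi_DD k : Z * DD k = DD k * zi (dvertex k).
Proof.
elim: k => [|k IH] /=; first by rewrite zi_E E_zi.
by rewrite mulrA IH -!mulrA -/(dvertex k.+1) D_zi Sn_dvertex.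
Qed.

(** Stability under right multiplication by every arrow, shown below, makes this span exhaust the
    paths that start at vertex 0. *)
Inductive normal : Pi -> Prop :=
| normal0 : normal 0
| normalD u v : normal u -> normal v -> normal (u + v)
| normalC c m k : normal (kap c * Z ^+ m * CC k)
| normalDD c m k : normal (kap c * Z ^+ m * DD k).

Lemma normal_left c m v : normal v -> normal (kap c * Z ^+ m * v).
Proof.
have comm c' m' : kap c * Z ^+ m * (kap c' * Z ^+ m') = kap (c * c') * Z ^+ (m + m').
  by rewrite mulrA -[kap c * _ * kap c']mulrA -kapC mulrA -rmorphM /= -mulrA -exprD.
elim=> [|u w _ hu _ hw|c' m' k|c' m' k].
- by rewrite mulr0; exact: normal0.
- by rewrite mulrDr; exact: normalD.
- by rewrite mulrA comm; exact: normalC.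
- by rewrite mulrA comm; exact: normalDD.
Qed.

Lemma normal_kap c v : normal v -> normal (kap c * v).
Proof. by move=> /(@normal_left c 0); rewrite mulr1. Qed.

Lemma normal_Z v : normal v -> normal (Z * v).
Proof. by move=> /(@normal_left 1 1); rewrite rmorph1 mul1r. Qed.

Lemma normal_CC k : normal (CC k).
Proof. by have := normalC 1 0 k; rewrite rmorph1 !mul1r. Qed.

Lemma normal_DD k : normal (DD k).
Proof. by have := normalDD 1 0 k; rewrite rmorph1 !mul1r. Qed.

Lemma normalB u v : normal u -> normal v -> normal (u - v).
Proof.
move=> hu hv; apply: normalD => //.
by rewrite -mulN1r -(rmorph1 kap) -rmorphN; exact: normal_kap.
Qed.

Lemma normal_right w : (forall k, normal (CC k * w)) -> (forall k, normal (DD k * w)) ->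
  forall v, normal v -> normal (v * w).
Proof.
move=> hC hD v; elim=> [|u v' _ hu _ hv|c m k|c m k].
- by rewrite mul0r; exact: normal0.
- by rewrite mulrDl; exact: normalD.
- by rewrite -mulrA; exact: normal_left.
- by rewrite -mulrA; exact: normal_left.
Qed.

Lemma normal_E i v : normal v -> normal (v * E_ i).
Proof.
apply: normal_right => k; rewrite ?CC_E ?DD_E; case: ifP => _.
- exact: normal_CC.
- exact: normal0.
- exact: normal_DD.
- exact: normal0.
Qed.

(** A c-path is either extended or killed. On a nonempty d-path c_i cancels the last arrow, leaving
    z - nu_i, and z moves to the front by [zi_DD]. *)
Lemma normal_C i v : normal v -> normal (v * C_ i).
Proof.
have CCC k : normal (CC k * C_ i).
  rewrite -[C_ i]E_C mulrA CC_E; case: eqP => [->|_]; last by rewrite mul0r; exact: normal0.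
  exact: (normal_CC k.+1).
apply: normal_right => // -[|k]; first exact: (CCC 0%N).
rewrite -[C_ i]E_C mulrA DD_E; case: eqP => [->|_]; last by rewrite mul0r; exact: normal0.
rewrite /= -/(dvertex k.+1) -mulrA DC_zi Sn_dvertex mulrBr -zi_DD.
apply: normalB; first exact/normal_Z/normal_DD.
by rewrite mulrA -kapC -mulrA DD_E eqxx; exact/normal_kap/normal_DD.
Qed.

Lemma normal_D i v : normal v -> normal (v * D_ i).
Proof.
have DDD k : normal (DD k * D_ i).
  rewrite -[D_ i]E_D mulrA DD_E; case: eqP => [e|_]; last by rewrite mul0r; exact: normal0.
  have -> : i = dvertex k.+1 by rewrite -[LHS](@ordSK n.+1) e.
  exact: (normal_DD k.+1).
apply: normal_right => // -[|k]; first exact: (DDD 0%N).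
rewrite -[D_ i]E_D mulrA CC_E; case: eqP => [e|_]; last by rewrite mul0r; exact: normal0.
have -> : i = cvertex k by apply: (can_inj (@ordSK n.+1)); rewrite e.
rewrite /= -mulrA CD_zi mulrBr -zi_CC.
apply: normalB; first exact/normal_Z/normal_CC.
by rewrite mulrA -kapC -mulrA CC_E eqxx; exact/normal_kap/normal_CC.
Qed.

Lemma cvertexE k : cvertex k = (k %% n.+1)%N :> nat.
Proof. by rewrite /cvertex iter_ordS. Qed.

Lemma cvertex_period k : cvertex (n.+1 + k) = cvertex k.
Proof. by apply: val_inj; rewrite [LHS]cvertexE [RHS]cvertexE modnDl. Qed.

Lemma dvertex_period k : dvertex (n.+1 + k) = dvertex k.
Proof. by rewrite /dvertex iterD iter_ord_pred_period. Qed.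

Lemma cvertex_n : cvertex n.+1 = ord0.
Proof. by have := cvertex_period 0; rewrite addn0. Qed.

Lemma dvertex_n : dvertex n.+1 = ord0.
Proof. by have := dvertex_period 0; rewrite addn0. Qed.

Lemma cvertex_eq0 k : cvertex k = ord0 -> k = (n.+1 * (k %/ n.+1))%N.
Proof.
by move=> /(congr1 val); rewrite /= cvertexE => k0; rewrite {1}(divn_eq k n.+1) k0 addn0 mulnC.
Qed.

Lemma dvertex_eq0 k : dvertex k = ord0 -> k = (n.+1 * (k %/ n.+1))%N.
Proof.
move=> s0; apply: cvertex_eq0; rewrite /cvertex -[X in iter _ _ X]s0; exact: iter_ord_predK.
Qed.

Lemma CC_period k : CC (n.+1 + k) = CC n.+1 * CC k.
Proof.
elim: k => [|k IH]; last by rewrite addnS -[LHS]/(CC (n.+1 + k) * C_ (cvertex (n.+1 + k))) IH cvertex_period -mulrA.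
by rewrite addn0 [CC 0]/= CC_E cvertex_n eqxx.
Qed.

Lemma DD_period k : DD (n.+1 + k) = DD n.+1 * DD k.
Proof.
elim: k => [|k IH]; last first.
  rewrite addnS -[LHS]/(DD (n.+1 + k) * D_ (dvertex (n.+1 + k).+1)) IH -addnS dvertex_period.
  by rewrite -mulrA.
by rewrite addn0 [DD 0]/= DD_E dvertex_n eqxx.
Qed.

Local Notation e := (E_ ord0).
Local Notation x := (CC n.+1).
Local Notation y := (DD n.+1).

Lemma x_e : x * e = x.
Proof. by rewrite CC_E cvertex_n eqxx. Qed.

Lemma y_e : y * e = y.
Proof. by rewrite DD_E dvertex_n eqxx. Qed.

Lemma CC_mul i : CC (n.+1 * i) = e * x ^+ i.
Proof.
elim: i => [|i IH]; first by rewrite muln0 mulr1.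
by rewrite mulnS CC_period IH exprS !mulrA x_e E_CC.
Qed.

Lemma DD_mul i : DD (n.+1 * i) = e * y ^+ i.
Proof.
elim: i => [|i IH]; first by rewrite muln0 mulr1.
by rewrite mulnS DD_period IH exprS !mulrA y_e E_DD.
Qed.

(** Right multiplication by e keeps the closed paths, whose lengths are multiples of n+1, that is,
    the powers of the two full turns x and y. *)
Lemma normal_corner (H : Pi -> Prop) : H 0 -> (forall u v, H u -> H v -> H (u + v)) ->
  (forall c m i, H (kap c * Z ^+ m * (e * x ^+ i) * e)) ->
  (forall c m i, H (kap c * Z ^+ m * (e * y ^+ i) * e)) ->
  forall v, normal v -> H (v * e).
Proof.
move=> H0 HD Hx Hy v; elim=> [|u w _ hu _ hw|c m k|c m k].
- by rewrite mul0r.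
- by rewrite mulrDl; exact: HD.
- rewrite -mulrA CC_E; case: eqP => [/esym/cvertex_eq0 ->|_]; last by rewrite mulr0.
  have := Hx c m (k %/ n.+1)%N; rewrite -mulrA -CC_mul CC_E.
  by rewrite -[(n.+1 * _)%N]addn0; case: eqP => // -[]; apply: val_inj; rewrite /= cvertexE addn0 modnMr.
- rewrite -mulrA DD_E; case: eqP => [/esym/dvertex_eq0 ->|_]; last by rewrite mulr0.
  have := Hy c m (k %/ n.+1)%N; rewrite -mulrA -DD_mul DD_E.
  by case: eqP => // -[]; elim: (k %/ n.+1)%N => [|i IH]; rewrite ?muln0 // mulnS dvertex_period.
Qed.

Local Notation S := {poly {poly F}}.
Local Notation K := {fraction S}.
Variables (ee : e * e = e) (rb : {rmorphism Pi -> 'M[K]_n.+1}).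

(* The weights are chosen so that c_0 ... c_n acts as x and each c_i d_i as z - nu_i. *)
Definition wc (i : 'I_n.+1) : K := if i == ord0 then 'X%:F else 1.
Definition wd (i : 'I_n.+1) : K := ('X - (nu lam i)%:P)%:P%:F / wc i.

Hypotheses (normal_e : forall u, normal (e * u))
  (rb_e : rb e = delta_mx 0 0) (rb_kap : forall c, rb (kap c) = (c%:P%:P%:F)%:M)
  (rb_C : forall i, rb (C_ i) = wc i *: delta_mx i (Sn i))
  (rb_D : forall i, rb (D_ i) = wd i *: delta_mx (Sn i) i).

Lemma wc_neq0 i : wc i != 0.
Proof. by rewrite /wc; case: ifP => _; rewrite ?oner_neq0 // tofrac_eq0 polyX_eq0. Qed.

Lemma rb_CC k : rb (CC k) = (\prod_(i < k) wc (cvertex i)) *: delta_mx 0 (cvertex k).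
Proof.
elim: k => [|k IH] /=; first by rewrite rb_e big_ord0 scale1r.
rewrite rmorphM IH rb_C big_ord_recr /= -mulmxE -scalemxAl -scalemxAr mul_delta_mx.
by rewrite scalerA.
Qed.

Lemma rb_DD k : rb (DD k) = (\prod_(i < k) wd (dvertex i.+1)) *: delta_mx 0 (dvertex k).
Proof.
elim: k => [|k IH]; first by rewrite /= rb_e big_ord0 scale1r.
rewrite -[DD k.+1]/(DD k * D_ (dvertex k.+1)) rmorphM IH rb_D Sn_dvertex big_ord_recr /=.
by rewrite -mulmxE -scalemxAl -scalemxAr mul_delta_mx scalerA.
Qed.

Lemma prod_wc : \prod_i wc i = 'X%:F.
Proof.
rewrite (bigD1 ord0) //= /wc eqxx big1 ?mulr1 // => i /negPf -> //.
Qed.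

(** The (0, 0) entry of rb sends z to the variable of F[z], the full c-turn to 'X and the full
    d-turn to [root_poly] / 'X; the normal forms supply the spanning hypothesis of
    [surface_recognition]. *)
Lemma corner_surface : exists A' : comNzRingType, (A' : pzRingType) = corner ee /\
  exists ix iy : {rmorphism S -> A'}, is_surface (nu lam) ix iy.
Proof.
have [j jE] := corner_entry_rmorphism ee rb_e.
have mk u : e * u = u -> u * e = u -> exists w : corner ee, val w = u.
  move=> h1 h2; have hu : u \in in_corner e by apply/in_cornerP.
  by exists (exist _ u hu).
have [zO ez] := mk _ (E_zi ord0) (zi_E ord0).
have [xO ex] := mk _ (E_CC n.+1) x_e.
have [yO ey] := mk _ (E_DD n.+1) y_e.
have k_in c : kap c * e \in in_corner e.
  by apply/(in_cornerP ee); rewrite mulrA -kapC -mulrA ee.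
pose kO0 c : corner ee := exist (fun u => u \in in_corner e) _ (k_in c).
have kO_zmod : zmod_morphism kO0.
  by move=> c d; apply: val_inj; rewrite /= rmorphB mulrBl.
have kO_mon : monoid_morphism kO0.
  split=> [|c d]; apply: val_inj; rewrite /= ?rmorph1 ?mul1r //.
  by rewrite rmorphM -[RHS]mulrA [e * (_ * _)]mulrA -(kapC d e) -[kap d * e * e]mulrA ee mulrA.
pose kOa := GRing.isZmodMorphism.Build _ _ kO0 kO_zmod.
pose kOm := GRing.isMonoidMorphism.Build _ _ kO0 kO_mon.
pose kO : {rmorphism F -> corner ee} := HB.pack kO0 kOa kOm.
have valM (u v : corner ee) : val (u * v) = val u * val v by [].
have vk c : val (kO c) = kap c * e by [].
have kO_comm u c : GRing.comm u (kO c).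
  have [eu ue] := corner_valP u; apply: val_inj.
  by rewrite !valM vk mulrA -kapC -!mulrA ue eu.
apply: (@surface_recognition F n (nu lam) (corner ee) j kO xO yO zO).
- by move=> c; exact: kO_comm.
- by move=> c; exact: kO_comm.
- by move=> c; exact: kO_comm.
- apply: val_inj; rewrite !valM ex ez zi_CC.
  by rewrite cvertex_n.
- apply: val_inj; rewrite !valM ey ez zi_DD.
  by rewrite dvertex_n.
- by move=> c; rewrite jE vk rmorphM rb_kap rb_e -mulmxE mul_scalar_mx !mxE mulr1.
- rewrite jE ez /zi rmorphD !rmorphM rb_C rb_D rb_kap rb_e -!mulmxE -scalemxAl -scalemxAr.
  rewrite mul_delta_mx mul_scalar_mx scalerA !mxE !mulr1 /wd mulrCA mulfV ?wc_neq0 // mulr1.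
  by rewrite -rmorphD -polyCD subrK.
- rewrite jE ex rb_CC cvertex_n !mxE mulr1 -prod_wc.
  by apply: eq_bigr => i _; congr wc; apply: val_inj; rewrite /= cvertexE modn_small.
- rewrite jE ey rb_DD dvertex_n !mxE mulr1.
  (* The d-turn visits the vertices in decreasing order: dvertex i.+1 is n - i. *)
  have -> : \prod_(i < n.+1) wd (dvertex i.+1) = \prod_i wd i.
    rewrite [RHS](reindex_inj rev_ord_inj); apply: eq_bigr => i _; congr wd; apply: val_inj.
    by rewrite [LHS]iter_ord_pred0 ?subSS // -ltnS.
  rewrite prodf_div prod_wc /root_poly !rmorph_prod; congr (_ / _).
- move=> H H0 HD Hx Hy a.
  have Ze m : e * Z ^+ m = Z ^+ m * e.
    by apply: commrX; rewrite /GRing.comm E_zi zi_E.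
  have gen c m i (w : corner ee) : kap c * Z ^+ m * (e * val w ^+ i) * e = val (kO c * zO ^+ m * w ^+ i).
    have [ew we] := corner_valP (w ^+ i).
    rewrite !valM vk -corner_val_exp -[LHS]mulrA we -{1}ew (corner_val_exp zO m) ez.
    by rewrite [kap c * e * _]mulrA -[kap c * e * e]mulrA ee -[kap c * e * _]mulrA Ze !mulrA.
  have [ea ae] := corner_valP a.
  suff [w [Hw ew]] : exists w : corner ee, H w /\ val w = e * val a * e.
    by have <- : w = a by apply: val_inj; rewrite ew ea ae.
  apply: (normal_corner (H := fun u => exists w : corner ee, H w /\ val w = u)) => //.
  - by exists 0.
  - by move=> _ _ [u [Hu <-]] [v [Hv <-]]; exists (u + v); split=> //; exact: HD.
  - by move=> c m i; exists (kO c * zO ^+ m * xO ^+ i); rewrite -gen ex.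
  - by move=> c m i; exists (kO c * zO ^+ m * yO ^+ i); rewrite -gen ey.
Qed.

End NormalForms.

(** * The deformed preprojective algebra as an instance *)

Section Preprojective.
Variables (F : closedFieldType) (n : nat) (lam : 'I_n.+1 -> F).
Local Notation Qbar := (double_cyclic_quiver n).
Local Notation FQ := (pathalg F Qbar).
Local Notation Pi := (quotr (preproj_relations lam)).
Local Notation pr := (quotr_pi (preproj_relations lam)).
Local Notation Sn := (@ordS n.+1).
Local Notation pn := (@ord_pred n.+1).

Definition E_ i : Pi := pr (e_ F i).
Definition C_ i : Pi := pr (c_ F i).
Definition D_ i : Pi := pr (d_ F i).

Lemma EE i k : E_ i * E_ k = if i == k then E_ i else 0.
Proof.
rewrite -quotr_pi_mul (trivial_trivial F (Q := Qbar)).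
by case: (i == k); rewrite ?quotr_pi_zero.
Qed.

Lemma EC i k : E_ i * C_ k = if i == k then C_ k else 0.
Proof.
rewrite -quotr_pi_mul (trivial_arrow F (Q := Qbar)) /=.
by case: (i == k); rewrite ?quotr_pi_zero.
Qed.

Lemma CE i k : C_ k * E_ i = if i == Sn k then C_ k else 0.
Proof.
rewrite -quotr_pi_mul (arrow_trivial F (Q := Qbar)) /=.
by case: (i == _); rewrite ?quotr_pi_zero.
Qed.

Lemma ED i k : E_ i * D_ k = if i == Sn k then D_ k else 0.
Proof.
rewrite -quotr_pi_mul (trivial_arrow F (Q := Qbar)) /=.
by case: (i == _); rewrite ?quotr_pi_zero.
Qed.

Lemma DE i k : D_ k * E_ i = if i == k then D_ k else 0.
Proof.
rewrite -quotr_pi_mul (arrow_trivial F (Q := Qbar)) /=.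
by case: (i == _); rewrite ?quotr_pi_zero.
Qed.

Definition kap (c : F) : Pi := pr (c *: (1 : FQ)).

Lemma kap_pr c f : kap c * pr f = pr (c *: f).
Proof. by rewrite /kap -quotr_pi_mul -pathalg_scalerAl mul1r. Qed.

Lemma pr_kap c f : pr f * kap c = pr (c *: f).
Proof. by rewrite /kap -quotr_pi_mul -pathalg_scalerAr mulr1. Qed.

Lemma kapC c u : kap c * u = u * kap c.
Proof. by rewrite -(quotr_piK u) kap_pr pr_kap. Qed.

Lemma kap_zmod_morphism : zmod_morphism kap.
Proof. by move=> c d; rewrite /kap scalerBl quotr_pi_sub. Qed.

Lemma kap_monoid_morphism : monoid_morphism kap.
Proof.
split=> [|c d]; first by rewrite /kap scale1r (rmorph1 pr).
by rewrite {1}/kap -scalerA -kap_pr.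
Qed.

HB.instance Definition _ := GRing.isZmodMorphism.Build F Pi kap kap_zmod_morphism.
HB.instance Definition _ := GRing.isMonoidMorphism.Build F Pi kap kap_monoid_morphism.

Lemma preproj_relation i : D_ (pn i) * C_ (pn i) - C_ i * D_ i = kap (lam i) * E_ i.
Proof.
pose dc : FQ := d_ F (pn i) * c_ F (pn i); pose cd : FQ := c_ F i * d_ F i.
have e1 : pr (dc - cd - lam i *: e_ F i) = pr dc - pr cd - pr (lam i *: e_ F i).
  by rewrite (quotr_pi_sub _ (dc - cd)) (quotr_pi_sub _ dc).
have e2 : pr (dc - cd - lam i *: e_ F i) = 0 by apply: quotr_pi_relation; exists i.
have {}e1 : pr dc - pr cd = kap (lam i) * E_ i.
  by apply/eqP; rewrite -subr_eq0 /E_ kap_pr -e1 e2.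
apply: etrans e1; apply: (congr2 (fun u v => u - v)); exact/esym/quotr_pi_mul.
Qed.

Hypothesis lam_sum : \sum_i lam i = 0.
Local Notation kapm := (kap : {rmorphism F -> Pi}).
Local Notation normal := (normal lam E_ C_ D_ kapm).

(** Induction removes arrows from the right end of p, because normal forms are stable under right
    multiplication. *)
Lemma normal_path v p : normal v -> normal (v * pr (path_elt F p)).
Proof.
move: {2}(parrows p) (erefl (parrows p)) => l; elim/last_ind: l v p => [|l a IH] v p el hv.
  have -> : p = @trivial_path Qbar (pstart p) by apply: qpath_inj.
  exact: (normal_E (kap := kapm) EE CE DE kapC (pstart p) hv).
have [p' [el' ->]] := path_elt_rcons F el.
rewrite quotr_pi_mul mulrA; have := IH v p' el' hv; move: (v * _) => w hw.
case: a {el} => i.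
  exact: (normal_C (kap := kapm) lam_sum EE EC CE ED DE kapC preproj_relation i hw).
exact: (normal_D (kap := kapm) lam_sum EE EC CE ED DE kapC preproj_relation i hw).
Qed.

Lemma normal_pr f : normal (E_ ord0 * pr f).
Proof.
rewrite [f]pathalg_expand quotr_pi_sum mulr_sumr; elim/big_rec: _ => [|p v _ hv].
  exact: normal0.
apply: normalD => //; rewrite -kap_pr mulrA -kapC -mulrA.
apply: (normal_kap (kap := kapm) kapC); apply: normal_path.
exact: (normal_CC lam E_ C_ D_ kapm 0).
Qed.

Local Notation S := {poly {poly F}}.
Local Notation K := {fraction S}.
Local Notation iota := (@tofrac S \o polyC \o polyC : {rmorphism F -> K}).

Definition arrow_weight (a : arrow Qbar) : K :=
  match a with inl i => wc F i | inr i => wd lam i end.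

Local Notation rh := (rho iota arrow_weight).

Lemma rho_e i : rh (e_ F i) = delta_mx i i.
Proof. by rewrite rho_path /path_mx big_nil scale1r. Qed.

Lemma rho_c i : rh (c_ F i) = wc F i *: delta_mx i (Sn i).
Proof. by rewrite rho_path /path_mx big_seq1. Qed.

Lemma rho_d i : rh (d_ F i) = wd lam i *: delta_mx (Sn i) i.
Proof. by rewrite rho_path /path_mx big_seq1. Qed.

(** At vertex i the loops d_(i-1) c_(i-1) and c_i d_i act as z - nu_(i-1) and z - nu_i, which differ
    by lambda_i. *)
Lemma rho_relations f : preproj_relations lam f -> rh f = 0.
Proof.
move=> [i ->].
(* Rewriting under rho would try to unify distinct arrows by unfolding the path algebra. *)
pose dc : FQ := d_ F (pn i) * c_ F (pn i); pose cd : FQ := c_ F i * d_ F i.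
have e1 : rh dc = ('X - (nu lam (pn i))%:P)%:P%:F *: delta_mx i i.
  apply: etrans (rhoM iota arrow_weight _ _) _.
  apply: etrans (congr2 *%R (rho_d (pn i)) (rho_c (pn i))) _.
  rewrite -mulmxE -scalemxAl -scalemxAr mul_delta_mx scalerA ord_predK.
  by rewrite /wd divfK // wc_neq0.
have e2 : rh cd = ('X - (nu lam i)%:P)%:P%:F *: delta_mx i i.
  apply: etrans (rhoM iota arrow_weight _ _) _.
  apply: etrans (congr2 *%R (rho_c i) (rho_d i)) _.
  rewrite -mulmxE -scalemxAl -scalemxAr mul_delta_mx scalerA.
  by rewrite mulrC /wd divfK // wc_neq0.
have e3 : rh (lam i *: e_ F i) = (lam i)%:P%:P%:F *: delta_mx i i.
  by apply: etrans (rhoZ iota arrow_weight _ _) _; rewrite rho_e.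
apply: etrans (rhoB iota arrow_weight (dc - cd) _) _.
apply: etrans (congr2 (fun u v => u - v) (etrans (rhoB iota arrow_weight dc cd)
  (congr2 (fun u v => u - v) e1 e2)) e3) _.
rewrite -!scalerBl -!tofracB -!polyCB.
have -> : nu lam i = nu lam (pn i) + lam i by rewrite -{1 3}(@ord_predK n.+1 i) nuS.
rewrite (_ : _ - _ - _ = 0) ?polyC0 ?tofrac0 ?scale0r //.
by rewrite polyCD; ring.
Qed.

Theorem Olambda_surface : exists A : comNzRingType, (A : pzRingType) = Olambda lam /\
  exists ix iy : {rmorphism S -> A}, is_surface (nu lam) ix iy.
Proof.
have [rb rbE] := rho_preproj rho_relations.
have ne u : normal (E_ ord0 * u) by rewrite -(quotr_piK u); exact: normal_pr.
have rb_e : rb (E_ ord0) = delta_mx 0 0 by rewrite rbE rho_e.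
have rb_kap c : rb (kap c) = (c%:P%:P%:F)%:M.
  by rewrite rbE rhoZ rho1 -[1]/(1%:M) scale_scalar_mx mulr1.
have rb_C i : rb (C_ i) = wc F i *: delta_mx i (Sn i) by rewrite rbE rho_c.
have rb_D i : rb (D_ i) = wd lam i *: delta_mx (Sn i) i by rewrite rbE rho_d.
exact: (corner_surface (kap := kapm) lam_sum EE EC CE ED DE kapC preproj_relation
  (preproj_e0_idem lam) ne rb_e rb_kap rb_C rb_D).
Qed.

End Preprojective.

(** * The lattices *)

Lemma second_difference (V : zmodType) (a b c : V) : a - c - (b - a) = a *+ 2 - b - c.
Proof. by rewrite opprB addrACA -mulr2n [- c + _]addrC addrA. Qed.

Lemma ordS_inord n m : (m < n)%N -> ordS (inord m : 'I_n.+1) = inord m.+1.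
Proof. by move=> mn; apply: val_inj; rewrite /= !inordK ?modn_small // ltnW. Qed.

Section LatticeQuotients.
Variables (F : closedFieldType) (n : nat) (lam : 'I_n.+1 -> F).
Local Notation N := (class_relations (nu lam)).
Local Notation Sn := (@ordS n.+1).
Local Notation pn := (@ord_pred n.+1).

Lemma span_subgroup (V : zmodType) (S : set V) : subgroup [set v | v \in span S].
Proof. by split=> [|u v hu hv]; [exact: rpred0 | exact: rpredB]. Qed.

Lemma L_mod_Qlambda_iso : zmod_iso (quotg N) (L_mod_Qlambda lam).
Proof.
pose W := [set v : 'rV[int]_n.+1 | v = \sum_i bas i].
pose f : {additive 'rV[int]_n.+1 -> L_mod_Qlambda lam} := quotg_pi (Qlambda_roots lam) \o quotg_pi W.
have fE v : f v = quotg_pi (Qlambda_roots lam) (quotg_pi W v) by [].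
apply: (first_iso (f := f)) => [w|v].
  by exists (repr (repr w)); rewrite fE !quotg_piK.
rewrite fE quotg_pi_eq0; split.
  have [v' hv'|g gE] := @quotg_lift_exists _ _ W (quotg_pi N).
    by apply/quotg_pi_eq0/mem_span; left.
  move=> hv; apply/quotg_pi_eq0; rewrite -gE; apply: span_ker hv.
  move=> _ [i [j [_ e ->]]]; rewrite raddfB /= !gE -raddfB.
  by apply/quotg_pi_eq0/mem_span; right; exists i, j.
apply: (span_sub (H := [set v | quotg_pi W v \in span (Qlambda_roots lam)])).
  split=> [|u w hu hw]; first by rewrite /= raddf0 rpred0.
  by rewrite /= raddfB rpredB.
move=> _ [->|[i [j [e ->]]]] /=.
  have -> : quotg_pi W (\sum_i bas i) = 0 by apply/quotg_pi_eq0/mem_span.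
  exact: rpred0.
have [->|ij] := eqVneq i j; first by rewrite subrr raddf0 rpred0.
by rewrite raddfB; apply: mem_span; exists i, j.
Qed.

Hypothesis lam_sum : \sum_i lam i = 0.
Hypothesis nu_interval : forall i j k : 'I_n.+1, nu lam i = nu lam j ->
  (i < k <= j)%N -> lam k = 0.

Lemma step_subproof i : (bas i - bas (Sn i) : 'rV[int]_n.+1) \in span
  [set x : 'rV[int]_n.+1 | exists i j, x = bas i - bas j].
Proof. by apply: mem_span; exists i, (Sn i). Qed.

(** The comparison with P sends r_i to t_i - t_(i+1). The sum of the r_i goes to 0, and r_i -
    r_(i-1) goes to 2 t_i - t_(i-1) - t_(i+1). *)
Definition step i : P_lattice n := exist (fun x => Defs.span _ x) _ (step_subproof i).

Definition stepmap (v : 'rV[int]_n.+1) : P_lattice n := \sum_i step i *~ v 0 i.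

Lemma stepmap_zmod_morphism : zmod_morphism stepmap.
Proof.
by move=> u v; rewrite /stepmap -sumrB; apply: eq_bigr => i _; rewrite !mxE mulrzBr.
Qed.

HB.instance Definition _ := GRing.isZmodMorphism.Build _ _ stepmap stepmap_zmod_morphism.

Lemma stepmap_bas i : stepmap (bas i) = step i.
Proof.
rewrite /stepmap (bigD1 i) //= /bas mxE !eqxx big1 ?addr0 // => j ji.
by rewrite mxE eqxx (negPf ji).
Qed.

Lemma sum_step : \sum_i step i = 0.
Proof.
apply: val_inj; rewrite raddf_sum /= sumrB.
rewrite [X in _ - X](reindex_inj (can_inj (@ord_predK n.+1))) /=.
by under [X in _ - X]eq_bigr do rewrite ord_predK; rewrite subrr.
Qed.

Lemma stepmap_surj w : exists v, stepmap v = w.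
Proof.
suff [v hv] : exists v, sval (stepmap v) = sval w by exists v; exact: val_inj.
apply: (span_sub (H := [set u | exists v, sval (stepmap v) = u])) (valP w).
  split=> [|_ _ [u <-] [v <-]]; first by exists 0; rewrite raddf0.
  by exists (u - v); rewrite raddfB.
have from0 m : (m <= n)%N -> exists v, sval (stepmap v) = bas ord0 - bas (inord m).
  elim: m => [_|m IH mn].
    exists 0; have -> : inord 0 = ord0 :> 'I_n.+1 by apply: val_inj; rewrite /= inordK.
    by rewrite raddf0 subrr.
  have [v hv] := IH (ltnW mn); exists (v + bas (inord m)).
  have -> : stepmap (v + bas (inord m)) = stepmap v + step (inord m).
    by rewrite raddfD /= stepmap_bas.
  rewrite -[LHS]/(sval (stepmap v) + sval (step (inord m))) hv.
  by rewrite -ordS_inord //= addrA subrK.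
move=> _ [i [j ->]]; have [u hu] := from0 i (leq_ord i); have [v hv] := from0 j (leq_ord j).
exists (v - u); have -> : stepmap (v - u) = stepmap v - stepmap u by rewrite raddfB.
rewrite -[LHS]/(sval (stepmap v) - sval (stepmap u)) hu hv !inord_val.
by rewrite opprB addrC addrA subrK.
Qed.

(** The coordinates of the image are cyclic differences, so the kernel consists of the constant
    vectors, the multiples of the sum of the r_i. *)
Lemma stepmap_entry v k : val (stepmap v) 0 (Sn k) = v 0 (Sn k) - v 0 k.
Proof.
have -> : val (stepmap v) = \sum_i (bas i - bas (Sn i)) *~ v 0 i.
  by rewrite /stepmap raddf_sum; apply: eq_bigr => i _; rewrite raddfMz.
rewrite summxE.
have basE (i j : 'I_n.+1) : (bas i : 'rV[int]_n.+1) 0 j = (i == j)%:R by rewrite /bas mxE eqxx eq_sym.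
have mE i : ((bas i - bas (Sn i) : 'rV[int]_n.+1) *~ v 0 i) 0 (Sn k) =
    ((i == Sn k)%:R - (i == k)%:R) * v 0 i.
  have -> : (bas i - bas (Sn i) : 'rV[int]_n.+1) *~ v 0 i = v 0 i *: (bas i - bas (Sn i)).
    by rewrite -[v 0 i in RHS]intz scaler_int.
  rewrite mxE mulrC; congr (_ * _); rewrite [LHS]mxE [(- bas (Sn i)) _ _]mxE !basE.
  by rewrite (inj_eq (can_inj (@ordSK n.+1))).
under eq_bigr do rewrite mE mulrBl.
have pick (l : 'I_n.+1) : \sum_i (i == l)%:R * v 0 i = v 0 l.
  by rewrite (bigD1 l) //= eqxx mul1r big1 ?addr0 // => i /negPf ->; rewrite mul0r.
by rewrite sumrB !pick.
Qed.

Lemma stepmap_ker v : stepmap v = 0 -> v \in span N.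
Proof.
move=> v0; have eqS k : v 0 (Sn k) = v 0 k.
  by apply/eqP; rewrite -subr_eq0 -stepmap_entry v0 mxE.
have const m : (m <= n)%N -> v 0 (inord m) = v 0 ord0.
  elim: m => [_|m IH mn]; first by congr (v _ _); apply: val_inj; rewrite /= inordK.
  by rewrite -ordS_inord // eqS IH // ltnW.
have -> : v = (\sum_i bas i) *~ v 0 ord0.
  rewrite {1}[v]row_sum_delta -scaler_int intz scaler_sumr.
  by apply: eq_bigr => i _; rewrite -(const i (leq_ord i)) inord_val.
apply: (subgroup_mulz (H := [set v | v \in span N])); first exact: span_subgroup.
by apply: mem_span; left.
Qed.

Lemma stepS_relation k : lam (Sn k) = 0 -> step (Sn k) - step k \in span (P_relations lam).
Proof.
move=> l0; apply: mem_span; exists (Sn k); split=> //=.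
by rewrite ordSK second_difference.
Qed.

(** lambda vanishes on every index after i up to j, and the corresponding relations of P
    telescope. *)
Lemma step_eq i j : nu lam i = nu lam j -> (i <= j)%N -> step j - step i \in span (P_relations lam).
Proof.
move=> e ij.
have chain m : (i + m <= j)%N -> step (inord (i + m)) - step i \in span (P_relations lam).
  elim: m => [|m IH] h; first by rewrite addn0 inord_val subrr rpred0.
  have hm : (i + m < n.+1)%N by rewrite (leq_ltn_trans _ (ltn_ord j)) // (leq_trans _ h) // addnS.
  have hS : inord (i + m.+1) = Sn (inord (i + m)).
    by rewrite addnS ordS_inord // -addnS; exact: leq_trans h (leq_ord j).
  rewrite hS -[step _](subrK (step (inord (i + m)))) -addrA; apply: rpredD.
    apply: stepS_relation; apply: (nu_interval e); rewrite -hS inordK; last exact: leq_ltn_trans h (ltn_ord j).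
    by rewrite h andbT addnS ltnS leq_addr.
  by apply: IH; apply: leq_trans h; rewrite addnS.
by have := chain (j - i)%N; rewrite subnKC // inord_val; apply.
Qed.

Lemma P_mod_relations_iso : zmod_iso (quotg N) (P_mod_relations lam).
Proof.
pose f : {additive 'rV[int]_n.+1 -> P_mod_relations lam} := quotg_pi (P_relations lam) \o stepmap.
have fE v : f v = quotg_pi (P_relations lam) (stepmap v) by [].
apply: (first_iso (f := f)) => [w|v].
  by have [v hv] := stepmap_surj (repr w); exists v; rewrite fE hv quotg_piK.
rewrite fE quotg_pi_eq0; split; last first.
  apply: (span_sub (H := [set v | stepmap v \in span (P_relations lam)])).
    split=> [|u w hu hw]; first by rewrite /= raddf0 rpred0.
    by rewrite /= raddfB rpredB.
  move=> _ [->|[i [j [e ->]]]] /=.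
    by rewrite raddf_sum /= (eq_bigr step) ?sum_step ?rpred0 // => i _; rewrite stepmap_bas.
  rewrite raddfB /= !stepmap_bas; have [ij|/ltnW ji] := leqP i j; last exact: step_eq.
  by rewrite -opprB rpredN; exact: step_eq.
(* Each relation of P lifts to r_i - r_(i-1), which belongs to the presentation because lambda_i = 0
   gives nu_i = nu_(i-1), cyclically at i = 0. What remains is the kernel of [stepmap]. *)
move=> hv; have [v' [hv' e]] : exists v', v' \in span N /\ stepmap v' = stepmap v.
  apply: (span_sub (H := [set w | exists v', v' \in span N /\ stepmap v' = w])) hv.
    split=> [|_ _ [u [hu <-]] [w [hw <-]]]; first by exists 0; rewrite raddf0 rpred0.
    by exists (u - w); rewrite raddfB rpredB.
  move=> w [i [l0 ew]]; exists (bas i - bas (pn i)); split.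
    apply: mem_span; right; exists i, (pn i); split=> //.
    by rewrite -{1}(@ord_predK n.+1 i) nuS // ord_predK l0 addr0.
  by apply: val_inj; rewrite raddfB /= !stepmap_bas [RHS]ew /= ord_predK second_difference.
rewrite -[v](subrK v'); apply: rpredD => //; apply: stepmap_ker.
by rewrite raddfB /= e subrr.
Qed.

End LatticeQuotients.

(** Nonnegativity of lambda_1, ..., lambda_n makes nu increase weakly from 0 to n, so equal values
    at i and j force it to be constant in between. *)
Lemma nu_interval_of_order (F : closedFieldType) (le : rel F) n (lam : 'I_n.+1 -> F) :
  additive_order le -> \sum_i lam i = 0 -> (forall i : 'I_n.+1, i != ord0 -> le 0 (lam i)) ->
  forall i j k : 'I_n.+1, nu lam i = nu lam j -> (i < k <= j)%N -> lam k = 0.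
Proof.
move=> [le_refl le_anti le_tr le_add] s0 pos i j k e /andP[ik kj].
have mono d m : (m + d <= n)%N -> le (nu lam (inord m)) (nu lam (inord (m + d))).
  elim: d => [|d IH] h; first by rewrite addn0.
  apply: le_tr (IH _) _; first by apply: leq_trans h; rewrite addnS.
  rewrite addnS -ordS_inord -?addnS // nuS // -{1}[nu lam _]addr0; apply: le_add; apply: pos.
  by rewrite ordS_inord -?addnS // -val_eqE /= inordK // addnS.
have {}mono (a b : 'I_n.+1) : (a <= b)%N -> le (nu lam a) (nu lam b).
  by move=> ab; have := mono (b - a)%N a; rewrite subnKC // !inord_val -ltnS; apply.
have k0 : k != ord0 by rewrite -val_eqE -lt0n (leq_ltn_trans _ ik).
have k1 : (0 < k)%N by exact: leq_ltn_trans ik.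
have pk : (ord_pred k).+1 = k :> nat.
  rewrite /=; have -> : (k + n.+1).-1 = (k.-1 + n.+1)%N by lia.
  by rewrite modnDr modn_small ?prednK // (leq_trans _ (ltn_ord k)) // ltnS leq_pred.
have nuk : nu lam k = nu lam (ord_pred k) + lam k by rewrite -{1 3}(@ord_predK n.+1 k) nuS.
(* The reverse inequality: nu_k <= nu_j = nu_i <= nu_(k-1). *)
have lek : le (nu lam k) (nu lam (ord_pred k)).
  apply: le_tr (mono _ _ kj) _; rewrite -e; apply: mono.
  by rewrite -ltnS pk.
have eqk : nu lam k = nu lam (ord_pred k).
  apply: le_anti; rewrite lek nuk -{1}[nu lam (ord_pred k)]addr0.
  by apply: le_add; exact: pos.
by apply: (addrI (nu lam (ord_pred k))); rewrite -nuk eqk addr0.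
Qed.

Theorem corollary4p3p4 (R : realType) (leC : rel R[i]) (n : nat)
    (lam : 'I_n.+1 -> R[i])
    (hle : additive_order leC)
    (hn : (1 <= n)%N)
    (hsum : \sum_i lam i = 0)
    (hpos : forall i : 'I_n.+1, i != ord0 -> leC 0 (lam i)) :
  [/\ zmod_iso (G0 (Olambda lam)) (int * Cl (Olambda lam))%type,
      zmod_iso (Cl (Olambda lam)) (L_mod_Qlambda lam)
    & zmod_iso (L_mod_Qlambda lam) (P_mod_relations lam)].
Proof.
have nu_int := nu_interval_of_order hle hsum hpos.
have [A [eA [ix [iy hA]]]] := Olambda_surface hsum.
have Liso := L_mod_Qlambda_iso lam.
split.
- by rewrite -eA; exact: surface_G0 hA.
- rewrite -eA; apply: zmod_iso_trans Liso; apply: zmod_iso_sym; exact: surface_Cl hA.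
- exact: zmod_iso_trans (zmod_iso_sym Liso) (P_mod_relations_iso hsum nu_int).
Qed.
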